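(* Let $n\ge 1$, let $h:[0,\infty)\to[0,\infty)$ be a continuous function with $\int_0^\infty r^{2m+2n-1}e^{-2h(r)}\,dr<\infty$ for every $m\in\mathbb{N}_0$, and let $\mathbf{m}=(b_1,\dots,b_k)$ be a partition of $n=b_1+\dots+b_k$. The representation $\pi_{\mathbf{m}}$ of the group $\mathbf{U_m}=\mathrm{U}(b_1)\times\dots\times\mathrm{U}(b_k)$ on $\mathcal{A}_h(\mathbb{C}^n)$ is multiplicity-free, and its isotypic decomposition is $$\mathcal{A}_h(\mathbb{C}^n)=\bigoplus_{s_1,\dots,s_k=0}^{\infty}P^{s_1}(\mathbb{C}^{b_1})\otimes\dots\otimes P^{s_k}(\mathbb{C}^{b_k}).$$
   Context: $\mathbb{N}_0=\{0,1,2,\dots\}$. Put $h(z):=h(|z|)$ for $z\in\mathbb{C}^n$. $L^2_h(\mathbb{C}^n)$ is the Hilbert space of (classes of) Lebesgue measurable functions $f$ on $\mathbb{C}^n$ with $\|f\|_h^2=\int_{\mathbb{C}^n}|f(z)|^2e^{-2h(z)}\,dz<\infty$, where $dz$ is Lebesgue measure. The radially weighted Fock space $\mathcal{A}_h(\mathbb{C}^n)$ is the closed subspace of entire functions in $L^2_h(\mathbb{C}^n)$. Given the partition $\mathbf{m}=(b_1,\dots,b_k)$ (positive integers summing to $n$), write $z=(z_{(1)},\dots,z_{(k)})\in\mathbb{C}^{b_1}\times\dots\times\mathbb{C}^{b_k}=\mathbb{C}^n$. The group $\mathbf{U_m}$ is embedded block-diagonally in $\mathrm{U}(n)$, and $\pi_{\mathbf{m}}$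 is its unitary representation on $\mathcal{A}_h(\mathbb{C}^n)$ given by $(\pi_{\mathbf{m}}(A_1,\dots,A_k)f)(z)=f(A_1^{-1}z_{(1)},\dots,A_k^{-1}z_{(k)})$. $P^{s}(\mathbb{C}^{b})$ is the space of homogeneous holomorphic polynomials of degree $s$ on $\mathbb{C}^b$, and $P^{s_1}(\mathbb{C}^{b_1})\otimes\dots\otimes P^{s_k}(\mathbb{C}^{b_k})$ is identified with the span in $\mathcal{A}_h(\mathbb{C}^n)$ of the products $p_1(z_{(1)})\cdots p_k(z_{(k)})$ with $p_j\in P^{s_j}(\mathbb{C}^{b_j})$. The direct sum is an orthogonal Hilbert-space direct sum. A unitary representation is multiplicity-free if it is a Hilbert direct sum of pairwise inequivalent irreducible representations; the isotypic decomposition is the decomposition into isotypic components (the closed spans of all subrepresentations equivalent to a given irreducible one), which in the multiplicity-free case are the irreducible summands themselves. *)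

(* Defs.v *)
From HB Require Import structures.
From mathcomp Require Import all_boot all_order all_algebra.
From mathcomp Require Import spectral complex.
From mathcomp Require Import all_classical all_reals all_analysis.
From mathcomp Require mpoly.

Set Implicit Arguments.
Unset Strict Implicit.
Unset Printing Implicit Defensive.

Import Order.TTheory GRing.Theory Num.Theory.
Import numFieldNormedType.Exports.

Local Open Scope classical_set_scope.
Local Open Scope ring_scope.

(* The product measure nu^N on N-tuples, built one factor at a time. *)
Section ProductCons.
Context d (T : measurableType d) (R : realType) (N : nat).
Variable nu : {sigma_finite_measure set T -> \bar R}.
Variable mu : {sigma_finite_measure set (N.-tuple T) -> \bar R}.

Let cons_pair (p : T * N.-tuple T) : N.+1.-tuple T := [tuple of p.1 :: p.2].

Definition product_cons : set (N.+1.-tuple T) -> \bar R :=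
  pushforward (nu \x mu)%E cons_pair.

Let measurable_cons_pair : measurable_fun [set: T * N.-tuple T] cons_pair.
Proof. exact: (measurable_cons measurable_fst measurable_snd). Qed.

Let measurable_preimage A : measurable A -> measurable (cons_pair @^-1` A).
Proof.
by move=> mA; rewrite -[X in measurable X]setTI; exact: measurable_cons_pair.
Qed.

Let product_cons0 : product_cons set0 = 0%E.
Proof. by rewrite /product_cons /pushforward preimage_set0 measure0. Qed.

Let product_cons_ge0 A : (0 <= product_cons A)%E.
Proof. exact: measure_ge0. Qed.

Let product_cons_sigma_additive : semi_sigma_additive product_cons.
Proof.
move=> F mF tF mUF; rewrite /product_cons /pushforward preimage_bigcup.
apply: measure_semi_sigma_additive.
- by move=> i; exact: measurable_preimage.
- by move=> i j _ _ [p [Fi Fj]]; apply: (tF i j) => //; exists (cons_pair p).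
- by rewrite -preimage_bigcup; exact: measurable_preimage.
Qed.

HB.instance Definition _ := isMeasure.Build _ _ _ product_cons
  product_cons0 product_cons_ge0 product_cons_sigma_additive.

Let product_cons_sigma_finite : sigma_finite [set: N.+1.-tuple T] product_cons.
Proof.
have /sigma_finiteP[F [TF ndF Foo]] := sigma_finiteT nu.
have /sigma_finiteP[G [TG ndG Goo]] := sigma_finiteT mu.
exists (fun n => [set t | F n (thead t) /\ G n [tuple of behead t]]).
  rewrite predeqE => t; split=> // _.
  have [i _ Fi] : (\bigcup_i F i) (thead t) by rewrite -TF.
  have [j _ Gj] : (\bigcup_j G j) [tuple of behead t] by rewrite -TG.
  exists (maxn i j) => //; split.
  - by move: Fi; exact/subsetPset/ndF/leq_maxl.
  - by move: Gj; exact/subsetPset/ndG/leq_maxr.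
move=> n; have [mF Fn] := Foo n; have [mG Gn] := Goo n; split.
  apply: measurableI; rewrite -[X in measurable X]setTI.
  - exact: measurable_tnth.
  - exact: measurable_behead.
rewrite /product_cons /pushforward (_ : _ @^-1` _ = F n `*` G n).
  by rewrite product_measure1E// lte_mul_pinfty// ge0_fin_numE.
have consK (p : T * N.-tuple T) : [tuple of behead (cons_pair p)] = p.2.
  exact/val_inj.
by apply/seteqP; split=> p; rewrite /= consK theadE.
Qed.

HB.instance Definition _ :=
  Measure_isSigmaFinite.Build _ _ _ product_cons
    product_cons_sigma_finite.
End ProductCons.

Fixpoint product_tuple d (T : measurableType d) (R : realType)
    (nu : {sigma_finite_measure set T -> \bar R}) (N : nat) :
    {sigma_finite_measure set (N.-tuple T) -> \bar R} :=
  match N with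
  | 0 => \d_([tuple] : 0.-tuple T)
  | N'.+1 => product_cons nu (product_tuple nu N')
  end.

Definition lebesgue_tuple (R : realType) (N : nat) :
    {sigma_finite_measure set (N.-tuple (measurableTypeR R)) -> \bar R} :=
  product_tuple (@lebesgue_measure R) N.

(* A unitary representation is given by concrete data: a Hilbert space H sitting
   inside a complex vector space V, with inner product ip (only relevant on
   H), and a set Gs of group elements acting by act. The predicates below are
   meant for data that do form a unitary representation on a Hilbert space. *)
Section UnitaryRepresentations.
Variables (R : realType) (V : lmodType R[i]).
Variables (H : set V) (ip : V -> V -> R[i]).
Variables (G : Type) (Gs : set G) (act : G -> V -> V).
Implicit Types (W A : set V) (u v : V).

Definition hnorm u : R := Num.sqrt (complex.Re (ip u u)).

Definition lspan A : set V :=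
  [set v | exists (N : nat) (c : 'I_N -> R[i]) (u : 'I_N -> V),
     (forall l, A (u l)) /\ v = \sum_(l < N) c l *: u l].

(* The closure of A in H, for the norm of H. *)
Definition hclosure A : set V :=
  [set u | H u /\
     forall e : R, 0 < e -> exists2 v, A v & hnorm (u - v) < e].

Definition closed_subspace W : Prop :=
  [/\ W `<=` H, W 0,
      forall (a : R[i]) u v, W u -> W v -> W (a *: u + v)
    & hclosure W `<=` W].

Definition subrep W : Prop :=
  closed_subspace W /\ forall g, Gs g -> forall u, W u -> W (act g u).

Definition irreducible_subrep W : Prop :=
  [/\ subrep W, exists2 u, W u & u <> 0
    & forall W', subrep W' -> W' `<=` W -> W' = [set 0] \/ W' = W].

(* Unitary equivalence: T is only relevant on W1, where it is a linear
   isometry onto W2 intertwining the two actions. *)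
Definition equivalent_subrep W1 W2 : Prop :=
  exists T : V -> V,
    [/\ T @` W1 = W2,
        forall (a : R[i]) u v, W1 u -> W1 v -> T (a *: u + v) = a *: T u + T v,
        forall u v, W1 u -> W1 v -> ip (T u) (T v) = ip u v
      & forall g, Gs g -> forall u, W1 u -> T (act g u) = act g (T u)].

Definition isotypic_component W : set V :=
  hclosure (lspan
    (\bigcup_(W' in [set W' | subrep W' /\ equivalent_subrep W W']) W')).

Definition hilbert_direct_sum (I : Type) (E : I -> set V) : Prop :=
  [/\ forall i, closed_subspace (E i),
      forall i j, i <> j -> forall u v, E i u -> E j v -> ip u v = 0
    & hclosure (lspan (\bigcup_i E i)) = H].

Definition multiplicity_free : Prop :=
  exists (I : Type) (E : I -> set V),
    [/\ hilbert_direct_sum E,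
        forall i, irreducible_subrep (E i)
      & forall i j, i <> j -> ~ equivalent_subrep (E i) (E j)].

(* H is the Hilbert direct sum of the E i, and these are exactly the isotypic
   components of the representation. *)
Definition isotypic_decomposition (I : Type) (E : I -> set V) : Prop :=
  [/\ hilbert_direct_sum E,
      forall i, exists2 W, irreducible_subrep W & E i = isotypic_component W
    & forall W, irreducible_subrep W -> exists i, E i = isotypic_component W].

End UnitaryRepresentations.

(* R[i]^o is C as a one-dimensional normed space over itself; this is what
   differentiable needs to mean complex differentiability. *)
Notation cfun R n := ('cV[R[i]]_n -> R[i]^o).

Section FockSpace.
Variable R : realType.

Definition sqnorm (c : R[i]) : R := complex.Re c ^+ 2 + complex.Im c ^+ 2.

(* The Euclidean norm; the library's norm on matrices is the sup norm. *)
Definition eucl_norm n (z : 'cV[R[i]]_n) : R :=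
  Num.sqrt (\sum_i sqnorm (z i 0)).

(* C^n is identified with R^(2n); integrals over C^n are computed in the
   coordinates (x_1, ..., x_n, y_1, ..., y_n) of z = x + i y. *)
Definition cvec n (x : (n + n).-tuple (measurableTypeR R)) : 'cV[R[i]]_n :=
  \col_i (tnth x (lshift n i) +i* tnth x (rshift n i))%C.

Definition fock_weight n (h : R -> R) (z : 'cV[R[i]]_n) : R :=
  expR (- 2 * h (eucl_norm z)).

Definition entire n (f : cfun R n) : Prop := forall z, differentiable f z.

Definition fock_space n (h : R -> R) : set (cfun R n) :=
  [set f | entire f /\
     (\int[lebesgue_tuple R (n + n)]_x
        (sqnorm (f (cvec x)) * fock_weight h (cvec x))%:E < +oo)%E].

Definition fock_ip n (h : R -> R) (f g : cfun R n) : R[i] :=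
  let F x := (f (cvec x) : R[i]) * conjc (g (cvec x)) *
             (fock_weight h (cvec x))%:C%C in
  ((\int[lebesgue_tuple R (n + n)]_x complex.Re (F x)) +i*
   (\int[lebesgue_tuple R (n + n)]_x complex.Im (F x)))%C.

Definition homog_poly n (s : nat) : set (cfun R n) :=
  [set f | exists p : mpoly.dhomog n R[i] s,
     forall z : 'cV_n,
       f z = mpoly.meval (fun i => z i 0) (mpoly.mpoly_of_dhomog p)].

Section Partition.
Variables (k : nat) (b : 'I_k -> nat).

Definition block_unitary : set (forall j, 'M[R[i]]_(b j)) :=
  [set A | forall j, A j \is unitarymx].

Definition block_action (A : forall j, 'M[R[i]]_(b j))
    (f : cfun R (\sum_j b j)) : cfun R (\sum_j b j) :=
  fun z => f (\mxcol_j (invmx (A j) *m submxcol z j)).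

Definition homog_tensor (s : 'I_k -> nat) : set (cfun R (\sum_j b j)) :=
  lspan [set f : cfun R (\sum_j b j) | exists2 p : forall j, cfun R (b j),
     forall j, homog_poly (s j) (p j)
     & forall z, f z = \prod_j (p j (submxcol z j) : R[i])].

End Partition.
End FockSpace.

(* Main.v *)
(** The summands are the weight spaces of the scalar subgroup U(1)^k of the group:
an entire function on which (l_1, ..., l_k) acts by l_1^s_1 ... l_k^s_k is homogeneous of
degree s_1 + ... + s_k, hence equal to one of its Taylor components, hence a polynomial
by Euler's identity, and averaging over the scalars leaves only monomials of block degrees
s_1, ..., s_k. This makes the summands closed and invariant, and pairwise orthogonal and
inequivalent.

Polynomials are dense because the Taylor components of f are limits of averages of
z |-> f(w z) over roots of unity w: Parseval's identity on these roots and Fatou's lemma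
give Bessel's inequality, and then convergence of the Taylor series in norm.

A nonzero invariant subspace of a summand contains a monomial, by averaging over the
diagonal unitary matrices. In each block there is a real symmetric unitary matrix with
positive first row and column; it maps every monomial to a polynomial with a nonzero
coefficient at the monomial in the first coordinates of the blocks, and maps the latter to
a polynomial with no zero coefficient. Averaging again, the subspace contains all monomials.
An arbitrary irreducible subrepresentation contains the Taylor components of its
elements, hence a monomial, hence is one of the summands. *)

Require Import Defs.
From HB Require Import structures.
From mathcomp Require Import all_boot all_order all_algebra.
From mathcomp Require Import cyclic separable cyclotomic spectral complex.
From mathcomp Require Import ring lra.
From mathcomp Require Import all_classical all_reals all_analysis.
From mathcomp Require Import measurable_realfun.
From mathcomp Require mpoly.

Set Implicit Arguments.
Unset Strict Implicit.
Unset Printing Implicit Defensive.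

Import Order.TTheory GRing.Theory Num.Theory.
Import numFieldNormedType.Exports.
Import Normc.

Local Open Scope classical_set_scope.
Local Open Scope ring_scope.

(** * Complex numbers *)

(** [entire] asks for complex differentiability at each point and says nothing on continuity of the
    derivative, so the function theory starts from Goursat's theorem. It is developed in one
    variable: functions on [C^n] are restricted to complex lines, bounded on discs of radius 2 and
    evaluated in the unit disc, so that errors are of order [2^-N], uniformly on balls. This
    uniformity carries differentiability in several variables through limits.

    Averages over roots of unity replace integrals over circles and tori because they are finite
    linear combinations of group translates: they stay in an invariant subspace by linearity, and
    all their terms have the same weighted norm.

    Each summand is described intrinsically, as the entire functions of a given weight. Weights are
    respected by the action, by intertwiners and by norm limits, which yields invariance,
    inequivalence and closedness without computing with polynomials.

    The integrability hypothesis on [h] is one-dimensional, while norms are integrals over [R^(2n)];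
    a comparison of radial integrals with it puts the monomials in the space. *)

Section ComplexNumbers.
Variable R : realType.
Local Notation C := R[i].
Implicit Types (w x y z : C).

Lemma sqnormE z : sqnorm z = normc z ^+ 2.
Proof. by case: z => a b; rewrite /sqnorm /normc /= sqr_sqrtr // addr_ge0 // sqr_ge0. Qed.

Lemma sqnormM x y : sqnorm (x * y) = sqnorm x * sqnorm y.
Proof. by rewrite !sqnormE normcM exprMn. Qed.

Lemma sqnorm_ge0 z : 0 <= sqnorm z.
Proof. by rewrite addr_ge0 // sqr_ge0. Qed.

Lemma sqnormC z : (sqnorm z)%:C%C = z * conjc z.
Proof.
by case: z => a b; rewrite /sqnorm /=; simpc; congr (_ +i* _)%C; ring.
Qed.

Lemma normc_ge0 z : 0 <= normc z.
Proof. by case: z => a b; rewrite sqrtr_ge0. Qed.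

Lemma normcE z : `|z| = (normc z)%:C%C.
Proof. by case: z => a b; rewrite normc_def. Qed.

Lemma normc_eq0 z : (normc z == 0) = (z == 0).
Proof.
by apply/eqP/eqP => [|->]; [exact: eq0_normc | exact: normc0].
Qed.

Lemma normc_gt0 z : (0 < normc z) = (z != 0).
Proof. by rewrite lt_def normc_ge0 andbT normc_eq0. Qed.

Lemma normcX z n : normc (z ^+ n) = normc z ^+ n.
Proof. by elim: n => [|n IH]; rewrite ?normc1 // !exprS normcM IH. Qed.

Lemma normc_real (a : R) : normc a%:C%C = `|a|.
Proof. by rewrite /normc /= expr0n /= addr0 sqrtr_sqr. Qed.

Lemma normc_nat n : normc n%:R = n%:R :> R.
Proof. by rewrite -(rmorph_nat (real_complex R)) normc_real normr_nat. Qed.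

Lemma normcN z : normc (- z) = normc z.
Proof. by case: z => a b; rewrite /normc /= !sqrrN. Qed.

Lemma le_normcD x y : normc (x + y) <= normc x + normc y.
Proof. by rewrite -lecR rmorphD /= -!normcE ler_normD. Qed.

Lemma distc_sym x y : normc (x - y) = normc (y - x).
Proof. by rewrite -opprB normcN. Qed.

Lemma le_normcB x y : normc (x - y) <= normc x + normc y.
Proof. by rewrite -[normc y]normcN; apply: le_normcD. Qed.

Lemma ler_dist_normc x y : `|normc x - normc y| <= normc (x - y).
Proof.
have h1 := le_normcD (x - y) y; have h2 := le_normcD (y - x) x.
rewrite !subrK (distc_sym y) in h1 h2.
by rewrite ler_norml; apply/andP; split; clear -h1 h2; lra.
Qed.

Lemma le_normc_sum (I : Type) (r : seq I) (P : pred I) (F : I -> C) :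
  normc (\sum_(i <- r | P i) F i) <= \sum_(i <- r | P i) normc (F i).
Proof.
elim/big_rec2: _ => [|i y1 y2 _ h]; first by rewrite normc0.
exact: le_trans (le_normcD _ _) (lerD _ h).
Qed.

Lemma normc_prod (I : Type) (r : seq I) (P : pred I) (F : I -> C) :
  normc (\prod_(i <- r | P i) F i) = \prod_(i <- r | P i) normc (F i).
Proof. exact: (big_morph _ (@normcM R) (normc1 R)). Qed.

Lemma Re_le_normc z : `|complex.Re z| <= normc z.
Proof.
case: z => a b /=; rewrite -sqrtr_sqr ler_sqrt ?addr_ge0 ?sqr_ge0 //.
by rewrite lerDl sqr_ge0.
Qed.

Lemma Im_le_normc z : `|complex.Im z| <= normc z.
Proof.
case: z => a b /=; rewrite -sqrtr_sqr ler_sqrt ?addr_ge0 ?sqr_ge0 //.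
by rewrite lerDr sqr_ge0.
Qed.

Lemma normc_le_ReIm z : normc z <= `|complex.Re z| + `|complex.Im z|.
Proof.
case: z => a b /=; rewrite -[leRHS]ger0_norm ?addr_ge0 // -sqrtr_sqr.
rewrite ler_sqrt ?sqr_ge0 // sqrrD !real_normK ?num_real //.
by rewrite -addrA lerD2l lerDr mulrn_wge0 // mulr_ge0.
Qed.

Lemma complex_eqP x y :
  (complex.Re x = complex.Re y) -> (complex.Im x = complex.Im y) -> x = y.
Proof. by case: x y => a b [c d] /= -> ->. Qed.

Lemma cReD x y : complex.Re (x + y) = complex.Re x + complex.Re y.
Proof. by case: x y => a b [c d]. Qed.
Lemma cImD x y : complex.Im (x + y) = complex.Im x + complex.Im y.
Proof. by case: x y => a b [c d]. Qed.
Lemma cReB x y : complex.Re (x - y) = complex.Re x - complex.Re y.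
Proof. by case: x y => a b [c d]. Qed.
Lemma cImB x y : complex.Im (x - y) = complex.Im x - complex.Im y.
Proof. by case: x y => a b [c d]. Qed.
Lemma cReM x y : complex.Re (x * y) =
  complex.Re x * complex.Re y - complex.Im x * complex.Im y.
Proof. by case: x y => a b [c d]. Qed.
Lemma cImM x y : complex.Im (x * y) =
  complex.Re x * complex.Im y + complex.Im x * complex.Re y.
Proof. by case: x y => a b [c d]. Qed.

Lemma normci : normc ('i%C : C) = 1.
Proof. by rewrite /normc expr0n /= add0r expr1n sqrtr1. Qed.

Lemma complexi_neq0 : 'i%C != 0 :> C.
Proof. by rewrite -normc_gt0 normci. Qed.

Lemma normc_small0 z : (forall e : R, 0 < e -> normc z <= e) -> z = 0.
Proof.
move=> h; apply/eqP; rewrite -normc_eq0 eq_le normc_ge0 andbT.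
by apply/ler_addgt0Pr => e e0; rewrite add0r; apply: h.
Qed.

(** [X^n - 1] splits over an algebraically closed field and is separable in characteristic 0, so it
    has [n] distinct roots, and one of them generates the others. *)
Lemma complex_prim_root_exists n : (0 < n)%N ->
  exists w : C, n.-primitive_root w.
Proof.
pose p : {poly C} := 'X^n - 1; have [r Dp] := closed_field_poly_normal p.
move=> n_gt0; rewrite (monicP _) ?monicXnsubC // scale1r in Dp.
have rn1: all n.-unity_root r by apply/allP=> z; rewrite -root_prod_XsubC -Dp.
have sz_r: (n < (size r).+1)%N.
  by rewrite -(size_prod_XsubC r id) -Dp size_XnsubC.
have [|z] := hasP (has_prim_root n_gt0 rn1 _ sz_r); last by exists z.
by rewrite -separable_prod_XsubC -Dp separable_Xn_sub_1 // pnatr_eq0 -lt0n.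
Qed.

Lemma normc_unity n w : (0 < n)%N -> w ^+ n = 1 -> normc w = 1.
Proof.
move=> n0 wn; apply/eqP; rewrite -(@eqrXn2 _ n) // ?normc_ge0 //.
by rewrite -normcX wn normc1 expr1n.
Qed.

Lemma prim_root_neq0 n w : n.-primitive_root w -> w != 0.
Proof.
move=> pw; apply/eqP => w0; move: (prim_expr_order pw).
by rewrite w0 expr0n gtn_eqF ?(prim_order_gt0 pw) // => /eqP; rewrite eq_sym oner_eq0.
Qed.

Lemma normc_prim_root n w k : n.-primitive_root w -> normc (w ^+ k) = 1.
Proof.
move=> pw; rewrite normcX (normc_unity (prim_order_gt0 pw)) ?expr1n //.
exact: prim_expr_order.
Qed.

(** Orthogonality of the characters of [Z/n]: the summand is the [k]-th power of [v = w^(j - d)],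
    and the geometric sum of an [n]-th root of unity [v] vanishes unless [v = 1]. *)
Lemma unity_root_average n w (d j : nat) : n.-primitive_root w ->
  n%:R^-1 * (\sum_(k < n) ((w ^+ k) ^+ d)^-1 * (w ^+ k) ^+ j) =
  (j == d %[mod n])%:R.
Proof.
move=> pw; have n0 := prim_order_gt0 pw; have w0 := prim_root_neq0 pw.
have E k : ((w ^+ k) ^+ d)^-1 * (w ^+ k) ^+ j = (w ^- d * w ^+ j) ^+ k.
  by rewrite exprMn exprVn -!exprM !(mulnC k).
rewrite (eq_bigr _ (fun (k : 'I_n) _ => E k)).
set v := w ^- d * w ^+ j.
have n0' : n%:R != 0 :> C by rewrite pnatr_eq0 -lt0n.
have v1 : (v == 1) = (j == d %[mod n]).
  rewrite -(eq_prim_root_expr pw) -(inj_eq (mulfI (expf_neq0 d w0))).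
  by rewrite mulr1 /v mulrA divff ?expf_neq0 // mul1r.
case: eqP v1 => [->|vn1] <-.
  under eq_bigr do rewrite expr1n.
  by rewrite sumr_const card_ord mulVf.
suff -> : \sum_(k < n) v ^+ k = 0 by rewrite mulr0.
have vn : v ^+ n = 1.
  by rewrite /v exprMn exprVn -!exprM !(mulnC _ n) !exprM (prim_expr_order pw) !expr1n invr1 mulr1.
apply: (mulfI (x := v - 1)); first by rewrite subr_eq0; apply/eqP.
by rewrite mulr0 -subrX1 vn subrr.
Qed.

Lemma complex_root_N1 m : (0 < m)%N -> exists2 w : C, w ^+ m = -1 & normc w = 1.
Proof.
move=> m0; exists (m.-root (-1)); first by rewrite rootCK.
apply: (@normc_unity (m * 2)); first by rewrite muln_gt0 m0.
by rewrite exprM rootCK // sqrrN expr1n.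
Qed.

End ComplexNumbers.

(** * Cauchy's formula *)

Section Primitives.
Variables (R : realType) (A : R).
Local Notation C := R[i].
Implicit Types (f g F : R -> R) (phi psi : R -> C).

(* The base point A is kept below all bounds of integration, where prim f is
   differentiable: outside it the integral over an empty interval is 0. *)
Definition prim f (x : R) : R := \int[@lebesgue_measure R]_(t in `[A, x]) f t.

Lemma is_derive_prim f x : continuous f -> A < x -> is_derive x 1 (prim f) (f x).
Proof.
move=> cf Ax.
have [] := @continuous_FTC1_closed R f A x (x + 1) _ _ Ax (cf x).
- by rewrite ltrDl.
- apply: continuous_compact_integrable; first exact: segment_compact.
  exact: continuous_subspaceT.
by move=> df dfE; split; [exact: df | rewrite -derive1E; exact: dfE].
Qed.

(** As a difference of values it is additive in the bounds and makes sense for [b < a]. *)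
Definition rint f a b := prim f b - prim f a.

(** By the mean value theorem [F - prim f], of derivative 0, is constant. This uniqueness of
    primitives also gives the linearity of [rint] and its independence of the base point. *)
Lemma rint_FTC F f a b : continuous f -> A < a -> A < b ->
  (forall x, A < x -> is_derive x 1 F (f x)) -> rint f a b = F b - F a.
Proof.
move=> cf; wlog ab : a b / a < b => [hw Aa Ab dF|Aa Ab dF].
  have [ab|ba|->] := ltgtP a b; first exact: hw.
    by rewrite /rint -opprB -[RHS]opprB -[in RHS]hw.
  by rewrite /rint !subrr.
pose D x := F x - prim f x.
have dD x : A < x -> is_derive x 1 D 0.
  move=> Ax; have := is_deriveB (dF x Ax) (is_derive_prim cf Ax).
  by rewrite subrr.
have [] := @MVT R D (fun=> 0) a b ab.
- move=> x; rewrite in_itv /= => /andP[ax _]; apply: dD; exact: lt_trans ax.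
- apply: derivable_within_continuous => x; rewrite in_itv /= => /andP[ax _].
  by have [] := dD x (lt_le_trans Aa ax).
move=> c _; rewrite mul0r /D /rint; lra.
Qed.

Lemma rintD f g a b : continuous f -> continuous g -> A < a -> A < b ->
  rint (fun x => f x + g x) a b = rint f a b + rint g a b.
Proof.
move=> cf cg Aa Ab; pose F x := prim f x + prim g x.
transitivity (F b - F a); last by rewrite /F /rint; ring.
apply: rint_FTC => // x; first by apply: cvgD; [exact: cf | exact: cg].
by move=> Ax; apply: is_deriveD; apply: is_derive_prim.
Qed.

Lemma rintZ c f a b : continuous f -> A < a -> A < b ->
  rint (fun x => c * f x) a b = c * rint f a b.
Proof.
move=> cf Aa Ab; pose F x := c * prim f x.
transitivity (F b - F a); last by rewrite /F /rint; ring.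
apply: rint_FTC => // x; first by apply: cvgM; [exact: cvg_cst | exact: cf].
move=> Ax; exact: (is_deriveZ c (is_derive_prim cf Ax)).
Qed.

Lemma rint_bound f M a b : continuous f -> A < a -> a <= b ->
  (forall x, a <= x <= b -> `|f x| <= M) -> `|rint f a b| <= M * (b - a).
Proof.
move=> cf Aa; rewrite le_eqVlt => /predU1P[<- _|ab fM].
  by rewrite /rint !subrr normr0 mulr0.
have [] := @MVT R (prim f) f a b ab.
- move=> x; rewrite in_itv /= => /andP[ax _]; apply: is_derive_prim => //.
  exact: lt_trans ax.
- apply: derivable_within_continuous => x; rewrite in_itv /= => /andP[ax _].
  by have [] := is_derive_prim cf (lt_le_trans Aa ax).
move=> c; rewrite in_itv /= => /andP[ac cb] E.
rewrite /rint E normrM ler_pM // ?fM ?(ltW ac) ?(ltW cb) //.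
by rewrite ger0_norm // subr_ge0 ltW.
Qed.

Definition ccont phi :=
  continuous (fun x => complex.Re (phi x)) /\ continuous (fun x => complex.Im (phi x)).

Definition cderiv (Phi phi : R -> C) (x : R) :=
  is_derive x 1 (fun x : R => complex.Re (Phi x) : R) (complex.Re (phi x)) /\
  is_derive x 1 (fun x : R => complex.Im (Phi x) : R) (complex.Im (phi x)).

Definition cint phi a b : C :=
  (rint (fun x => complex.Re (phi x)) a b +i* rint (fun x => complex.Im (phi x)) a b)%C.

Lemma ccont_cst c : ccont (fun=> c).
Proof. by split=> x; apply: cvg_cst. Qed.

Lemma ccontD phi psi : ccont phi -> ccont psi -> ccont (fun x => phi x + psi x).
Proof.
move=> [pr pi] [sr si]; split=> x.
  rewrite (_ : (fun _ => _) = (fun x => complex.Re (phi x) + complex.Re (psi x))).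
    by apply: cvgD; [exact: pr | exact: sr].
  by apply/funext => y; rewrite cReD.
rewrite (_ : (fun _ => _) = (fun x => complex.Im (phi x) + complex.Im (psi x))).
  by apply: cvgD; [exact: pi | exact: si].
by apply/funext => y; rewrite cImD.
Qed.

Lemma ccontM phi psi : ccont phi -> ccont psi -> ccont (fun x => phi x * psi x).
Proof.
move=> [pr pi] [sr si]; split=> x.
  rewrite (_ : (fun _ => _) = (fun x => complex.Re (phi x) * complex.Re (psi x)
      - complex.Im (phi x) * complex.Im (psi x))).
    apply: cvgB; apply: cvgM; [exact: pr | exact: sr | exact: pi | exact: si].
  by apply/funext => y; rewrite cReM.
rewrite (_ : (fun _ => _) = (fun x => complex.Re (phi x) * complex.Im (psi x)
      + complex.Im (phi x) * complex.Re (psi x))).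
  apply: cvgD; apply: cvgM; [exact: pr | exact: si | exact: pi | exact: sr].
by apply/funext => y; rewrite cImM.
Qed.

Lemma ccontN phi : ccont phi -> ccont (fun x => - phi x).
Proof.
move=> cp; rewrite (_ : (fun _ => _) = (fun x => -1 * phi x)).
  by apply: ccontM => //; apply: ccont_cst.
by apply/funext => x; rewrite mulN1r.
Qed.

Lemma ccontB phi psi : ccont phi -> ccont psi -> ccont (fun x => phi x - psi x).
Proof. by move=> cp cs; apply: ccontD => //; apply: ccontN. Qed.

Lemma ccontX phi n : ccont phi -> ccont (fun x => phi x ^+ n).
Proof.
move=> cp; elim: n => [|n IH].
  rewrite (_ : (fun _ => _) = fun=> 1); first exact: ccont_cst.
  by apply/funext => x; rewrite expr0.
rewrite (_ : (fun _ => _) = fun x => phi x * phi x ^+ n); first exact: ccontM.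
by apply/funext => x; rewrite exprS.
Qed.

Lemma ccontV phi : (forall x, phi x != 0) -> ccont phi -> ccont (fun x => (phi x)^-1).
Proof.
move=> p0 [pr pi].
have cV : continuous (fun x => (sqnorm (phi x))^-1).
  move=> x; apply: cvgV.
    by rewrite sqnormE sqrf_eq0 normc_eq0.
  apply: cvgD; rewrite ?expr2; apply: cvgM;
    [exact: pr | exact: pr | exact: pi | exact: pi].
have E x : (phi x)^-1 = conjc (phi x) * ((sqnorm (phi x))^-1)%:C%C.
  apply: (mulfI (p0 x)); rewrite mulfV // mulrA -sqnormC -rmorphM /= divff //.
  by rewrite sqnormE sqrf_eq0 normc_eq0.
rewrite (_ : (fun _ => _) = fun x => conjc (phi x) * ((sqnorm (phi x))^-1)%:C%C); last first.
  by apply/funext.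
apply: ccontM; split=> /=.
- rewrite (_ : (fun _ => _) = (fun x => complex.Re (phi x))) //.
  by apply/funext => x; case: (phi x).
- rewrite (_ : (fun _ => _) = (fun x => - complex.Im (phi x))) //.
    by move=> x; apply: cvgN; apply: pi.
  by apply/funext => x; case: (phi x).
- exact: cV.
- exact: cst_continuous.
Qed.

Lemma ccontP phi : ccont phi <-> forall x e, 0 < e -> exists2 d, 0 < d &
  forall y, `|y - x| < d -> normc (phi y - phi x) < e.
Proof.
split=> [[cr ci] x e e0|h].
  have e2 : 0 < e / 2 by rewrite divr_gt0.
  have /cvgrPdist_lt /(_ _ e2) := cr x; have /cvgrPdist_lt /(_ _ e2) := ci x.
  move=> /nbhs_ballP[d1 /= d10 h1] /nbhs_ballP[d2 /= d20 h2].
  exists (Num.min d1 d2); first by rewrite lt_min d10 d20.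
  move=> y; rewrite lt_min distrC => /andP[y1 y2].
  apply: le_lt_trans (normc_le_ReIm _) _.
  rewrite cReB cImB distrC [X in _ + X]distrC (splitr e) ltrD //.
    exact: (h2 y).
  exact: (h1 y).
split=> x; apply/cvgrPdist_lt => e e0; have [d d0 hd] := h x e e0;
  apply/nbhs_ballP; exists d => // y; rewrite /ball /= distrC => /hd;
  apply: le_lt_trans.
  by rewrite distrC -cReB Re_le_normc.
by rewrite distrC -cImB Im_le_normc.
Qed.

Lemma cint_FTC Phi phi a b : ccont phi -> A < a -> A < b ->
  (forall x, A < x -> cderiv Phi phi x) -> cint phi a b = Phi b - Phi a.
Proof.
move=> [cr ci] Aa Ab d; apply: complex_eqP => /=.
  rewrite cReB; apply: (@rint_FTC (fun x => complex.Re (Phi x))) => // x Ax.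
  by have [] := d x Ax.
rewrite cImB; apply: (@rint_FTC (fun x => complex.Im (Phi x))) => // x Ax.
by have [] := d x Ax.
Qed.

Lemma eq_cint phi psi a b : phi =1 psi -> cint phi a b = cint psi a b.
Proof. by move=> /funext ->. Qed.

Lemma cintD phi psi a b : ccont phi -> ccont psi -> A < a -> A < b ->
  cint (fun x => phi x + psi x) a b = cint phi a b + cint psi a b.
Proof.
move=> [pr pi] [sr si] Aa Ab; apply: complex_eqP => /=.
  rewrite -rintD //; congr rint; apply/funext => x; exact: cReD.
rewrite -rintD //; congr rint; apply/funext => x; exact: cImD.
Qed.

Lemma cintZ c phi a b : ccont phi -> A < a -> A < b ->
  cint (fun x => c * phi x) a b = c * cint phi a b.
Proof.
move=> [pr pi] Aa Ab.
have cM (k : R) f : continuous f -> continuous (fun x => k * f x).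
  by move=> cf x; apply: cvgM; [exact: cvg_cst | exact: cf].
apply: complex_eqP => /=.
  rewrite cReM /= -mulNr -!rintZ // -rintD; [|exact: cM..|by []|by []].
  by congr rint; apply/funext => x; rewrite cReM mulNr.
rewrite cImM /= -!rintZ // -rintD; [|exact: cM..|by []|by []].
by congr rint; apply/funext => x; rewrite cImM.
Qed.

Lemma cintB phi psi a b : ccont phi -> ccont psi -> A < a -> A < b ->
  cint (fun x => phi x - psi x) a b = cint phi a b - cint psi a b.
Proof.
move=> cp cs Aa Ab; rewrite -mulN1r -cintZ // -cintD //.
  by apply: eq_cint => x; rewrite mulN1r.
by apply: ccontM => //; apply: ccont_cst.
Qed.

Lemma cint_split phi a b c : cint phi a c = cint phi a b + cint phi b c.
Proof. by apply: complex_eqP; rewrite /= /rint; ring. Qed.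

(** The factor 2 comes from estimating real and imaginary parts separately. *)
Lemma cint_bound phi M a b : ccont phi -> A < a -> a <= b ->
  (forall x, a <= x <= b -> normc (phi x) <= M) ->
  normc (cint phi a b) <= 2 * M * (b - a).
Proof.
move=> [cr ci] Aa ab h; apply: le_trans (normc_le_ReIm _) _ => /=.
rewrite -mulrA mulr_natl mulr2n lerD //; apply: rint_bound => // x hx;
  by rewrite (le_trans _ (h x hx)) // (Re_le_normc, Im_le_normc).
Qed.

End Primitives.

Section Bisection.
Variable R : realType.

Lemma half_power_lt (x e : R) : 0 < e -> exists n : nat, x / 2 ^+ n < e.
Proof.
move=> e0; exists (Num.bound `|x / e|).
rewrite ltr_pdivrMr ?exprn_gt0 // mulrC -ltr_pdivrMr //.
apply: (le_lt_trans (ler_norm _)); apply: lt_trans (archi_boundP (normr_ge0 _)) _ => //.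
by rewrite -natrX ltr_nat ltn_expl.
Qed.

(** A choice function selects a good quarter of each good rectangle; the suprema of the lower
    endpoints give the point common to the nested sequence. *)
Lemma bisection (P : R -> R -> R -> R -> Prop) (a0 b0 c0 d0 : R) :
  a0 <= b0 -> c0 <= d0 ->
  (forall a b c d, a <= b -> c <= d -> P a b c d ->
     let m := (a + b) / 2 in let l := (c + d) / 2 in
     [\/ P a m c l, P m b c l, P a m l d | P m b l d]) ->
  P a0 b0 c0 d0 ->
  exists p q, forall n : nat, exists a b c d,
    [/\ P a b c d, a0 <= a /\ b <= b0, c0 <= c /\ d <= d0,
        a <= p <= b /\ c <= q <= d
      & b - a = (b0 - a0) / 2 ^+ n /\ d - c = (d0 - c0) / 2 ^+ n].
Proof.
move=> ab0 cd0 Pq P0.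
pose T := (R * R * R * R)%type.
pose ok (x : T) := let: (a, b, c, d) := x in [/\ P a b c d, a <= b & c <= d].
pose sub (x y : T) := let: (a, b, c, d) := x in let: (a', b', c', d') := y in
  [/\ a <= a', b' <= b, c <= c', d' <= d &
   b' - a' = (b - a) / 2 /\ d' - c' = (d - c) / 2].
have step (x : T) : exists y, ok x -> ok y /\ sub x y.
  case: x => [[[a b] c] d].
  (* The choice function must be total: a rectangle that is not good is sent to itself. *)
  have [[Pabcd ab cd]|] := pselect (ok (a, b, c, d)); last by exists (a, b, c, d).
  by case: (Pq a b c d ab cd Pabcd) => Pq'; eexists (_, _, _, _) => _;
    split; (split; [exact: Pq'|lra|lra]) || (split; [lra|lra|lra|lra|split; lra]).
have {step}[f fP] := choice step.
pose x n := iter n f (a0, b0, c0, d0).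
have xok n : ok (x n) by elim: n => [|n IH] //; have [] := fP _ IH.
have xsub n : sub (x n) (x n.+1) by have [] := fP _ (xok n).
pose a n := (x n).1.1.1; pose b n := (x n).1.1.2; pose c n := (x n).1.2; pose d n := (x n).2.
have ok' n : [/\ P (a n) (b n) (c n) (d n), a n <= b n & c n <= d n].
  by have := xok n; rewrite /ok /a /b /c /d; case: (x n) => [[[]]].
have sub' n : [/\ a n <= a n.+1, b n.+1 <= b n, c n <= c n.+1, d n.+1 <= d n &
   b n.+1 - a n.+1 = (b n - a n) / 2 /\ d n.+1 - c n.+1 = (d n - c n) / 2].
  by have := xsub n; rewrite /sub /a /b /c /d; case: (x n) (x n.+1) => [[[? ?] ?] ?] [[[]]].
have size n : b n - a n = (b0 - a0) / 2 ^+ n /\ d n - c n = (d0 - c0) / 2 ^+ n.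
  elim: n => [|n [IHa IHc]]; first by rewrite expr0 !divr1.
  have [_ _ _ _ [-> ->]] := sub' n; rewrite IHa IHc exprSr.
  by split; rewrite -mulrA -invfM.
have mono (u v : nat -> R) : (forall n, u n <= u n.+1) -> (forall n, v n.+1 <= v n) ->
    (forall n, u n <= v n) -> exists p, forall n, u n <= p <= v n.
  move=> hu hv huv.
  have uv n m : u n <= v m.
    have hu' : {homo u : k l / (k <= l)%N >-> k <= l}.
      by apply: homo_leq => //; apply: le_trans.
    have hv' : {homo v : k l / (k <= l)%N >-> l <= k}.
      by apply: homo_leq => // ? ? ? h1 h2; apply: le_trans h1.
    exact: le_trans (hu' _ _ (leq_maxl n m)) (le_trans (huv _) (hv' _ _ (leq_maxr n m))).
  exists (sup (range u)) => n; apply/andP; split.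
    by apply: ub_le_sup; [exists (v 0) => _ [m _ <-] | exists n].
  by apply: ge_sup; [exists (u 0); exists 0 | move=> _ [m _ <-]].
have [p hp] := mono a b (fun n => let: And5 h _ _ _ _ := sub' n in h)
  (fun n => let: And5 _ h _ _ _ := sub' n in h) (fun n => let: And3 _ h _ := ok' n in h).
have [q hq] := mono c d (fun n => let: And5 _ _ h _ _ := sub' n in h)
  (fun n => let: And5 _ _ _ h _ := sub' n in h) (fun n => let: And3 _ _ h := ok' n in h).
exists p, q => n; exists (a n), (b n), (c n), (d n); split => //.
- by have [] := ok' n.
- elim: n => [|n [IH1 IH2]] //; have [h1 h2 _ _ _] := sub' n.
  by split; [exact: le_trans h1|exact: le_trans IH2].
- elim: n => [|n [IH1 IH2]] //; have [_ _ h1 h2 _] := sub' n.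
  by split; [exact: le_trans h1|exact: le_trans IH2].
Qed.

End Bisection.

Section ComplexFunctions.
Variable R : realType.
Local Notation C := R[i].
Implicit Types (g : C -> C) (phi : R -> C).

Definition gcont g := forall p (e : R), 0 < e -> exists2 d : R, 0 < d &
  forall z, normc (z - p) < d -> normc (g z - g p) < e.

Definition gdiff g := forall p, exists B : C, forall e : R, 0 < e ->
  exists2 d : R, 0 < d & forall z, normc (z - p) < d ->
    normc (g z - g p - B * (z - p)) <= e * normc (z - p).

Lemma gdiff_cont g : gdiff g -> gcont g.
Proof.
move=> dg p e e0; have [B /(_ _ ltr01) [d d0 hd]] := dg p.
have k0 : 0 < 1 + normc B by rewrite ltr_pwDl ?normc_ge0.
exists (Num.min d (e / (1 + normc B))); first by rewrite lt_min d0 divr_gt0.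
move=> z; rewrite lt_min ltr_pdivlMr // => /andP[/hd h1 h2].
apply: le_lt_trans h2.
rewrite -[g z - g p](subrK (B * (z - p))) [leRHS]mulrDr mulr1.
apply: le_trans (le_normcD _ _) _; rewrite normcM [X in _ + X <= _]mulrC lerD //.
by rewrite -[leRHS]mul1r.
Qed.

Lemma gcont_comp g phi : gcont g -> ccont phi -> ccont (fun x => g (phi x)).
Proof.
move=> cg /ccontP cp; apply/ccontP => x e e0.
have [d d0 hd] := cg (phi x) e e0; have [d' d'0 hd'] := cp x d d0.
by exists d' => // y /hd'/hd.
Qed.

Lemma gcontD g1 g2 : gcont g1 -> gcont g2 -> gcont (fun z => g1 z + g2 z).
Proof.
move=> c1 c2 p e e0; have e2 : 0 < e / 2 by rewrite divr_gt0.
have [d1 d10 h1] := c1 p _ e2; have [d2 d20 h2] := c2 p _ e2.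
exists (Num.min d1 d2); first by rewrite lt_min d10.
move=> z; rewrite lt_min => /andP[/h1 k1 /h2 k2].
rewrite opprD addrACA (splitr e); apply: le_lt_trans (le_normcD _ _) (ltrD k1 k2).
Qed.

Lemma gcontZ c g : gcont g -> gcont (fun z => c * g z).
Proof.
move=> cg p e e0; have k0 : 0 < 1 + normc c by rewrite ltr_pwDl ?normc_ge0.
have [d d0 h] := cg p _ (divr_gt0 e0 k0); exists d => // z /h.
rewrite ltr_pdivlMr // => {}h; rewrite -mulrBr normcM; apply: le_lt_trans h.
by rewrite mulrC ler_wpM2l ?normc_ge0 // lerDr.
Qed.

Lemma gcont_cst c : gcont (fun=> c).
Proof. by move=> p e e0; exists 1 => // z _; rewrite subrr normc0. Qed.

Lemma gcont_sub a : gcont (fun z => z - a).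
Proof. by move=> p e e0; exists e => // z; rewrite opprB addrA subrK. Qed.

End ComplexFunctions.

Section Circle.
Variable R : realType.
Local Notation C := R[i].
Implicit Types (t s : R).

Definition cis t : C := (cos t +i* sin t)%C.

Lemma normc_cis t : normc (cis t) = 1.
Proof. by rewrite /normc /= cos2Dsin2 sqrtr1. Qed.

Lemma cis_neq0 t : cis t != 0.
Proof. by rewrite -normc_gt0 normc_cis. Qed.

Lemma ccont_cis : ccont cis.
Proof. by split=> /=; [exact: continuous_cos | exact: continuous_sin]. Qed.

Lemma cderiv_cis t : cderiv cis (fun t => 'i%C * cis t) t.
Proof.
split; rewrite ?cReM ?cImM /= ?mul0r ?mul1r ?add0r ?sub0r ?addr0.
  exact: is_derive_cos.
exact: is_derive_sin.
Qed.

Lemma cderivZ c (Phi phi : R -> C) t : cderiv Phi phi t ->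
  cderiv (fun t => c * Phi t) (fun t => c * phi t) t.
Proof.
move=> [dr di]; split.
  rewrite cReM (_ : (fun _ => _) = fun x : R => complex.Re c * complex.Re (Phi x) - complex.Im c * complex.Im (Phi x)).
    exact: (is_deriveB (is_deriveZ (complex.Re c) dr) (is_deriveZ (complex.Im c) di)).
  by apply/funext => x; rewrite cReM.
rewrite cImM (_ : (fun _ => _) = fun x : R => complex.Re c * complex.Im (Phi x) + complex.Im c * complex.Re (Phi x)).
  exact: (is_deriveD (is_deriveZ (complex.Re c) di) (is_deriveZ (complex.Im c) dr)).
by apply/funext => x; rewrite cImM.
Qed.

Lemma ccont_expR : ccont (fun s : R => (expR s)%:C%C : C).
Proof. by split=> /=; [exact: continuous_expR | exact: cst_continuous]. Qed.

Lemma cderiv_expR s :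
  cderiv (fun s => (expR s)%:C%C : C) (fun s => (expR s)%:C%C) s.
Proof.
split=> /=; first exact: is_derive_expR.
exact: is_derive_cst.
Qed.

Lemma cis2pi : cis (2 * pi) = cis 0.
Proof. by rewrite /cis mulr_natl cos2pi sin2pi cos0 sin0. Qed.

Lemma lipschitz_of_derive (f df : R -> R) (K a b : R) :
  (forall x : R, is_derive x 1 f (df x)) -> (forall x, Num.min a b <= x <= Num.max a b -> `|df x| <= K) ->
  `|f b - f a| <= K * `|b - a|.
Proof.
wlog ab : a b / a < b => [hw d h|d h].
  have [ab|ba|->] := ltgtP a b; first exact: hw.
    by rewrite distrC [X in _ * X]distrC; apply: hw => // x; rewrite minC maxC; exact: h.
  by rewrite !subrr normr0 mulr0.
have [] := @MVT R f df a b ab (fun x _ => d x).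
  by apply: derivable_within_continuous => x _; have [] := d x.
move=> c; rewrite in_itv /= => /andP[ac cb] ->.
by rewrite normrM ler_wpM2r // h // min_l ?max_r ?(ltW ab) // !ltW.
Qed.

Lemma cis_lip s t : normc (cis t - cis s) <= 2 * `|t - s|.
Proof.
apply: le_trans (normc_le_ReIm _) _; rewrite cReB cImB /= mulr_natl mulr2n.
apply: lerD.
  rewrite -[leRHS]mul1r; apply: (@lipschitz_of_derive cos (fun x => - sin x)) => x _.
  by rewrite normrN ler_norml sin_geN1 sin_le1.
rewrite -[leRHS]mul1r; apply: (@lipschitz_of_derive sin cos) => x _.
by rewrite ler_norml cos_geN1 cos_le1.
Qed.

Lemma expR_lip s t : s <= 0 -> t <= 0 -> `|expR t - expR s| <= `|t - s|.
Proof.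
move=> s0 t0; rewrite -[leRHS]mul1r; apply: (@lipschitz_of_derive expR expR) => x.
by rewrite le_max => /andP[_ /orP[] h];
  rewrite ger0_norm ?expR_ge0 // -expR0 ler_expR (le_trans h).
Qed.

End Circle.

(** * Goursat's theorem in logarithmic polar coordinates *)

Section Goursat.
Variable R : realType.
Local Notation C := R[i].
Implicit Types (g : C -> C) (s t : R).
Variables (a : C) (ha : normc a <= 1).

(* Polar coordinates at a with logarithmic radius: s = 0 is the circle of radius 2
   around 0, and dz/(z - a) becomes ds + ckernel t dt. *)
Definition ccirc t : C := 2 * cis t.
Definition cray t : C := ccirc t - a.
Definition cpolar s t : C := a + (expR s)%:C%C * cray t.
Definition ckernel t : C := 'i%C * ccirc t / cray t.

Lemma normc_ccirc t : normc (ccirc t) = 2.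
Proof. by rewrite /ccirc normcM normc_cis mulr1 normc_nat. Qed.

Lemma ccirc_neq0 t : ccirc t != 0.
Proof. by rewrite -normc_gt0 normc_ccirc. Qed.

Lemma normc_cray_ge t : 1 <= normc (cray t).
Proof.
have := le_normcD (ccirc t - a) a; rewrite subrK normc_ccirc.
by move: ha => h1 h2; rewrite /cray; lra.
Qed.

Lemma normc_cray_le t : normc (cray t) <= 3.
Proof. by apply: le_trans (le_normcB _ _) _; rewrite normc_ccirc; move: ha => h; lra. Qed.

Lemma cray_neq0 t : cray t != 0.
Proof. by rewrite -normc_gt0 (lt_le_trans ltr01) // normc_cray_ge. Qed.

Lemma ccont_ccirc : ccont ccirc.
Proof. by apply: ccontM; [exact: ccont_cst | exact: ccont_cis]. Qed.

Lemma ccont_cray : ccont cray.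
Proof. by apply: ccontB; [exact: ccont_ccirc | exact: ccont_cst]. Qed.

Lemma ccont_ckernel : ccont ckernel.
Proof.
apply: ccontM; last by apply: ccontV ccont_cray; exact: cray_neq0.
by apply: ccontM; [exact: ccont_cst | exact: ccont_ccirc].
Qed.

Lemma normc_ckernel t : normc (ckernel t) <= 2.
Proof.
rewrite /ckernel 2!normcM normcV normc_ccirc.
rewrite normci mul1r -[leRHS]mulr1 ler_wpM2l // invf_le1 ?normc_cray_ge //.
by rewrite (lt_le_trans ltr01) // normc_cray_ge.
Qed.

Lemma ccont_cpolar_s t : ccont (cpolar^~ t).
Proof.
apply: ccontD; first exact: ccont_cst.
by apply: ccontM; [exact: ccont_expR | exact: ccont_cst].
Qed.

Lemma ccont_cpolar_t s : ccont (cpolar s).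
Proof.
apply: ccontD; first exact: ccont_cst.
by apply: ccontM; [exact: ccont_cst | exact: ccont_cray].
Qed.

(** On [s <= 0] the exponential is at most 1 and 1-Lipschitz; with [|cray t| <= 3] and [cis]
    2-Lipschitz the sum is at most [3 |s - s'| + 4 |t - t'|]. *)
Lemma cpolar_lip s t s' t' : s <= 0 -> s' <= 0 ->
  normc (cpolar s t - cpolar s' t') <= 4 * (`|s - s'| + `|t - t'|).
Proof.
move=> s0 s'0.
have -> : cpolar s t - cpolar s' t' =
    (expR s - expR s')%:C%C * cray t + (expR s')%:C%C * (2 * (cis t - cis t')).
  by rewrite /cpolar /cray /ccirc rmorphB /=; ring.
apply: le_trans (le_normcD _ _) _; rewrite !normcM !normc_real normc_nat.
rewrite [`|expR s'|]ger0_norm ?expR_ge0 //.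
have h1 := expR_lip s'0 s0; have h2 := cis_lip t' t.
have h3 := normc_cray_le t; have h4 : expR s' <= 1 by rewrite -expR0 ler_expR.
have h5 : `|expR s - expR s'| * normc (cray t) <= `|s - s'| * 3.
  by apply: ler_pM; rewrite ?normc_ge0.
have h6 : expR s' * (2 * normc (cis t - cis t')) <= 1 * (2 * (2 * `|t - t'|)).
  by apply: ler_pM; rewrite ?expR_ge0 ?mulr_ge0 ?normc_ge0 // ler_wpM2l.
have := normr_ge0 (s - s'); lra.
Qed.

Section Rectangle.
Variables (A : R).

(* The integral of g(z)dz/(z - a) along the image of the boundary of
   [s0, s1] x [t0, t1] under cpolar. *)
Definition rect g s0 s1 t0 t1 : C :=
  cint A (fun s => g (cpolar s t0) - g (cpolar s t1)) s0 s1 +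
  cint A (fun t => (g (cpolar s1 t) - g (cpolar s0 t)) * ckernel t) t0 t1.

Lemma ccont_hor g t0 t1 : gcont g ->
  ccont (fun s => g (cpolar s t0) - g (cpolar s t1)).
Proof.
by move=> cg; apply: ccontB; apply: gcont_comp => //; apply: ccont_cpolar_s.
Qed.

Lemma ccont_ver g s0 s1 : gcont g ->
  ccont (fun t => (g (cpolar s1 t) - g (cpolar s0 t)) * ckernel t).
Proof.
move=> cg; apply: ccontM ccont_ckernel.
by apply: ccontB; apply: gcont_comp => //; apply: ccont_cpolar_t.
Qed.

Lemma rectD g1 g2 s0 s1 t0 t1 : gcont g1 -> gcont g2 ->
  A < s0 -> A < s1 -> A < t0 -> A < t1 ->
  rect (fun z => g1 z + g2 z) s0 s1 t0 t1 = rect g1 s0 s1 t0 t1 + rect g2 s0 s1 t0 t1.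
Proof.
move=> c1 c2 As0 As1 At0 At1; rewrite /rect addrACA.
rewrite -cintD //; [|exact: ccont_hor..]; rewrite -cintD //; [|exact: ccont_ver..].
by congr (_ + _); apply: eq_cint => x; ring.
Qed.

Lemma rectZ c g s0 s1 t0 t1 : gcont g ->
  A < s0 -> A < s1 -> A < t0 -> A < t1 ->
  rect (fun z => c * g z) s0 s1 t0 t1 = c * rect g s0 s1 t0 t1.
Proof.
move=> cg As0 As1 At0 At1; rewrite /rect mulrDr.
rewrite -cintZ //; [|exact: ccont_hor]; rewrite -cintZ //; [|exact: ccont_ver].
by congr (_ + _); apply: eq_cint => x; ring.
Qed.

Lemma cint0 s0 s1 : cint A (fun=> 0) s0 s1 = 0.
Proof.
apply: complex_eqP; rewrite /= /rint /prim.
  by rewrite !Rintegral_cst // !mul0r subr0.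
by rewrite !Rintegral_cst // !mul0r subr0.
Qed.

Lemma rect_cst c s0 s1 t0 t1 : rect (fun=> c) s0 s1 t0 t1 = 0.
Proof.
rewrite /rect (eq_cint _ (psi := fun=> 0)) => [|x]; last exact: subrr.
rewrite cint0 add0r (eq_cint _ (psi := fun=> 0)) => [|x]; last by rewrite subrr mul0r.
exact: cint0.
Qed.

(** For [g z = z - a] the form [g(z)dz/(z - a)] is [dz]: each side integrates to a difference of
    values of [cpolar], and around the boundary these cancel. *)
Lemma rect_lin s0 s1 t0 t1 : A < s0 -> A < s1 -> A < t0 -> A < t1 ->
  rect (fun z => z - a) s0 s1 t0 t1 = 0.
Proof.
move=> As0 As1 At0 At1; rewrite /rect.
have c1 : ccont (fun s : R => (cray t0 - cray t1) * (expR s)%:C%C).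
  by apply: ccontM; [exact: ccont_cst | exact: ccont_expR].
have c2 : ccont (fun t : R => 'i%C * cis t : C).
  by apply: ccontM; [exact: ccont_cst | exact: ccont_cis].
pose k : C := (expR s1)%:C%C - (expR s0)%:C%C.
rewrite (eq_cint _ (psi := fun s => (cray t0 - cray t1) * (expR s)%:C%C)) => [|s]; last first.
  by rewrite /cpolar; ring.
rewrite (@cint_FTC _ A (fun s => (cray t0 - cray t1) * (expR s)%:C%C)) //; last first.
  by move=> s _; apply: cderivZ; exact: cderiv_expR.
rewrite [X in _ + X](eq_cint _ (psi := fun t => (2 * k) * ('i%C * cis t))) => [|t]; last first.
  rewrite /cpolar /ckernel /k.
  transitivity (((expR s1)%:C%C - (expR s0)%:C%C) * ('i%C * ccirc t) * (cray t / cray t)); first by ring.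
  by rewrite divff ?cray_neq0 // mulr1 /ccirc; ring.
rewrite cintZ // (@cint_FTC _ A (@cis R)) //; last by move=> t _; exact: cderiv_cis.
by rewrite /cray /ccirc /k; ring.
Qed.

Lemma rect_split g s0 s1 s2 t0 t1 t2 : gcont g ->
  A < s0 -> A < s1 -> A < s2 -> A < t0 -> A < t1 -> A < t2 ->
  rect g s0 s2 t0 t2 = rect g s0 s1 t0 t1 + rect g s1 s2 t0 t1 +
    (rect g s0 s1 t1 t2 + rect g s1 s2 t1 t2).
Proof.
move=> cg As0 As1 As2 At0 At1 At2.
have splits p q r t t' : A < p -> A < q -> A < r -> A < t -> A < t' ->
    rect g p r t t' = rect g p q t t' + rect g q r t t'.
  move=> Ap Aq Ar At At'; rewrite /rect (cint_split _ _ p q r) addrACA; congr (_ + _).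
  by rewrite -cintD //; [|exact: ccont_ver..]; apply: eq_cint => x; ring.
have splitt p q t t' t'' : A < p -> A < q -> A < t -> A < t' -> A < t'' ->
    rect g p q t t'' = rect g p q t t' + rect g p q t' t''.
  move=> Ap Aq At At' At''; rewrite /rect (cint_split _ _ t t' t'') [RHS]addrACA; congr (_ + _).
  by rewrite -cintD //; [|exact: ccont_hor..]; apply: eq_cint => x; ring.
by rewrite (splitt s0 s2 t0 t1 t2) // !(splits s0 s1 s2).
Qed.

(** In the factor 8, one 2 counts the opposite sides, one bounds [ckernel], and one comes from
    [cint_bound]. *)
Lemma rect_small g e s0 s1 t0 t1 : gcont g -> A < s0 -> A < t0 ->
  s0 <= s1 -> t0 <= t1 ->
  (forall s t, s0 <= s <= s1 -> t0 <= t <= t1 -> normc (g (cpolar s t)) <= e) ->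
  normc (rect g s0 s1 t0 t1) <= 8 * e * ((s1 - s0) + (t1 - t0)).
Proof.
move=> cg As0 At0 s01 t01 h.
have e0 : 0 <= e.
  by apply: le_trans (normc_ge0 _) (h s0 t0 _ _); rewrite lexx.
apply: le_trans (le_normcD _ _) _; rewrite mulrDr; apply: lerD.
  apply: le_trans (@cint_bound _ _ _ (2 * e) _ _ _ As0 s01 _) _.
  - exact: ccont_hor.
  - move=> s hs; apply: le_trans (le_normcB _ _) _.
    by rewrite mulr_natl mulr2n lerD // h ?lexx ?t01.
  by rewrite ler_wpM2r ?subr_ge0 // mulrA ler_wpM2r // -natrM ler_nat.
apply: le_trans (@cint_bound _ _ _ ((2 * e) * 2) _ _ _ At0 t01 _) _.
- exact: ccont_ver.
- move=> t ht; rewrite normcM ler_pM ?normc_ge0 ?normc_ckernel //.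
  apply: le_trans (le_normcB _ _) _.
  by rewrite mulr_natl mulr2n lerD // h ?lexx ?s01.
by rewrite ler_wpM2r ?subr_ge0 //; lra.
Qed.

Lemma mid_between (x y : R) : x <= y -> x <= (x + y) / 2 <= y.
Proof. by move=> xy; apply/andP; split; lra. Qed.

(** Bisection in the parameter rectangle, where [cpolar] stays away from the pole [a]. A rectangle
    is bad when its boundary integral exceeds [e] times its area, and a bad rectangle has a bad
    quarter. Near the limit point the affine part of [g] contributes nothing, and the rest is at
    most a small multiple of the squared size. *)
Lemma goursat g s0 s1 t0 t1 : gdiff g -> A < s0 -> A < t0 ->
  s0 < s1 -> s1 <= 0 -> t0 < t1 -> rect g s0 s1 t0 t1 = 0.
Proof.
move=> dg As0 At0 s01 s10 t01; have cg := gdiff_cont dg.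
pose L := s1 - s0; pose K := t1 - t0.
have L0 : 0 < L by rewrite subr_gt0.
have K0 : 0 < K by rewrite subr_gt0.
apply: normc_small0 => e' e'0; rewrite leNgt; apply/negP => hlt.
(* With this [e] the whole rectangle is bad, since [e * (L * K) = e']. *)
pose e := e' / (L * K); have e0 : 0 < e by rewrite divr_gt0 ?mulr_gt0.
pose P b0 b1 c0 c1 := [/\ s0 <= b0, b1 <= s1, t0 <= c0, c1 <= t1 &
  e * ((b1 - b0) * (c1 - c0)) < normc (rect g b0 b1 c0 c1)].
have P0 : P s0 s1 t0 t1 by split => //; rewrite /e divfK // mulf_neq0 // gt_eqF.
have [|] := bisection (ltW s01) (ltW t01) _ P0.
  move=> b0 b1 c0 c1 b01 c01 [sb bs tc ct hP] m l.
  have /andP[m1 m2] : b0 <= m <= b1 := mid_between b01.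
  have /andP[l1 l2] : c0 <= l <= c1 := mid_between c01.
  have Ab0 := lt_le_trans As0 sb; have Am := lt_le_trans Ab0 m1.
  have Ac0 := lt_le_trans At0 tc; have Al := lt_le_trans Ac0 l1.
  clearbody m l.
  apply: contrapT => nP.
  have n1 h := nP (Or41 _ _ _ h); have n2 h := nP (Or42 _ _ _ h).
  have n3 h := nP (Or43 _ _ _ h); have n4 h := nP (Or44 _ _ _ h).
  have nle x0 x1 y0 y1 : s0 <= x0 -> x1 <= s1 -> t0 <= y0 -> y1 <= t1 ->
      ~ P x0 x1 y0 y1 -> normc (rect g x0 x1 y0 y1) <= e * ((x1 - x0) * (y1 - y0)).
    by move=> h1 h2 h3 h4 nP'; rewrite leNgt; apply/negP => h; apply: nP'; split.
  have {}n1 := nle _ _ _ _ sb (le_trans m2 bs) tc (le_trans l2 ct) n1.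
  have {}n2 := nle _ _ _ _ (le_trans sb m1) bs tc (le_trans l2 ct) n2.
  have {}n3 := nle _ _ _ _ sb (le_trans m2 bs) (le_trans tc l1) ct n3.
  have {}n4 := nle _ _ _ _ (le_trans sb m1) bs (le_trans tc l1) ct n4.
  move: hP; rewrite (@rect_split g b0 m b1 c0 l c1) ?(lt_le_trans _ m2) ?(lt_le_trans _ l2) //.
  move=> /lt_le_trans /(_ (le_normcD _ _)).
  have := le_normcD (rect g b0 m c0 l) (rect g m b1 c0 l).
  have := le_normcD (rect g b0 m l c1) (rect g m b1 l c1).
  move=> h1 h2 h3.
  have : e * ((b1 - b0) * (c1 - c0)) < e * ((m - b0) * (l - c0)) +
    e * ((b1 - m) * (l - c0)) + (e * ((m - b0) * (c1 - l)) + e * ((b1 - m) * (c1 - l))).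
    apply: lt_le_trans h3 _; apply: lerD; [apply: le_trans h2 _|apply: le_trans h1 _];
      by apply: lerD.
  rewrite -!mulrDr ltr_pM2l // => h4.
  suff : (b1 - b0) * (c1 - c0) < (b1 - b0) * (c1 - c0) by rewrite ltxx.
  apply: lt_le_trans h4 _; rewrite le_eqVlt; apply/orP; left; apply/eqP; ring.
move=> p [q hpq].
have [B hB] := dg (cpolar p q).
(* The upper bound below is [32 e1 (L + K)^2 / v^2]. The constant 64 turns it into half of the lower
   bound [e L K / v^2], a contradiction. *)
pose e1 := e * (L * K) / (64 * (L + K) ^+ 2).
have LK0 : 0 < L + K by rewrite addr_gt0.
have eLK0 : 0 < e * (L * K) by exact: mulr_gt0 e0 (mulr_gt0 L0 K0).
have e10 : 0 < e1.
  by apply: divr_gt0 eLK0 _; apply: mulr_gt0 => //; apply: exprn_gt0.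
have [d d0 hd] := hB e1 e10.
have [n hn] := half_power_lt (4 * (L + K)) d0.
have [b0 [b1 [c0 [c1 [[_ _ _ _ hP] [sb bs] [tc ct] [hp hq] [Eb Ec]]]]]] := hpq n.
set v := 2 ^+ n in hn Eb Ec; have v0 : 0 < v by rewrite exprn_gt0.
have b01 : b0 <= b1 by case/andP: hp => h1 h2; exact: le_trans h2.
have c01 : c0 <= c1 by case/andP: hq => h1 h2; exact: le_trans h2.
have p0 : p <= 0 by case/andP: hp => _ h2; rewrite (le_trans h2) // (le_trans bs).
pose rho z := g z - g (cpolar p q) - B * (z - cpolar p q).
have crho : gcont rho.
  rewrite /rho (_ : (fun _ => _) = fun z => (g z + - g (cpolar p q)) + - B * (z - cpolar p q)).
    apply: gcontD; last by apply: gcontZ; exact: gcont_sub.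
    by apply: gcontD => //; exact: gcont_cst.
  by apply/funext => z; rewrite mulNr.
have Erect : rect g b0 b1 c0 c1 = rect rho b0 b1 c0 c1.
  (* The tangent affine map at the limit point is recentred at [a], so that [rect_cst] and
     [rect_lin] annihilate it. *)
  pose w := g (cpolar p q) + B * (a - cpolar p q).
  have Ab0 : A < b0 := lt_le_trans As0 sb.
  have Ab1 : A < b1 := lt_le_trans Ab0 b01.
  have Ac0 : A < c0 := lt_le_trans At0 tc.
  have Ac1 : A < c1 := lt_le_trans Ac0 c01.
  rewrite (_ : g = fun z => rho z + (w + B * (z - a))); last first.
    by apply/funext => z; rewrite /rho /w; ring.
  rewrite rectD //; last first.
    by apply: gcontD; [exact: gcont_cst | apply: gcontZ; exact: gcont_sub].
  rewrite rectD //; [|exact: gcont_cst|by apply: gcontZ; exact: gcont_sub].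
  rewrite rect_cst rectZ ?rect_lin //; last exact: gcont_sub.
  by rewrite mulr0 !addr0.
have hrho s t : b0 <= s <= b1 -> c0 <= t <= c1 ->
    normc (rho (cpolar s t)) <= e1 * (4 * ((L + K) / v)).
  move=> /andP[bs' sb'] /andP[ct' tc'].
  case/andP: hp => hp1 hp2; case/andP: hq => hq1 hq2.
  have hdist : normc (cpolar s t - cpolar p q) <= 4 * ((L + K) / v).
    apply: le_trans (cpolar_lip _ _ _ p0) _; first by rewrite (le_trans sb') // (le_trans bs).
    rewrite ler_wpM2l // mulrDl -Eb -Ec; apply: lerD; rewrite ler_distl.
      by apply/andP; split; clear -bs' sb' hp1 hp2; lra.
    by apply/andP; split; clear -ct' tc' hq1 hq2; lra.
  apply: le_trans (hd _ _) _; first by apply: le_lt_trans hdist _; rewrite mulrA.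
  by rewrite ler_wpM2l // ltW.
have := rect_small crho (lt_le_trans As0 sb) (lt_le_trans At0 tc) b01 c01 hrho.
rewrite -Erect => /(lt_le_trans hP); rewrite Eb Ec -/L -/K -mulrDl.
have -> : 8 * (e1 * (4 * ((L + K) / v))) * ((L + K) / v) =
  32 * (e1 * (L + K) ^+ 2) / v ^+ 2 by field; rewrite gt_eqF.
have -> : e1 * (L + K) ^+ 2 = e * (L * K) / 64.
  by rewrite /e1; field; rewrite gt_eqF.
have -> : e * (L / v * (K / v)) = e * (L * K) / v ^+ 2 by field; rewrite gt_eqF.
rewrite ltr_pM2r ?invr_gt0 ?exprn_gt0 //.
by move: eLK0; clear => h1 h2; lra.
Qed.

End Rectangle.
End Goursat.

(** * Cauchy's formula and Taylor series in one variable *)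

Section CauchySeries.
Variable R : realType.
Local Notation C := R[i].
Implicit Types (g : C -> C) (a : C) (t : R).

(** In [cauchy_value] the base point has to lie below the logarithm of the radius of a shrinking
    circle, hence cannot be fixed once and for all. *)
Lemma cint_base (A A' : R) (phi : R -> C) x y : ccont phi -> A' <= A -> A < x -> A < y ->
  cint A phi x y = cint A' phi x y.
Proof.
move=> [cr ci] AA Ax Ay; apply: complex_eqP => /=.
  apply: (@rint_FTC R A (prim A' _)) => // z Az.
  by apply: is_derive_prim => //; apply: le_lt_trans Az.
apply: (@rint_FTC R A (prim A' _)) => // z Az.
by apply: is_derive_prim => //; apply: le_lt_trans Az.
Qed.

Lemma cisD t u : cis (t + u) = cis t * cis u.
Proof.
apply: complex_eqP; rewrite /= ?cReM ?cImM /=; first by rewrite cosD.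
by rewrite sinD [LHS]addrC; congr (_ + _); rewrite mulrC.
Qed.

Lemma cis0 : cis 0 = 1 :> C.
Proof. by rewrite /cis cos0 sin0. Qed.

Lemma cis_nat t n : cis (n%:R * t) = cis t ^+ n.
Proof.
elim: n => [|n IH]; first by rewrite mul0r cis0 expr0.
by rewrite -natr1 mulrDl mul1r cisD IH exprSr.
Qed.

Lemma cisN t : cis (- t) = (cis t)^-1.
Proof. by apply: (mulfI (cis_neq0 t)); rewrite -cisD subrr cis0 divff ?cis_neq0. Qed.

Lemma cderiv_cisZ (k : R) t :
  cderiv (fun t => cis (k * t)) (fun t => ('i * k%:C)%C * cis (k * t)) t.
Proof.
have dk : is_derive t 1 (fun t : R => k * t) k.
  rewrite -[X in is_derive _ _ _ X]mulr1.
  exact: (is_deriveZ k (is_derive_id t 1)).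
have E : ('i * k%:C)%C * cis (k * t) = (- sin (k * t) * k +i* (cos (k * t) * k))%C.
  by apply: complex_eqP; rewrite ?cReM ?cImM /= ?cReM ?cImM /=; ring.
rewrite /cderiv E; split.
  exact: (is_derive1_comp (is_derive_cos (k * t)) dk).
exact: (is_derive1_comp (is_derive_sin (k * t)) dk).
Qed.

Lemma cint_cisV j : (0 < j)%N -> cint (-1) (fun t => (cis t ^+ j)^-1) 0 (2 * pi) = 0 :> C.
Proof.
move=> j0; pose k : R := - j%:R.
have k0 : ('i * k%:C)%C != 0 :> C.
  apply: mulf_neq0; first exact: complexi_neq0.
  by rewrite -normc_eq0 normc_real normr_eq0 oppr_eq0 pnatr_eq0 -lt0n.
have ck : ccont (fun t => (cis t ^+ j)^-1 : C).
  apply: ccontV => [t|]; first by rewrite expf_neq0 // cis_neq0.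
  by apply: ccontX; exact: ccont_cis.
have E t : (cis t ^+ j)^-1 = cis (k * t) by rewrite /k mulNr cisN cis_nat.
apply: (mulfI k0); rewrite mulr0 -cintZ ?ltrN10 //; last first.
  by rewrite (lt_le_trans (ltrN10 R)) // mulr_ge0 // pi_ge0.
rewrite (@cint_FTC _ (-1) (fun t => cis (k * t))) ?ltrN10 //.
- by rewrite -!E cis2pi subrr.
- by apply: ccontM ck; exact: ccont_cst.
- by rewrite (lt_le_trans (ltrN10 R)) // mulr_ge0 // pi_ge0.
by move=> x _; rewrite [X in cderiv _ X _](_ : _ = fun t => ('i * k%:C)%C * cis (k * t));
  [exact: cderiv_cisZ | apply/funext => t; rewrite E].
Qed.

(** The [j]-th Taylor coefficient at 0, as Cauchy's integral over the circle of radius 2; [-1] is a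
    base point below the bounds of integration. *)
Definition cauchy_coef g (j : nat) : C :=
  ((2 * pi)^-1)%:C%C * cint (-1) (fun t => g (ccirc t) * (ccirc t ^+ j)^-1) 0 (2 * pi).

Let pi2 : 0 < 2 * pi :> R. Proof. by rewrite mulr_gt0 // pi_gt0. Qed.
Let A0 : -1 < 0 :> R := ltrN10 R.
Let A1 : -1 < 2 * pi :> R. Proof. exact: lt_trans A0 pi2. Qed.

(** [goursat] on [[s0, 0] x [0, 2 pi]]: the sides [t = 0] and [t = 2 pi] have the same image, so the
    integrals over the outer circle and over a small closed curve around [a] agree, and on the
    latter [g] is close to [g a]. The kernel integral is evaluated afterwards, by
    [cauchy_kernel_int]. *)
Lemma cauchy_value g a : gdiff g -> normc a <= 1 ->
  cint (-1) (fun t => g (ccirc t) * ckernel a t) 0 (2 * pi) =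
  g a * cint (-1) (ckernel a) 0 (2 * pi).
Proof.
move=> dg ha; have cg := gdiff_cont dg.
have ck := ccont_ckernel ha.
have cgk : ccont (fun t => g (ccirc t) * ckernel a t).
  by apply: ccontM => //; apply: gcont_comp => //; exact: ccont_ccirc.
rewrite -cintZ //; apply: subr0_eq; apply: normc_small0 => e e0.
(* [cint_bound], with kernel at most 2 and length [2 pi], multiplies this by [8 pi]. *)
have e1 : 0 < e / (8 * pi) by rewrite divr_gt0 // mulr_gt0 // pi_gt0.
have [d d0 hd] := cg a _ e1.
(* The inner curve lies within [3 y < d] of [a]; the bound 1/2 makes its logarithmic radius
   negative. *)
pose y := Num.min (d / 4) (2^-1); have y0 : 0 < y by rewrite lt_min divr_gt0 //= invr_gt0.
have y1 : y < 1 by rewrite gt_min orbC invf_lt1 // ltr1n.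
pose s0 := ln y; have Es0 : expR s0 = y by rewrite lnK.
have s00 : s0 < 0 by rewrite ln_lt0 // y0.
pose A := s0 - 1.
have As0 : A < s0 by rewrite /A; lra.
have AN1 : A <= -1 by rewrite /A; lra.
have AA0 : A < 0 := le_lt_trans AN1 A0.
have AA1 : A < 2 * pi := le_lt_trans AN1 A1.
have := @goursat _ a ha A g s0 0 0 (2 * pi) dg As0 AA0 s00 (lexx _) pi2.
rewrite /rect (eq_cint _ (psi := fun=> 0)); last first.
  by move=> s; rewrite /cpolar /cray /ccirc cis2pi subrr.
have Ept t : cpolar a 0 t = ccirc t.
  by rewrite /cpolar expR0 mul1r /cray addrC subrK.
rewrite cint0 add0r (eq_cint _ (psi := fun t => (g (ccirc t) - g (cpolar a s0 t)) * ckernel a t)); last first.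
  by move=> t; rewrite Ept.
have cgp : ccont (fun t => g (cpolar a s0 t)).
  by apply: gcont_comp => //; exact: ccont_cpolar_t.
move=> E.
rewrite -cintB //; last by apply: ccontM ck; exact: ccont_cst.
rewrite (@cint_base _ A) //; last first.
  by apply: ccontB cgk _; apply: ccontM ck; exact: ccont_cst.
rewrite (eq_cint _ (psi := fun t => (g (ccirc t) - g (cpolar a s0 t)) * ckernel a t +
  (g (cpolar a s0 t) - g a) * ckernel a t)); last by move=> t; ring.
rewrite cintD //; last 2 first.
- by apply: ccontM ck; apply: ccontB cgp; apply: gcont_comp => //; exact: ccont_ccirc.
- by apply: ccontM ck; apply: ccontB cgp _; exact: ccont_cst.
rewrite E add0r.
apply: le_trans (@cint_bound _ _ _ (e / (8 * pi) * 2) _ _ _ AA0 (ltW pi2) _) _.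
- by apply: ccontM ck; apply: ccontB cgp _; exact: ccont_cst.
- move=> t _; rewrite normcM ler_pM ?normc_ge0 ?normc_ckernel // ltW // hd //.
  rewrite /cpolar addrC addKr normcM normc_real Es0 ger0_norm ?ltW //.
  apply: le_lt_trans (_ : y * 3 < d); first by rewrite ler_wpM2l ?normc_cray_le // ltW.
  have : y <= d / 4 by rewrite ge_min lexx.
  by clear -d0 => h; lra.
rewrite subr0 le_eqVlt; apply/orP; left; apply/eqP.
have pn0 : pi != 0 :> R by rewrite gt_eqF // pi_gt0.
move: (pi : R) pn0 => q q0.
by field.
Qed.

(** With [c = ccirc t], [ckernel a t = i + (a / c) * ckernel a t]. Iterating peels off one Taylor
    term at a time and leaves an integrand with the factor [(a / c)^N], of modulus [(|a| / 2)^N]. *)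
Lemma cauchy_remainder g a N M : gcont g -> normc a <= 1 ->
  (forall z, normc z <= 2 -> normc (g z) <= M) ->
  normc (cint (-1) (fun t => g (ccirc t) * ckernel a t) 0 (2 * pi) -
    'i%C * (2 * pi)%:C%C * (\sum_(j < N) cauchy_coef g j * a ^+ j))
  <= 8 * pi * M * (normc a / 2) ^+ N.
Proof.
move=> cg ha hM; have ck := ccont_ckernel ha.
have cgc : ccont (fun t => g (ccirc t)) by apply: gcont_comp => //; exact: ccont_ccirc.
have cV n : ccont (fun t => (ccirc t ^+ n)^-1 : C).
  apply: ccontV => [t|]; first by rewrite expf_neq0 // ccirc_neq0.
  by apply: ccontX; exact: ccont_ccirc.
have cT n : ccont (fun t => g (ccirc t) * (a ^+ n * ((ccirc t ^+ n)^-1 * ckernel a t))).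
  by apply: ccontM cgc _; apply: ccontM (ccont_cst _) _; apply: ccontM (cV _) ck.
have -> : cint (-1) (fun t => g (ccirc t) * ckernel a t) 0 (2 * pi) =
    'i%C * (2 * pi)%:C%C * (\sum_(j < N) cauchy_coef g j * a ^+ j) +
    cint (-1) (fun t => g (ccirc t) * (a ^+ N * ((ccirc t ^+ N)^-1 * ckernel a t))) 0 (2 * pi).
  elim: N => [|N ->].
    rewrite big_ord0 mulr0 add0r; apply: eq_cint => t.
    by rewrite !expr0 invr1 !mul1r.
  rewrite [in RHS]big_ord_recr /=; set S := \sum_(j < N) _.
  rewrite [in RHS](mulrDr _ S) -[RHS]addrA; congr (_ + _).
  have -> : 'i%C * (2 * pi)%:C%C * (cauchy_coef g N * a ^+ N) =
    cint (-1) (fun t => ('i%C * a ^+ N) * (g (ccirc t) * (ccirc t ^+ N)^-1)) 0 (2 * pi).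
    rewrite cintZ //; last exact: ccontM cgc (cV _).
    rewrite /cauchy_coef; set I := cint _ _ _ _.
    transitivity ('i%C * a ^+ N * I * ((2 * pi)%:C%C * ((2 * pi)^-1)%:C%C)); first by ring.
    by rewrite -rmorphM /= divff ?gt_eqF // mulr1.
  rewrite -cintD //; last by apply: ccontM (ccont_cst _) _; exact: ccontM cgc (cV _).
  apply: eq_cint => t; rewrite /ckernel.
  have h1 := cray_neq0 ha t; have h2 := ccirc_neq0 t.
  by rewrite /cray in h1 *; rewrite !exprS; field; rewrite h1 h2 expf_neq0.
rewrite addrC addKr.
apply: le_trans (@cint_bound _ _ _ (M * (normc a / 2) ^+ N * 2) _ _ _ A0 (ltW pi2) _) _ => //.
- move=> t _; rewrite 3!normcM normcV !normcX normc_ccirc.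
  have hc := normc_ckernel ha t; have hg : normc (g (ccirc t)) <= M.
    by apply: hM; rewrite normc_ccirc.
  have -> : M * (normc a / 2) ^+ N * 2 = M * (normc a ^+ N * ((2 ^+ N)^-1 * 2)).
    by rewrite exprMn exprVn; ring.
  have i0 : 0 <= (2 ^+ N)^-1 :> R by rewrite invr_ge0 exprn_ge0.
  have n0 : 0 <= normc a ^+ N by rewrite exprn_ge0 // normc_ge0.
  apply: ler_pM; rewrite ?normc_ge0 //.
    by rewrite mulr_ge0 // mulr_ge0 // normc_ge0.
  by rewrite ler_wpM2l // ler_wpM2l.
by rewrite subr0 le_eqVlt; apply/orP; left; apply/eqP; ring.
Qed.

Lemma cauchy_coef1 j : cauchy_coef (fun=> 1) j = (j == 0%N)%:R.
Proof.
rewrite /cauchy_coef; case: j => [|j] /=.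
  rewrite (eq_cint _ (psi := fun t => ('i%C)^-1 * ('i%C * 1))) => [|t]; last first.
    by rewrite expr0 invr1 mulr1 mulr1 mulVf // complexi_neq0.
  rewrite cintZ //; last by apply: ccontM; exact: ccont_cst.
  rewrite (@cint_FTC _ _ (fun t => 'i%C * t%:C%C)) //; last 2 first.
  - by apply: ccontM; exact: ccont_cst.
  - move=> t _; apply: (@cderivZ _ 'i%C (fun t => t%:C%C) (fun=> 1)).
    by split => /=; [exact: is_derive_id | exact: is_derive_cst].
  rewrite mulr0 subr0 mulKf; last exact: complexi_neq0.
  by rewrite -rmorphM /= mulVf ?gt_eqF.
rewrite (eq_cint _ (psi := fun t => (2 ^+ j.+1)^-1 * (cis t ^+ j.+1)^-1)) => [|t]; last first.
  by rewrite mul1r /ccirc exprMn invfM.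
rewrite cintZ //; first by rewrite cint_cisV // !mulr0.
apply: ccontV => [t|]; first by rewrite expf_neq0 // cis_neq0.
by apply: ccontX; exact: ccont_cis.
Qed.

(** [cauchy_remainder] for [g = 1]: the only nonzero coefficient is the first, so the value appears
    as [N] grows. *)
Lemma cauchy_kernel_int a : normc a <= 1 ->
  cint (-1) (ckernel a) 0 (2 * pi) = 'i%C * (2 * pi)%:C%C.
Proof.
move=> ha; apply: subr0_eq; apply: normc_small0 => e e0.
have [n hn] := half_power_lt (8 * pi) e0.
have := @cauchy_remainder (fun=> 1) a n.+1 1 (gcont_cst _) ha.
rewrite normc1 => /(_ (fun _ _ => lexx _)).
rewrite big_ord_recl cauchy_coef1 /= expr0 mulr1 big1 ?addr0; last first.
  by move=> j _; rewrite cauchy_coef1 mul0r.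
rewrite (eq_cint _ (psi := ckernel a)) => [|t]; last by rewrite mul1r.
rewrite !mulr1 => /le_trans; apply; apply: le_trans (ltW hn).
rewrite ler_wpM2l ?mulr_ge0 ?pi_ge0 // -exprVn.
apply: le_trans (_ : 2^-1 ^+ n.+1 <= _).
  rewrite lerXn2r ?nnegrE ?divr_ge0 ?normc_ge0 ?invr_ge0 //.
  by rewrite -[leRHS]mul1r ler_wpM2r // invr_ge0.
by rewrite exprS ler_piMl ?exprn_ge0 ?invr_ge0 // invf_le1 // ler1n.
Qed.

Lemma cauchy_series g M a N : gdiff g ->
  (forall z, normc z <= 2 -> normc (g z) <= M) -> normc a <= 1 ->
  normc (g a - \sum_(j < N) cauchy_coef g j * a ^+ j) <= 4 * M * (normc a / 2) ^+ N.
Proof.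
move=> dg hM ha.
have := cauchy_remainder N (gdiff_cont dg) ha hM.
rewrite cauchy_value // cauchy_kernel_int //.
set S := \sum_(j < N) _.
have -> : g a * ('i%C * (2 * pi)%:C%C) - 'i%C * (2 * pi)%:C%C * S =
  'i%C * (2 * pi)%:C%C * (g a - S) by ring.
rewrite !normcM normc_real ger0_norm ?(ltW pi2) //.
rewrite normci mul1r (_ : 8 * pi * M * _ = (2 * pi) * (4 * M * (normc a / 2) ^+ N)); last by ring.
by rewrite ler_pM2l.
Qed.

Lemma cauchy_coef_bound g M j : gcont g ->
  (forall z, normc z <= 2 -> normc (g z) <= M) ->
  normc (cauchy_coef g j) <= 2 * M / 2 ^+ j.
Proof.
move=> cg hM; rewrite /cauchy_coef normcM normc_real ger0_norm ?invr_ge0 ?(ltW pi2) //.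
rewrite ler_pdivrMl //.
apply: le_trans (@cint_bound _ _ _ (M / 2 ^+ j) _ _ _ A0 (ltW pi2) _) _.
- apply: ccontM; first by apply: gcont_comp => //; exact: ccont_ccirc.
  apply: ccontV => [t|]; first by rewrite expf_neq0 // ccirc_neq0.
  by apply: ccontX; exact: ccont_ccirc.
- move=> t _; rewrite normcM normcV normcX normc_ccirc ler_wpM2r ?invr_ge0 ?exprn_ge0 //.
  by rewrite hM ?normc_ccirc.
by rewrite subr0 le_eqVlt; apply/orP; left; apply/eqP; ring.
Qed.

End CauchySeries.

(** * Entire functions of several variables *)

Section Frechet.
Variables (R : realType) (n : nat).
Local Notation C := R[i].
Local Notation V := 'cV[C]_n.
Implicit Types (f : V -> C) (z h L : V).

(** The l1 norm, with values in [R]; the norm of ['cV[C]_n] as a normed module is a complex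
    number. *)
Definition vnorm z : R := \sum_i normc (z i 0).

(** No conjugation: [dotp L] is the linear form with coefficients [L], and [L] plays the part of a
    gradient. *)
Definition dotp L h : C := \sum_i L i 0 * h i 0.

Definition fder f z L := forall e : R, 0 < e -> exists2 d : R, 0 < d &
  forall h, vnorm h < d -> normc (f (z + h) - f z - dotp L h) <= e * vnorm h.

Definition frechet f := forall z, exists L, fder f z L.

Lemma vnorm_ge0 z : 0 <= vnorm z.
Proof. by apply: sumr_ge0 => i _; apply: normc_ge0. Qed.

Lemma vnorm0 : vnorm 0 = 0.
Proof. by rewrite /vnorm big1 // => i _; rewrite mxE normc0. Qed.

Lemma vnormD z h : vnorm (z + h) <= vnorm z + vnorm h.
Proof. by rewrite -big_split ler_sum // => i _; rewrite mxE le_normcD. Qed.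

Lemma vnormZ c z : vnorm (c *: z) = normc c * vnorm z.
Proof. by rewrite /vnorm mulr_sumr; apply: eq_bigr => i _; rewrite mxE normcM. Qed.

Lemma normc_le_vnorm z i : normc (z i 0) <= vnorm z.
Proof.
by rewrite /vnorm (bigD1 i) //= lerDl sumr_ge0 // => j _; apply: normc_ge0.
Qed.

Lemma vnorm_eq0 z : vnorm z = 0 -> z = 0.
Proof.
move=> z0; apply/matrixP => i j; rewrite (ord1 j) mxE; apply: eq0_normc.
by apply/eqP; rewrite eq_le normc_ge0 andbT -z0 normc_le_vnorm.
Qed.

Lemma vnorm_delta i : vnorm (delta_mx i 0) = 1.
Proof.
rewrite /vnorm (bigD1 i) //= mxE !eqxx normc1 big1 ?addr0 // => j ji.
by rewrite mxE (negbTE ji) normc0.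
Qed.

Lemma dotpZ L c h : dotp L (c *: h) = c * dotp L h.
Proof. by rewrite /dotp mulr_sumr; apply: eq_bigr => i _; rewrite mxE mulrCA. Qed.

Lemma dotpD L h h' : dotp L (h + h') = dotp L h + dotp L h'.
Proof. by rewrite /dotp -big_split; apply: eq_bigr => i _; rewrite mxE mulrDr. Qed.

Lemma dotp_delta L i : dotp L (delta_mx i 0) = L i 0.
Proof.
rewrite /dotp (bigD1 i) //= mxE !eqxx mulr1 big1 ?addr0 // => j ji.
by rewrite mxE (negbTE ji) mulr0.
Qed.

Lemma dotp_bound L (M : R) h : (forall i, normc (L i 0) <= M) -> normc (dotp L h) <= M * vnorm h.
Proof.
move=> hL; apply: le_trans (le_normc_sum _ _ _) _; rewrite /vnorm mulr_sumr.
by apply: ler_sum => i _; rewrite normcM ler_wpM2r ?normc_ge0.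
Qed.

Lemma fder_line f z L v : fder f z L ->
  forall e : R, 0 < e -> exists2 d : R, 0 < d & forall t : C, normc t < d ->
    normc (f (z + t *: v) - f z - dotp L v * t) <= e * normc t.
Proof.
move=> hL e e0; have k0 : 0 < 1 + vnorm v by rewrite ltr_pwDl ?vnorm_ge0.
have [d d0 hd] := hL _ (divr_gt0 e0 k0); exists (d / (1 + vnorm v)); first exact: divr_gt0.
move=> t; rewrite ltr_pdivlMr // => ht; have htv : normc t * vnorm v <= normc t * (1 + vnorm v).
  by rewrite ler_wpM2l ?normc_ge0 // lerDr.
have := hd (t *: v); rewrite vnormZ dotpZ [t * _]mulrC => /(_ (le_lt_trans htv ht)) /le_trans; apply.
by rewrite mulrAC ler_pdivrMr // -mulrA ler_wpM2l // ltW.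
Qed.

Lemma gdiff_line f z v : frechet f -> gdiff (fun t => f (z + t *: v)).
Proof.
move=> df p; have [L hL] := df (z + p *: v); exists (dotp L v) => e e0.
have [d d0 hd] := fder_line v hL e0; exists d => // t ht.
by have := hd _ ht; rewrite -(addrA z) -scalerDl [p + _]addrC subrK.
Qed.

Lemma gdiff_ray f v : frechet f -> gdiff (fun t => f (t *: v)).
Proof.
by move=> /(gdiff_line 0 v); rewrite (_ : (fun _ => _) = fun t => f (t *: v)) //;
  apply/funext => t; rewrite add0r.
Qed.

Lemma frechet_cst c : frechet (fun=> c).
Proof.
move=> z; exists 0 => e e0; exists 1 => // h _.
rewrite subrr sub0r normcN /dotp big1 ?normc0 ?mulr_ge0 ?vnorm_ge0 1?ltW // => i _.
by rewrite mxE mul0r.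
Qed.

Lemma frechetD f g : frechet f -> frechet g -> frechet (fun z => f z + g z).
Proof.
move=> df dg z; have [L hL] := df z; have [K hK] := dg z; exists (L + K) => e e0.
have e2 : 0 < e / 2 by rewrite divr_gt0.
have [d1 d10 h1] := hL _ e2; have [d2 d20 h2] := hK _ e2.
exists (Num.min d1 d2); first by rewrite lt_min d10.
move=> h; rewrite lt_min => /andP[/h1 k1 /h2 k2].
have -> : dotp (L + K) h = dotp L h + dotp K h.
  by rewrite /dotp -big_split; apply: eq_bigr => i _; rewrite mxE mulrDl.
rewrite (splitr e) mulrDl; apply: le_trans (lerD k1 k2).
by rewrite (le_trans _ (le_normcD _ _)) // le_eqVlt; apply/orP; left; apply/eqP; congr normc; ring.
Qed.

Lemma frechetZ c f : frechet f -> frechet (fun z => c * f z).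
Proof.
move=> df z; have [L hL] := df z; exists (c *: L) => e e0.
have k0 : 0 < 1 + normc c by rewrite ltr_pwDl ?normc_ge0.
have [d d0 hd] := hL _ (divr_gt0 e0 k0); exists d => // h /hd.
have -> : dotp (c *: L) h = c * dotp L h.
  by rewrite /dotp mulr_sumr; apply: eq_bigr => i _; rewrite mxE mulrA.
rewrite -!mulrBr normcM mulrAC ler_pdivlMr // => hh; apply: le_trans hh.
by rewrite mulrC ler_wpM2l ?normc_ge0 // lerDr.
Qed.

Lemma frechet_sum (I : Type) (r : seq I) (F : I -> V -> C) :
  (forall i, frechet (F i)) -> frechet (fun z => \sum_(i <- r) F i z).
Proof.
move=> dF; elim: r => [|i r IH].
  rewrite (_ : (fun _ => _) = fun=> 0); first exact: frechet_cst.
  by apply/funext => z; rewrite big_nil.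
rewrite (_ : (fun _ => _) = fun z => F i z + \sum_(j <- r) F j z); first exact: frechetD.
by apply/funext => z; rewrite big_cons.
Qed.

Lemma mulmx_vnorm_bound (A : 'M[C]_n) : exists2 K : R, 0 < K & forall h, vnorm (A *m h) <= K * vnorm h.
Proof.
exists (1 + \sum_i \sum_j normc (A i j)).
  by rewrite ltr_pwDl // sumr_ge0 // => i _; rewrite sumr_ge0 // => j _; apply: normc_ge0.
move=> h; apply: (@le_trans _ _ ((\sum_i \sum_j normc (A i j)) * vnorm h)); last first.
  by rewrite ler_wpM2r ?vnorm_ge0 // lerDr.
rewrite mulr_suml ler_sum // => i _; rewrite mxE.
apply: le_trans (le_normc_sum _ _ _) _; rewrite mulr_suml ler_sum // => j _.
by rewrite normcM ler_wpM2l ?normc_ge0 // normc_le_vnorm.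
Qed.

Lemma frechet_affine f (A : 'M[C]_n) w : frechet f -> frechet (fun z => f (A *m z + w)).
Proof.
move=> df z; have [L hL] := df (A *m z + w); exists (A^T *m L) => e e0.
have [K K0 hK] := mulmx_vnorm_bound A.
have [d d0 hd] := hL _ (divr_gt0 e0 K0); exists (d / K); first exact: divr_gt0.
move=> h; rewrite ltr_pdivlMr // mulrC => hh.
have := hd (A *m h) (le_lt_trans (hK h) hh).
rewrite (_ : A *m (z + h) + w = A *m z + w + A *m h); last by rewrite mulmxDr addrAC.
have -> : dotp (A^T *m L) h = dotp L (A *m h).
  rewrite /dotp; under eq_bigr do rewrite mxE mulr_suml.
  rewrite exchange_big /=; apply: eq_bigr => i _; rewrite mxE mulr_sumr.
  by apply: eq_bigr => j _; rewrite mxE; ring.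
move=> /le_trans; apply; rewrite -mulrA ler_wpM2l ?(ltW e0) // mulrC ler_pdivrMr // mulrC.
exact: hK.
Qed.

Lemma frechet_translate f w : frechet f -> frechet (fun z => f (z + w)).
Proof.
move=> /(frechet_affine 1%:M w).
by rewrite (_ : (fun _ => _) = fun z => f (z + w)) //; apply/funext => z; rewrite mul1mx.
Qed.

Lemma frechet_scale f c : frechet f -> frechet (fun z => f (c *: z)).
Proof.
move=> /(frechet_affine c%:M 0).
by rewrite (_ : (fun _ => _) = fun z => f (c *: z)) //; apply/funext => z; rewrite mul_scalar_mx addr0.
Qed.

Definition vcont f := forall z (e : R), 0 < e -> exists2 d : R, 0 < d &
  forall w, vnorm (w - z) < d -> normc (f w - f z) < e.

Lemma frechet_cont f : frechet f -> vcont f.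
Proof.
move=> df z e e0; have [L hL] := df z; have [d d0 hd] := hL 1 ltr01.
pose M := vnorm L; have k0 : 0 < 1 + M by rewrite ltr_pwDl ?vnorm_ge0.
exists (Num.min d (e / (1 + M))); first by rewrite lt_min d0 divr_gt0.
move=> w; rewrite lt_min ltr_pdivlMr // => /andP[/hd h1 h2].
move: h1; rewrite (_ : z + (w - z) = w); last by rewrite addrC subrK.
move=> h1.
apply: le_lt_trans h2; rewrite mulrDr mulr1.
rewrite -[f w - f z](subrK (dotp L (w - z))).
apply: le_trans (le_normcD _ _) (lerD _ _); first by rewrite -[leRHS]mul1r.
rewrite [leRHS]mulrC; apply: dotp_bound => i; exact: normc_le_vnorm.
Qed.

(** Compactness is used for boxes in [R^(2n)], after writing [z] in real and imaginary parts. *)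
Lemma vcont_bounded f : vcont f -> forall r : R, exists M : R, forall z, vnorm z <= r -> normc (f z) <= M.
Proof.
move=> cf r.
pose c (x : 'rV[R]_(n + n)) : V := \col_i (x 0 (lshift n i) +i* x 0 (rshift n i))%C.
pose F x := normc (f (c x)).
have cF : continuous F.
  move=> x; apply/(@cvgrPdist_lt _ _ _ _ (nbhs_filter x)) => e e0.
  have [d d0 hd] := cf (c x) e e0.
  (* The distance in [vnorm] adds up [2n] real coordinates; [n.+1] keeps the inequality strict and
     covers [n = 0]. *)
  have k0 : 0 < 2 * n.+1%:R :> R by rewrite mulr_gt0.
  apply/nbhs_ballP; exists (d / (2 * n.+1%:R)); first exact: divr_gt0.
  move=> y xy; apply: le_lt_trans (hd (c y) _).
    by rewrite distrC; apply: ler_dist_normc.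
  have xy' i : `|y 0 i - x 0 i| <= d / (2 * n.+1%:R).
    by rewrite distrC ltW //; exact: (xy.2 0 i).
  apply: (@le_lt_trans _ _ (\sum_(i < n) (d / n.+1%:R))).
    apply: ler_sum => i _; rewrite !mxE; apply: le_trans (normc_le_ReIm _) _ => /=.
    have -> : d / n.+1%:R = d / (2 * n.+1%:R) + d / (2 * n.+1%:R).
      have : n.+1%:R != 0 :> R by rewrite pnatr_eq0.
      by move: (n.+1%:R : R) => m m0; field.
    exact: lerD.
  rewrite sumr_const card_ord -[ltLHS]mulr_natr mulrAC ltr_pdivrMr // ltr_pM2l // ltr_nat //.
have cK : compact [set v : 'rV[R]_(n + n) | forall i, `[- r, r]%classic (v 0 i)].
  by apply: (@rV_compact R _ (fun=> `[- r, r]%classic)) => i; exact: segment_compact.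
have [M [_ hM]] := compact_bounded (continuous_compact (continuous_subspaceT cF) cK).
exists (M + 1) => z hz.
pose x : 'rV[R]_(n + n) := row_mx (\row_i complex.Re (z i 0)) (\row_i complex.Im (z i 0)).
have cx : c x = z.
  by apply/matrixP => i j; rewrite (ord1 j) mxE row_mxEl row_mxEr !mxE; case: (z i 0).
apply: le_trans (ler_norm _) _; apply: hM; first by rewrite ltrDl.
exists x; last by rewrite /F cx.
move=> i; rewrite /= in_itv /= -ler_norml.
case: (splitP i) => j ij.
  have -> : i = lshift n j by apply/val_inj.
  by rewrite row_mxEl mxE (le_trans (Re_le_normc _)) // (le_trans (normc_le_vnorm _ _)).
have -> : i = rshift n j by apply/val_inj.
by rewrite row_mxEr mxE (le_trans (Im_le_normc _)) // (le_trans (normc_le_vnorm _ _)).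
Qed.

End Frechet.

Section EntireFrechet.
Variables (R : realType) (n : nat).
Local Notation C := R[i].
Local Notation V := 'cV[C]_n.

Lemma le_norm_vnorm (h : V) : `|h| <= (vnorm h)%:C%C.
Proof.
rewrite [`|h|]mx_normE; have h0 : 0 <= (vnorm h)%:C%C :> C by rewrite lecR vnorm_ge0.
rewrite (_ : (vnorm h)%:C%C = (NngNum h0)%:num) // num_le.
apply/bigmax_leP; split => //= [[i j]] _ /=.
by rewrite -num_le /= (ord1 j) normcE lecR normc_le_vnorm.
Qed.

Lemma vnorm_le_norm (h : V) : (vnorm h)%:C%C <= n%:R * `|h|.
Proof.
apply: (@le_trans _ _ (\sum_(i < n) `|h|)); last by rewrite sumr_const card_ord mulr_natl.
rewrite /vnorm rmorph_sum /=.
apply: ler_sum => i _; rewrite -normcE [`|h|]mx_normE.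
have -> : `|h i 0| = (`|h (i, 0 : 'I_1).1 (i, 0 : 'I_1).2|%:nng)%:num by [].
by rewrite num_le; apply: le_bigmax.
Qed.

Let VN : normedModType C := 'cV[C]_n.
Let WN : normedModType C := R[i]^o.

(** The two norms are equivalent. On the left [eps] is complex; being positive, it is real. *)
Lemma littleo_vnorm (g : V -> R[i]^o) :
  (forall eps : C, 0 < eps -> nbhs (0 : VN) [set h : VN | `|g h| <= eps * `|h|]) <->
  forall e : R, 0 < e -> exists2 d : R, 0 < d &
    forall h, vnorm h < d -> normc (g h : C) <= e * vnorm h.
Proof.
split=> [hg e e0|hg eps].
  have e0' : 0 < e%:C%C :> C by rewrite ltcR.
  have /nbhs_ballP [d /= d0 hd] := hg _ e0'.
  have dE : d = (complex.Re d)%:C%C by rewrite RRe_real // gtr0_real.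
  exists (complex.Re d); first by rewrite -ltcR -dE.
  move=> h hh; have := hd h.
  rewrite -ball_normE /ball_ /= sub0r normrN.
  have hd' : `|h| < d by apply: le_lt_trans (le_norm_vnorm h) _; rewrite dE ltcR.
  move=> /(_ hd'); rewrite [X in X <= _](_ : _ = (normc (g h : C))%:C%C); last exact: normcE.
  move=> h1; rewrite -lecR; apply: le_trans h1 _.
  by rewrite rmorphM /= ler_wpM2l ?le_norm_vnorm // lecR ltW.
move=> eps0; have epsE : eps = (complex.Re eps)%:C%C by rewrite RRe_real // gtr0_real.
have e0 : 0 < complex.Re eps by rewrite -ltcR -epsE.
have n0 : 0 < n.+1%:R :> R by [].
have [d d0 hd] := hg _ (divr_gt0 e0 n0).
apply/nbhs_ballP; exists (d / n.+1%:R)%:C%C => /=; first by rewrite ltcR divr_gt0.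
move=> h; rewrite -ball_normE /ball_ /= sub0r normrN => hh.
have hnE : `|h| = (complex.Re `|h|)%:C%C by rewrite RRe_real // normr_real.
have hv : vnorm h <= n.+1%:R * complex.Re `|h|.
  rewrite -lecR; apply: le_trans (vnorm_le_norm h) _.
  rewrite rmorphM /= -hnE rmorph_nat ler_wpM2r // ler_nat //.
rewrite [X in X <= _](_ : _ = (normc (g h : C))%:C%C); last exact: normcE.
rewrite epsE hnE -rmorphM /= lecR; apply: le_trans (hd _ _) _.
  apply: le_lt_trans hv _; rewrite mulrC -ltr_pdivlMr // -ltcR -hnE //.
by rewrite mulrAC ler_pdivrMr // -mulrA [_ * n.+1%:R]mulrC ler_wpM2l // ltW.
Qed.

Lemma dotp_is_linear (L : V) : linear (dotp L : V -> R[i]^o).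
Proof. by move=> c u v; rewrite dotpD dotpZ. Qed.

(** A [C]-linear differential is [dotp L], where [L] collects its values on the basis vectors;
    conversely [dotp L] is continuous coordinate by coordinate. *)
Lemma entire_frechet (f : cfun R n) : entire f <-> frechet (f : V -> C).
Proof.
split=> df z.
  have /diff_locallyP [dc] := df z.
  set D := 'd f (z : VN) => /eqaddoP /littleo_vnorm E.
  pose L : V := \col_i (D (delta_mx i 0) : C).
  have DL h : D h = dotp L h.
    rewrite [h in LHS](matrix_sum_delta h) linear_sum /dotp; apply: eq_bigr => i _.
    by rewrite big_ord1 linearZ mxE mulrC.
  exists L => e e0; have [d d0 hd] := E e e0; exists d => // h /hd.
  by rewrite /= !fctE /= DL opprD addrA [h + z]addrC.
have [L hL] := df z.
pose dL := GRing.isLinear.Build C V R[i]^o _ (dotp L : V -> R[i]^o) (dotp_is_linear L).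
pose D : {linear VN -> WN} := HB.pack (dotp L : V -> R[i]^o) dL.
have DE : (D : V -> _) = dotp L by [].
have cD : continuous (D : VN -> WN).
  rewrite DE (_ : (dotp L : V -> R[i]^o) = \sum_(i < n) (fun h : V => L i 0 *: (h i 0 : R[i]^o))).
    elim/big_ind: _ => [|g1 g2 c1 c2|i _] x.
    - exact: cst_continuous.
    - exact: (cvgD (c1 x) (c2 x)).
    - exact: (cvgZl_tmp (k := L i 0) (@coord_continuous C n 1 i 0 x)).
  by apply/funext => h; rewrite fct_sumE /dotp.
have E : f \o shift (z : VN) = cst (f z) + D +o_ (0 : VN) id.
  apply/eqaddoP/littleo_vnorm => e e0; have [d d0 hd] := hL e e0; exists d => // h /hd.
  by rewrite /= !fctE /= opprD addrA [h + z]addrC.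
by apply/diff_locallyP; rewrite (diff_unique cD E).
Qed.

End EntireFrechet.

Section FrechetProducts.
Variables (R : realType) (n : nat).
Local Notation C := R[i].
Local Notation V := 'cV[C]_n.

Lemma frechetM (f g : V -> C) : frechet f -> frechet g -> frechet (fun z => f z * g z).
Proof.
move=> /(entire_frechet (f : cfun R n)) df /(entire_frechet (g : cfun R n)) dg.
by apply/entire_frechet => z; apply: (@differentiableM C 'cV[C]_n).
Qed.

Lemma frechet_prod (I : Type) (r : seq I) (F : I -> V -> C) :
  (forall i, frechet (F i)) -> frechet (fun z => \prod_(i <- r) F i z).
Proof.
move=> dF; elim: r => [|i r IH].
  by rewrite (_ : (fun _ => _) = fun=> 1); [exact: frechet_cst | apply/funext => z; rewrite big_nil].
rewrite (_ : (fun _ => _) = fun z => F i z * \prod_(j <- r) F j z); first exact: frechetM.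
by apply/funext => z; rewrite big_cons.
Qed.

Lemma frechet_coordX i m : frechet (fun z : V => (z i 0 : C) ^+ m).
Proof.
elim: m => [|m IH]; first by under eq_fun do rewrite expr0; exact: frechet_cst.
under eq_fun do rewrite exprS; apply: frechetM => //.
apply/(entire_frechet (fun z : V => z i 0 : R[i]^o)) => z.
exact: (@differentiable_coord C n 1).
Qed.

End FrechetProducts.

(** * Taylor coefficients and averages over roots of unity *)

Section Coefficients.
Variable R : realType.
Local Notation C := R[i].
Implicit Types (g : C -> C) (M e : R).

Lemma half_power_le M e : 0 < e -> exists N0, forall N, (N0 <= N)%N -> M / 2 ^+ N <= e.
Proof.
move=> e0; have [N0 hN0] := half_power_lt `|M| e0; exists N0 => N hN.
apply: le_trans (ltW hN0); apply: (@le_trans _ _ (`|M| / 2 ^+ N)).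
  by rewrite ler_wpM2r ?invr_ge0 ?exprn_ge0 // ler_norm.
by rewrite ler_wpM2l // lef_pV2 ?posrE ?exprn_gt0 // ler_weXn2l // ler1n.
Qed.

Lemma complex_cauchy (u : nat -> C) :
  (forall e : R, 0 < e -> exists N0, forall N N', (N0 <= N)%N -> (N0 <= N')%N -> normc (u N - u N') <= e) ->
  exists l, forall e : R, 0 < e -> exists N0, forall N, (N0 <= N)%N -> normc (u N - l) <= e.
Proof.
move=> hu.
have cv (p : C -> R) : (forall x y, `|p x - p y| <= normc (x - y)) -> exists l : R, forall e : R, 0 < e ->
    exists N0, forall N, (N0 <= N)%N -> `|p (u N) - l| <= e.
  move=> hp; have /cauchy_cvgP/cvg_ex[l hl] : cauchy ((p \o u) @ \oo).
    apply/cauchy_ballP => e e0; have e2 : 0 < e / 2 by rewrite divr_gt0.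
    have [N0 hN] := hu _ e2.
    exists ([set x | exists2 N, (N0 <= N)%N & x = p (u N)], [set x | exists2 N, (N0 <= N)%N & x = p (u N)]).
      by split; exists N0 => // N /= hN0; exists N.
    move=> [x y] /= [[N h1 ->] [N' h2 ->]]; rewrite /ball /=.
    apply: le_lt_trans (hp _ _) _; apply: le_lt_trans (hN _ _ h1 h2) _.
    by rewrite ltr_pdivrMr // ltr_pMr // ltr1n.
  exists l => e e0; have /cvgrPdist_le /(_ e e0) [N0 _ h] := hl.
  by exists N0 => N hN; rewrite distrC; apply: h.
have [lr hr] := cv (@complex.Re R) (fun x y => eq_ind _ (fun z => `|z| <= _) (Re_le_normc (x - y)) _ (cReB x y)).
have [li hi] := cv (@complex.Im R) (fun x y => eq_ind _ (fun z => `|z| <= _) (Im_le_normc (x - y)) _ (cImB x y)).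
exists (lr +i* li)%C => e e0; have e2 : 0 < e / 2 by rewrite divr_gt0.
have [N1 h1] := hr _ e2; have [N2 h2] := hi _ e2; exists (maxn N1 N2) => N.
rewrite geq_max => /andP[/h1 k1 /h2 k2].
by apply: le_trans (normc_le_ReIm _) _; rewrite cReB cImB (splitr e) lerD.
Qed.

Lemma cauchy_coef_at0 g M : gdiff g -> (forall z, normc z <= 2 -> normc (g z) <= M) ->
  cauchy_coef g 0 = g 0.
Proof.
move=> dg hM; apply/esym/subr0_eq; apply: normc_small0 => e e0.
have := @cauchy_series _ g M 0 1 dg hM; rewrite normc0 mul0r expr1 mulr0 => /(_ ler01).
by rewrite big_ord1 expr0 mulr1 => /le_trans; apply; exact: ltW.
Qed.

(** At a small real [t] the expansion given by the derivative and the Taylor expansion with two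
    terms are compared and divided by [t]. *)
Lemma cauchy_coef_derive g M B : gdiff g -> (forall z, normc z <= 2 -> normc (g z) <= M) ->
  (forall e, 0 < e -> exists2 d : R, 0 < d & forall t, normc t < d ->
     normc (g t - g 0 - B * t) <= e * normc t) ->
  cauchy_coef g 1 = B.
Proof.
move=> dg hM hB; apply: subr0_eq; apply: normc_small0 => e e0.
have M0 : 0 <= M by apply: le_trans (normc_ge0 _) (hM 0 _); rewrite normc0.
have e2 : 0 < e / 2 by rewrite divr_gt0.
have [d d0 hd] := hB _ e2.
have k0 : 0 < 2 * (M + 1) by rewrite mulr_gt0 // ltr_wpDl.
(* The three bounds serve the differentiability estimate, the Taylor estimate on the unit disc, and
   [M * t <= e / 2]. *)
pose t := Num.min (d / 2) (Num.min 1 (e / (2 * (M + 1)))).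
have t0 : 0 < t by rewrite !lt_min ltr01 !divr_gt0.
have td : t < d by rewrite gt_min ltr_pdivrMr // ltr_pMr // ltr1n.
have t1 : t <= 1 by rewrite !ge_min lexx orbT.
have te : M * t <= e / 2.
  have : t <= e / (2 * (M + 1)) by rewrite !ge_min lexx !orbT.
  rewrite ler_pdivlMr // => h; rewrite ler_pdivlMr //; apply: le_trans h.
  by clear -t0 M0; nra.
have nt : normc (t%:C%C : C) = t by rewrite normc_real ger0_norm // ltW.
have h1 := hd t%:C%C; rewrite nt in h1; have {}h1 := h1 td.
have h2 := @cauchy_series _ g M t%:C%C 2 dg hM; rewrite nt in h2; have {}h2 := h2 t1.
rewrite big_ord_recl big_ord1 /= expr0 mulr1 expr1 (cauchy_coef_at0 dg hM) in h2.
have : normc ((cauchy_coef g 1 - B) * t%:C%C) <= e / 2 * t + 4 * M * (t / 2) ^+ 2.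
  apply: le_trans (lerD h1 h2); apply: le_trans (le_normcB _ _).
  by rewrite le_eqVlt; apply/orP; left; apply/eqP; congr normc; rewrite /bump /=; ring.
rewrite normcM nt => h3; rewrite -(ler_pM2r t0); apply: le_trans h3 _.
have -> : 4 * M * (t / 2) ^+ 2 = (M * t) * t by field.
by rewrite -mulrDl ler_pM2r // [leRHS](splitr e) lerD2l.
Qed.

Definition proot N : C := sval (cid (complex_prim_root_exists R (ltn0Sn N))).

Lemma prootP N : N.+1.-primitive_root (proot N).
Proof. by rewrite /proot; case: cid. Qed.

Lemma normc_proot N k : normc (proot N ^+ k) = 1.
Proof. exact: normc_prim_root (prootP N). Qed.

(** A discrete Fourier coefficient: Cauchy's integral over the unit circle sampled at [N + 1]
    points. The order [N + 1] keeps the degrees [0, ..., N] apart. *)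
Definition root_avg N d g : C :=
  N.+1%:R^-1 * \sum_(k < N.+1) ((proot N ^+ k) ^+ d)^-1 * g (proot N ^+ k).

Lemma root_avg_bound N d g M : (forall k, normc (g (proot N ^+ k)) <= M) ->
  normc (root_avg N d g) <= M.
Proof.
move=> hM; rewrite /root_avg normcM normcV normc_nat ler_pdivrMl //.
apply: le_trans (le_normc_sum _ _ _) _.
apply: (@le_trans _ _ (\sum_(k < N.+1) M)); last by rewrite sumr_const card_ord mulr_natl.
by apply: ler_sum => k _; rewrite normcM normcV normcX normc_proot expr1n invr1 mul1r.
Qed.

Lemma root_avg_poly N d (c : nat -> C) : (d <= N)%N ->
  root_avg N d (fun t => \sum_(j < N.+1) c j * t ^+ j) = c d.
Proof.
move=> dN; transitivity (\sum_(j < N.+1) c j *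
    (N.+1%:R^-1 * \sum_(k < N.+1) ((proot N ^+ k) ^+ d)^-1 * (proot N ^+ k) ^+ j)).
  rewrite /root_avg mulr_sumr; under eq_bigr do rewrite !mulr_sumr.
  rewrite exchange_big /=; apply: eq_bigr => j _; rewrite !mulr_sumr.
  by apply: eq_bigr => k _; ring.
rewrite (bigD1 (Ordinal (dN : (d < N.+1)%N))) //= (unity_root_average d d (prootP N)) eqxx mulr1.
rewrite big1 ?addr0 // => j jd; rewrite (unity_root_average d j (prootP N)).
by rewrite !modn_small // -(inj_eq val_inj) /= in jd *; rewrite (negbTE jd) mulr0.
Qed.

(** The average is exact on the Taylor polynomial of degree [N] and does not enlarge a uniform bound
    on the remainder. The factor [l] serves the homogeneity of the Taylor components. *)
Lemma root_avg_coef N d g M l : gdiff g -> (forall z, normc z <= 2 -> normc (g z) <= M) ->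
  (d <= N)%N -> normc l <= 1 ->
  normc (root_avg N d (fun t => g (l * t)) - cauchy_coef g d * l ^+ d) <= 4 * M / 2 ^+ N.+1.
Proof.
move=> dg hM dN l1.
have M0 : 0 <= M by apply: le_trans (normc_ge0 _) (hM 0 _); rewrite normc0.
pose p t := \sum_(j < N.+1) cauchy_coef g j * t ^+ j.
have -> : cauchy_coef g d * l ^+ d = root_avg N d (fun t => p (l * t)).
  rewrite -(root_avg_poly (fun j => cauchy_coef g j * l ^+ j) dN); congr (_ * _).
  apply: eq_bigr => k _; congr (_ * _); rewrite /p; apply: eq_bigr => j _.
  by rewrite exprMn mulrA.
have -> : root_avg N d (fun t => g (l * t)) - root_avg N d (fun t => p (l * t)) =
    root_avg N d (fun t => g (l * t) - p (l * t)).
  by rewrite /root_avg -mulrBr -sumrB; congr (_ * _); apply: eq_bigr => k _; rewrite mulrBr.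
apply: root_avg_bound => k.
have lk : normc (l * proot N ^+ k) <= 1 by rewrite normcM normc_proot mulr1.
apply: le_trans (cauchy_series _ dg hM lk) _.
rewrite -exprVn ler_wpM2l ?mulr_ge0 // lerXn2r ?nnegrE ?divr_ge0 ?invr_ge0 ?normc_ge0 //.
by rewrite -[leRHS]mul1r ler_wpM2r // invr_ge0.
Qed.

End Coefficients.

(** * Locally uniform limits of entire functions *)

Section Weierstrass.
Variables (R : realType) (n : nat).
Local Notation C := R[i].
Local Notation V := 'cV[C]_n.
Implicit Types (f : V -> C) (z h L : V) (M : R).

Lemma line_bound f z v M : (forall w, vnorm (w - z) <= 2 -> normc (f w) <= M) -> vnorm v <= 1 ->
  forall t, normc t <= 2 -> normc (f (z + t *: v)) <= M.
Proof.
move=> hM hv t ht; apply: hM; rewrite addrC addKr vnormZ -[leRHS]mulr1.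
by apply: ler_pM; rewrite ?normc_ge0 ?vnorm_ge0.
Qed.

Lemma fder_coef f z L M v : frechet f -> fder f z L ->
  (forall w, vnorm (w - z) <= 2 -> normc (f w) <= M) -> vnorm v <= 1 ->
  cauchy_coef (fun t => f (z + t *: v)) 1 = dotp L v.
Proof.
move=> df hL hM hv; apply: (cauchy_coef_derive (gdiff_line z v df) (line_bound hM hv)).
move=> e e0; have [d d0 hd] := fder_line v hL e0; exists d => // t /hd.
by rewrite scale0r addr0.
Qed.

Lemma fder_bound f z L M i : frechet f -> fder f z L ->
  (forall w, vnorm (w - z) <= 2 -> normc (f w) <= M) -> normc (L i 0) <= M.
Proof.
move=> df hL hM; have hv : vnorm (delta_mx i 0 : V) <= 1 by rewrite vnorm_delta.
rewrite -(dotp_delta L) -(fder_coef df hL hM hv).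
have := cauchy_coef_bound 1 (gdiff_cont (gdiff_line z (delta_mx i 0) df)) (line_bound hM hv).
by rewrite expr1 mulrAC divff ?mul1r.
Qed.

(** The Taylor estimate with two terms along [h / |h|], at the parameter [|h|]:
    [4 M (|h| / 2)^2 = M |h|^2]. The constant depends on the bound of [f] alone, hence survives
    limits. *)
Lemma fder_quad f z L M h : frechet f -> fder f z L ->
  (forall w, vnorm (w - z) <= 2 -> normc (f w) <= M) -> vnorm h <= 1 ->
  normc (f (z + h) - f z - dotp L h) <= M * vnorm h ^+ 2.
Proof.
move=> df hL hM h1; have [h0|hn0] := eqVneq (vnorm h) 0.
  by rewrite (vnorm_eq0 h0) addr0 subrr sub0r normcN /dotp big1 ?normc0 ?vnorm0 ?expr0n /= ?mulr0 // => i _; rewrite mxE mulr0.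
have hC : (vnorm h)%:C%C != 0 :> C by rewrite -normc_eq0 normc_real normr_eq0.
pose v : V := ((vnorm h)%:C%C)^-1 *: h.
have hv : vnorm v <= 1.
  by rewrite vnormZ normcV normc_real ger0_norm ?vnorm_ge0 // mulVf.
have hE : h = (vnorm h)%:C%C *: v by rewrite scalerA divff // scale1r.
have nh : normc ((vnorm h)%:C%C : C) = vnorm h by rewrite normc_real ger0_norm ?vnorm_ge0.
have dg := gdiff_line z v df; have bg := line_bound hM hv.
have := @cauchy_series _ _ M (vnorm h)%:C%C 2 dg bg; rewrite nh => /(_ h1).
rewrite big_ord_recl big_ord1 /= expr0 mulr1 expr1 (cauchy_coef_at0 dg bg) (fder_coef df hL hM hv).
rewrite -hE scale0r addr0 [dotp L v * _]mulrC -dotpZ -hE opprD addrA => /le_trans; apply.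
by rewrite le_eqVlt; apply/orP; left; apply/eqP; field.
Qed.

(** [fder_bound], applied to [F N - F N'], makes the gradients a Cauchy sequence. The quadratic
    estimate of [fder_quad] holds with one constant for all large [N], and its limit gives the
    differentiability of [f]. *)
Lemma weierstrass (F : nat -> V -> C) f : (forall N, frechet (F N)) ->
  (forall (r e : R), 0 < e -> exists N0, forall N, (N0 <= N)%N -> forall z, vnorm z <= r ->
     normc (F N z - f z) <= e) ->
  frechet f.
Proof.
move=> dF hF z; pose r := vnorm z + 2.
have ball w : vnorm (w - z) <= 2 -> vnorm w <= r.
  move=> hw; rewrite -(subrK z w) addrC /r; apply: le_trans (vnormD _ _) _.
  by rewrite lerD2l.
have [L hL] := choice (fun N => dF N z).
have [N1 hN1] := hF r 1 ltr01.
have [M1 hM1] := vcont_bounded (frechet_cont (dF N1)) r.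
have M10 : 0 <= M1.
  by apply: le_trans (normc_ge0 _) (hM1 z _); rewrite /r lerDl.
(* [F N] is within 1 of [f], and [f] within 1 of [F N1], which is bounded by [M1]. *)
pose M := M1 + 2.
have hM N w : (N1 <= N)%N -> vnorm (w - z) <= 2 -> normc (F N w) <= M.
  move=> hN /ball hw; have h1 := hN1 _ hN w hw; have h2 := hN1 _ (leqnn _) w hw.
  have h3 := hM1 w hw.
  have -> : F N w = (F N w - f w) + ((f w - F N1 w) + F N1 w) by ring.
  have -> : M = 1 + (1 + M1) by rewrite /M; ring.
  apply: le_trans (le_normcD _ _) (lerD h1 _).
  by apply: le_trans (le_normcD _ _) (lerD _ h3); rewrite distc_sym.
have lim i : exists l, forall e : R, 0 < e -> exists N0, forall N, (N0 <= N)%N -> normc (L N i 0 - l) <= e.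
  apply: complex_cauchy => e e0; have e2 : 0 < e / 2 by rewrite divr_gt0.
  have [N0 hN0] := hF r _ e2; exists N0 => N N' hN hN'.
  pose g w := F N w + (-1) * F N' w.
  have dg : frechet g by apply: frechetD => //; apply: frechetZ.
  have gL : fder g z (L N - L N').
    move=> e' e'0; have e'2 : 0 < e' / 2 by rewrite divr_gt0.
    have [d1 d10 k1] := hL N _ e'2; have [d2 d20 k2] := hL N' _ e'2.
    exists (Num.min d1 d2); first by rewrite lt_min d10.
    move=> h; rewrite lt_min => /andP[/k1 {}k1 /k2 {}k2].
    have -> : dotp (L N - L N') h = dotp (L N) h - dotp (L N') h.
      by rewrite /dotp -sumrB; apply: eq_bigr => j _; rewrite !mxE mulrBl.
    rewrite (splitr e') mulrDl; apply: le_trans (lerD k1 k2).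
    apply: le_trans (le_normcB _ _).
    by rewrite le_eqVlt; apply/orP; left; apply/eqP; congr normc; rewrite /g; ring.
  have -> : L N i 0 - L N' i 0 = (L N - L N') i 0 by rewrite !mxE.
  apply: (fder_bound i dg gL) => w /ball hw; rewrite /g mulN1r.
  have -> : F N w - F N' w = (F N w - f w) - (F N' w - f w) by ring.
  by apply: le_trans (le_normcB _ _) _; rewrite (splitr e) lerD // ?hN0.
have [l hl] := choice lim; exists (\col_i l i).
set l' := \col_i l i.
have quad h : vnorm h <= 1 -> normc (f (z + h) - f z - dotp l' h) <= M * vnorm h ^+ 2.
  move=> h1; apply/ler_addgt0Pr => e e0; have e4 : 0 < e / 4 by rewrite divr_gt0.
  have n0 : 0 < n.+1%:R :> R by [].
  have [K1 hK1] := hF r _ e4.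
  have : forall i : 'I_n, exists N0 : nat, forall N, (N0 <= N)%N -> normc (L N i 0 - l i) <= e / 4.
    by move=> i; apply: hl.
  move=> /choice [K hK]; pose N := maxn N1 (maxn K1 (\max_i K i)).
  have hN1' : (N1 <= N)%N by rewrite leq_maxl.
  have hNK1 : (K1 <= N)%N by rewrite !leq_max leqnn orbT.
  have hNK i : (K i <= N)%N by rewrite !leq_max (leq_bigmax i) !orbT.
  have q := fder_quad (dF N) (hL N) (fun w hw => hM N w hN1' hw) h1.
  have zr : vnorm z <= r by rewrite lerDl.
  have zhr : vnorm (z + h) <= r.
    by apply: ball; rewrite addrC addKr (le_trans h1) // ler1n.
  have q1 := hK1 _ hNK1 _ zr; have q2 := hK1 _ hNK1 _ zhr.
  have q3 : normc (dotp (L N) h - dotp l' h) <= e / 4.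
    have -> : dotp (L N) h - dotp l' h = dotp (L N - l') h.
      by rewrite /dotp -sumrB; apply: eq_bigr => j _; rewrite !mxE mulrBl.
    apply: le_trans (@dotp_bound _ _ _ (e / 4) _ _) _ => [i|].
      by rewrite !mxE; apply: hK.
    by rewrite -[leRHS]mulr1 ler_wpM2l // ltW.
  have -> : f (z + h) - f z - dotp l' h = (F N (z + h) - F N z - dotp (L N) h) +
     ((F N z - f z) - (F N (z + h) - f (z + h)) + (dotp (L N) h - dotp l' h)) by ring.
  apply: le_trans (le_normcD _ _) _; apply: lerD => //.
  apply: le_trans (le_normcD _ _) _.
  have q4 := le_trans (le_normcB _ _) (lerD q1 q2).
  by clear -q3 q4 e0; lra.
move=> e e0; have M0 : 0 < M by rewrite ltr_wpDl.
exists (Num.min 1 (e / M)); first by rewrite lt_min ltr01 divr_gt0.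
move=> h; rewrite lt_min => /andP[/ltW h1]; rewrite ltr_pdivlMr // => h2.
apply: le_trans (quad h h1) _; rewrite expr2 mulrA ler_wpM2r ?vnorm_ge0 // mulrC.
exact: ltW.
Qed.

End Weierstrass.

(** * Homogeneous Taylor components *)

Section LinearSpan.
Variables (R : realType) (W : lmodType R[i]).
Implicit Types (A B : set W) (u v : W).

Lemma lspan_gen A u : A u -> lspan A u.
Proof.
move=> Au; exists 1%N, (fun=> 1), (fun=> u); split => //.
by rewrite big_ord1 scale1r.
Qed.

Lemma lspan0 A : lspan A 0.
Proof. by exists 0%N, (fun=> 0), (fun=> 0); split=> [[]|] //; rewrite big_ord0. Qed.

Lemma lspanZ A a u : lspan A u -> lspan A (a *: u).
Proof.
move=> [N [c [w [Aw ->]]]]; exists N, (fun l => a * c l), w; split => //.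
by rewrite scaler_sumr; apply: eq_bigr => l _; rewrite scalerA.
Qed.

Lemma lspanD A u v : lspan A u -> lspan A v -> lspan A (u + v).
Proof.
move=> [N [c [w [Aw ->]]]] [N' [c' [w' [Aw' ->]]]].
exists (N + N')%N, (fun l => match fintype.split l with inl i => c i | inr j => c' j end),
  (fun l => match fintype.split l with inl i => w i | inr j => w' j end); split.
  by move=> l; case: fintype.split.
by rewrite big_split_ord /=; congr (_ + _); apply: eq_bigr => l _;
  [rewrite (unsplitK (inl l)) | rewrite (unsplitK (inr l))].
Qed.

Lemma lspan_sum A (I : Type) (r : seq I) (P : pred I) (F : I -> W) :
  (forall i, P i -> lspan A (F i)) -> lspan A (\sum_(i <- r | P i) F i).
Proof.
by move=> h; elim/big_rec: _ => [|i u Pi]; [exact: lspan0 | move/(lspanD (h i Pi))].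
Qed.

Lemma lspan_min A B : A `<=` B -> B 0 ->
  (forall (a : R[i]) u v, B u -> B v -> B (a *: u + v)) -> lspan A `<=` B.
Proof.
move=> AB B0 BL _ [N [c [w [Aw ->]]]].
by elim/big_rec: _ => [|l u _ Bu] //; apply: BL => //; apply: AB.
Qed.

Lemma lspanS A B : A `<=` B -> lspan A `<=` lspan B.
Proof.
move=> AB; apply: lspan_min; [|exact: lspan0|by move=> a u v hu hv; apply: lspanD => //; apply: lspanZ].
by move=> u /AB; apply: lspan_gen.
Qed.

End LinearSpan.

Section Taylor.
Variables (R : realType) (n : nat).
Local Notation C := R[i].
Local Notation V := 'cV[C]_n.
Implicit Types (f u : cfun R n) (z h L : V) (M : R).

(** The homogeneous component of degree [d], read off on the complex line through [z]. *)
Definition tcoef f d : cfun R n := fun z => cauchy_coef (fun t => f (t *: z)) d.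

Lemma ray_bound f z M : (forall w, vnorm w <= 2 * vnorm z -> normc (f w : C) <= M) ->
  forall t, normc t <= 2 -> normc (f (t *: z) : C) <= M.
Proof. by move=> hM t ht; apply: hM; rewrite vnormZ ler_wpM2r ?vnorm_ge0. Qed.

Lemma frechet_bounded f (r : R) : frechet f -> exists2 M : R, 0 <= M &
  forall z, vnorm z <= r -> normc (f z : C) <= M.
Proof.
move=> df; have [M hM] := vcont_bounded (frechet_cont df) r.
by exists `|M| => // z /hM /le_trans; apply; exact: ler_norm.
Qed.

Lemma tcoef_series f z M N : frechet f ->
  (forall w, vnorm w <= 2 * vnorm z -> normc (f w : C) <= M) ->
  normc ((f z : C) - \sum_(j < N) (tcoef f j z : C)) <= 4 * M / 2 ^+ N.
Proof.
move=> df hM; have := @cauchy_series _ _ M 1 N (gdiff_ray z df) (ray_bound hM).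
rewrite normc1 scale1r mul1r exprVn => /(_ (lexx _)).
by under eq_bigr do rewrite expr1n mulr1.
Qed.

Lemma tcoef_avg f z M N d : frechet f ->
  (forall w, vnorm w <= 2 * vnorm z -> normc (f w : C) <= M) -> (d <= N)%N ->
  normc (root_avg N d (fun t => f (t *: z)) - (tcoef f d z : C)) <= 4 * M / 2 ^+ N.+1.
Proof.
move=> df hM dN.
have := @root_avg_coef _ N d _ M 1 (gdiff_ray z df) (ray_bound hM) dN.
rewrite normc1 expr1n mulr1 => /(_ (lexx _)).
by rewrite (_ : (fun t => f ((1 * t) *: z)) = fun t => f (t *: z)) //;
  apply/funext => t; rewrite mul1r.
Qed.

Lemma frechet_root_avg N d (F : C -> cfun R n) : (forall t, frechet (F t)) ->
  frechet (fun z => root_avg N d (fun t => F t z)).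
Proof.
move=> dF; apply: frechetZ; apply: (@frechet_sum R n _ _ (fun (k : 'I_N.+1) z => _)) => k.
exact: frechetZ.
Qed.

(** A locally uniform limit of finite averages of dilates of [f]. The index [d + N] ensures that
    degree [d] is isolated. *)
Lemma frechet_tcoef f d : frechet f -> frechet (tcoef f d).
Proof.
move=> df; apply: (@weierstrass _ _ (fun N z => root_avg (d + N) d (fun t => f (t *: z)))).
  by move=> N; apply: frechet_root_avg => t; apply: frechet_scale.
move=> r e e0; have [M M0 hM] := frechet_bounded (2 * r) df.
have [N0 hN0] := half_power_le (4 * M) e0; exists N0 => N hN z hz.
apply: le_trans (hN0 (d + N).+1 _); last by rewrite ltnW // ltnS (leq_trans hN) // leq_addl.
apply: tcoef_avg => //; last by rewrite leq_addr.
by move=> w hw; apply: hM; rewrite (le_trans hw) // ler_wpM2l.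
Qed.

(** Nonzero [l] can be inverted in rescaling arguments; the value at 0 is recovered by
    continuity. *)
Definition homogeneous f d := forall (l : C) z, l != 0 -> f (l *: z) = l ^+ d * (f z : C).

(** For [|l| <= 1] both sides are limits of averages of the same function [t |-> f (t l z)], seen as
    the line through [l z] or as the line through [z] with a dilated parameter. Larger [l] are
    handled through [l^-1]. *)
Lemma tcoef_homogeneous f d : frechet f -> homogeneous (tcoef f d) d.
Proof.
move=> df.
have small (l : C) z : normc l <= 1 -> tcoef f d (l *: z) = l ^+ d * (tcoef f d z : C).
  move=> l1; apply/subr0_eq/normc_small0 => e e0; have e2 : 0 < e / 2 by rewrite divr_gt0.
  have [M M0 hM] := frechet_bounded (2 * vnorm z) df.
  have [N0 hN0] := half_power_le (4 * M) e2; pose N := maxn N0 d.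
  have hN : 4 * M / 2 ^+ N.+1 <= e / 2 by apply: hN0; rewrite ltnW // ltnS leq_maxl.
  have dN : (d <= N)%N by rewrite leq_maxr.
  have h1 := @root_avg_coef _ N d _ M l (gdiff_ray z df) (ray_bound hM) dN l1.
  have h2 : normc (root_avg N d (fun t => f (t *: (l *: z))) - (tcoef f d (l *: z) : C)) <= 4 * M / 2 ^+ N.+1.
    apply: tcoef_avg => // w; rewrite vnormZ => hw; apply: hM; rewrite (le_trans hw) //.
    by rewrite ler_wpM2l // -[leRHS]mul1r ler_wpM2r ?vnorm_ge0.
  have E : (fun t => f (t *: (l *: z))) = fun t => f ((l * t) *: z).
    by apply/funext => t; rewrite scalerA mulrC.
  rewrite E in h2; have h3 := le_trans (le_normcB _ _) (lerD h1 h2).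
  rewrite (splitr e); apply: le_trans (le_trans h3 (lerD hN hN)).
  by rewrite le_eqVlt; apply/orP; left; apply/eqP; congr normc; rewrite /tcoef; ring.
move=> l z l0; have [|l1] := leP (normc l) 1; first exact: small.
have h : normc l^-1 <= 1 by rewrite normcV invf_le1 ?normc_gt0 // ltW.
have := small l^-1 (l *: z) h; rewrite scalerA mulVf // scale1r => ->.
by rewrite mulrA -exprMn divff // expr1n mul1r.
Qed.

(** Written as a Cauchy integral, the derivative is total and a limit of root averages, which is how
    it is shown to be entire. *)
Definition pderiv i f : cfun R n := fun z => cauchy_coef (fun t => f (z + t *: delta_mx i 0)) 1.

Lemma pderiv_fder i f z L : frechet f -> fder f z L -> pderiv i f z = L i 0.
Proof.
move=> df hL; have [M M0 hM] := frechet_bounded (vnorm z + 2) df.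
rewrite /pderiv (@fder_coef _ _ _ z L M) ?dotp_delta ?vnorm_delta // => w hw.
apply: hM; rewrite -(subrK z w) addrC; apply: le_trans (vnormD _ _) _.
by rewrite lerD2l.
Qed.

Lemma frechet_pderiv i f : frechet f -> frechet (pderiv i f).
Proof.
move=> df; apply: (@weierstrass _ _ (fun N z => root_avg (1 + N) 1 (fun t => f (z + t *: delta_mx i 0)))).
  by move=> N; apply: frechet_root_avg => t; apply: frechet_translate.
move=> r e e0; have [M M0 hM] := frechet_bounded (r + 2) df.
have [N0 hN0] := half_power_le (4 * M) e0; exists N0 => N hN z hz.
apply: le_trans (hN0 (1 + N).+1 _); last by rewrite ltnW // ltnS (leq_trans hN) // leq_addl.
have hl : forall w, vnorm (w - z) <= 2 -> normc (f w : C) <= M.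
  move=> w hw; apply: hM; rewrite -(subrK z w) addrC; apply: le_trans (vnormD _ _) _.
  exact: lerD.
have hv : vnorm (delta_mx i 0 : V) <= 1 by rewrite vnorm_delta.
have := @root_avg_coef _ (1 + N) 1 _ M 1 (gdiff_line z (delta_mx i 0) df) (line_bound hl hv) isT.
rewrite normc1 expr1 mulr1 => /(_ (lexx _)).
by rewrite (_ : (fun t => f (z + (1 * t) *: _)) = fun t => f (z + t *: delta_mx i 0)) //;
  apply/funext => t; rewrite mul1r.
Qed.

Lemma pderiv_homogeneous i f d : frechet f -> homogeneous f d.+1 -> homogeneous (pderiv i f) d.
Proof.
move=> df hf l z l0; have [L hL] := df z.
have l'0 : 0 < normc l by rewrite normc_gt0.
have hL' : fder f (l *: z) (l ^+ d *: L).
  move=> e e0; have [d' d'0 hd] := hL (e / normc l ^+ d) (divr_gt0 e0 (exprn_gt0 _ l'0)).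
  exists (d' * normc l); first exact: mulr_gt0.
  move=> h hh; have := hd (l^-1 *: h); rewrite vnormZ normcV mulrC ltr_pdivrMr // => /(_ hh) k.
  have -> : l *: z + h = l *: (z + l^-1 *: h) by rewrite scalerDr scalerA divff // scale1r.
  rewrite !hf //.
  have -> : dotp (l ^+ d *: L) h = l ^+ d.+1 * dotp L (l^-1 *: h).
    rewrite dotpZ mulrA exprSr mulfK // /dotp mulr_sumr; apply: eq_bigr => j _.
    by rewrite mxE mulrA.
  rewrite -!mulrBr normcM normcX.
  apply: le_trans (_ : normc l ^+ d.+1 * (e / normc l ^+ d * (vnorm h / normc l)) <= _).
    by rewrite ler_wpM2l ?exprn_ge0 ?normc_ge0.
  rewrite le_eqVlt; apply/orP; left; apply/eqP; rewrite exprS; field.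
  by rewrite gt_eqF //= expf_neq0 // gt_eqF.
by rewrite (pderiv_fder i df hL') (pderiv_fder i df hL) mxE.
Qed.

Lemma onePX_bound (t : C) m : normc t <= 1 -> normc ((1 + t) ^+ m - 1) <= normc t * (2 ^+ m - 1).
Proof.
move=> t1; have t2 : normc (1 + t) <= 2.
  by apply: le_trans (le_normcD _ _) _; rewrite normc1; clear -t1; lra.
elim: m => [|m IH]; first by rewrite expr0 subrr normc0 subrr mulr0.
have -> : (1 + t) ^+ m.+1 - 1 = (1 + t) * ((1 + t) ^+ m - 1) + t by rewrite exprS; ring.
have -> : normc t * (2 ^+ m.+1 - 1) = 2 * (normc t * (2 ^+ m - 1)) + normc t by rewrite exprS; ring.
apply: le_trans (le_normcD _ _) _; rewrite normcM lerD2r.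
by apply: ler_pM; rewrite ?normc_ge0.
Qed.

(** The derivative of [(1 + t)^m] at 0 with an explicit error, for use in [euler]; it rests on
    [(1 + t)^m - 1] being [t] times the sum of the [(1 + t)^j] for [j < m]. *)
Lemma onePX_quad (t : C) m : normc t <= 1 ->
  normc ((1 + t) ^+ m - 1 - m%:R * t) <= normc t ^+ 2 * (m%:R * 2 ^+ m).
Proof.
move=> t1; have -> : (1 + t) ^+ m - 1 - m%:R * t = t * (\sum_(j < m) ((1 + t) ^+ j - 1)).
  rewrite sumrB sumr_const card_ord subrX1 (_ : 1 + t - 1 = t); last by ring.
  by rewrite mulrBr [m%:R * t]mulrC.
rewrite normcM expr2 -mulrA ler_wpM2l ?normc_ge0 //.
apply: le_trans (le_normc_sum _ _ _) _.
apply: (@le_trans _ _ (\sum_(j < m) normc t * 2 ^+ m)); last first.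
  by rewrite sumr_const card_ord -[leLHS]mulr_natl [leLHS]mulrCA lexx.
rewrite ler_sum // => j _.
apply: le_trans (onePX_bound _ t1) _; rewrite ler_wpM2l ?normc_ge0 //.
apply: (@le_trans _ _ (2 ^+ j)); first by rewrite gerBl.
have jm : (j <= m)%N by rewrite ltnW.
have h : 1 <= 2 :> R by rewrite ler1n.
by rewrite (ler_weXn2l h jm).
Qed.

(** Two first-order expansions of [f (z + t z) = (1 + t)^d f z] at a small real [t] are compared. *)
Lemma euler f d z L : homogeneous f d -> fder f z L -> dotp L z = d%:R * (f z : C).
Proof.
move=> hf hL; apply/subr0_eq/normc_small0 => e e0; have e2 : 0 < e / 2 by rewrite divr_gt0.
have [r r0 hr] := fder_line z hL e2.
pose K : R := d%:R * 2 ^+ d * normc (f z : C).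
have K0 : 0 <= K by rewrite !mulr_ge0 ?exprn_ge0 ?normc_ge0.
have k0 : 0 < 2 * (K + 1) by rewrite mulr_gt0 // ltr_wpDl.
pose t := Num.min (r / 2) (Num.min (2^-1) (e / (2 * (K + 1)))).
have t0 : 0 < t by rewrite !lt_min invr_gt0 ltr0n (divr_gt0 r0) // (divr_gt0 e0).
have tr : t < r by rewrite gt_min ltr_pdivrMr // ltr_pMr // ltr1n.
have t1 : t <= 1.
  apply: (@le_trans _ _ 2^-1); first by rewrite !ge_min lexx !orbT.
  by rewrite invf_le1 // ler1n.
have te : K * t <= e / 2.
  have : t <= e / (2 * (K + 1)) by rewrite !ge_min lexx !orbT.
  rewrite ler_pdivlMr // => h; rewrite ler_pdivlMr //; apply: le_trans h.
  by clear -t0 K0; nra.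
pose tc : C := t%:C%C; have nt : normc tc = t by rewrite normc_real ger0_norm // ltW.
have h1 := hr tc; rewrite nt in h1; have {}h1 := h1 tr.
have tn0 : 1 + tc != 0.
  apply/eqP => h; have : complex.Re (1 + tc) = 0 by rewrite h.
  by move=> /=; apply/eqP; rewrite gt_eqF // addr_gt0.
have E : f (z + tc *: z) = (1 + tc) ^+ d * (f z : C).
  by rewrite -hf // scalerDl scale1r.
rewrite E in h1.
have tc1 : normc tc <= 1 by rewrite nt.
have h2 := onePX_quad d tc1; rewrite nt in h2.
have h3 : normc ((dotp L z - d%:R * (f z : C)) * tc) <= e / 2 * t + t ^+ 2 * (d%:R * 2 ^+ d) * normc (f z : C).
  have -> : (dotp L z - d%:R * (f z : C)) * tc = ((1 + tc) ^+ d - 1 - d%:R * tc) * f z -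
     ((1 + tc) ^+ d * (f z : C) - f z - dotp L z * tc) by ring.
  apply: le_trans (le_normcB _ _) _; rewrite addrC; apply: lerD => //.
  by rewrite normcM ler_wpM2r ?normc_ge0.
rewrite normcM nt in h3; rewrite -(ler_pM2r t0); apply: le_trans h3 _.
have -> : t ^+ 2 * (d%:R * 2 ^+ d) * normc (f z : C) = (K * t) * t by rewrite /K; ring.
by rewrite -mulrDl ler_pM2r // [leRHS](splitr e) lerD2l.
Qed.

Definition mono (a : 'I_n -> nat) : cfun R n := fun z => \prod_i (z i 0) ^+ a i.

Definition monos d : set (cfun R n) :=
  [set u | exists a : 'I_n -> nat, (\sum_i a i)%N = d /\ u = mono a].

Lemma homogeneous_lspan d f : frechet f -> homogeneous f d -> lspan (monos d) f.
Proof.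
elim: d f => [|d IH] f df hf.
  have -> : f = (f 0 : C) *: (mono (fun=> 0%N)).
    apply/funext => z.
    have -> : ((f 0 : C) *: mono (fun=> 0%N)) z = f 0.
      rewrite fctE /mono big1 => [|i _]; last by rewrite expr0.
      exact: mulr1.
    (* In degree 0, [f z = f (t z)] for every nonzero [t], so continuity at 0 gives [f z = f 0]. *)
    apply/subr0_eq/normc_small0 => e e0; have [r r0 hr] := frechet_cont df 0 e0.
    have k0 : 0 < 1 + vnorm z by rewrite ltr_pwDl ?vnorm_ge0.
    pose t : C := (r / (2 * (1 + vnorm z)))%:C%C.
    have t0 : 0 < r / (2 * (1 + vnorm z)) by rewrite divr_gt0 // mulr_gt0.
    have -> : (f z : C) = f (t *: z).
      by rewrite hf ?expr0 ?mul1r // -normc_eq0 normc_real normr_eq0 gt_eqF.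
    apply: ltW; apply: hr; rewrite subr0 vnormZ normc_real ger0_norm ?(ltW t0) //.
    rewrite mulrAC ltr_pdivrMr ?mulr_gt0 // ltr_pM2l //.
    by have := vnorm_ge0 z; clear => h; lra.
  by apply/lspanZ/lspan_gen; exists (fun=> 0%N); split => //; rewrite big1.
have E : f = (d.+1%:R^-1 : C) *: (\sum_i (fun z : V => (z i 0 : C) * (pderiv i f z : C) : R[i]^o)).
  apply/funext => z; rewrite /GRing.scale /= fct_sumE.
  have [L hL] := df z.
  have -> : \sum_i (z i 0 : C) * (pderiv i f z : C) = dotp L z.
    by apply: eq_bigr => i _; rewrite (pderiv_fder i df hL) mulrC.
  rewrite (euler hf hL); apply/esym.
  have d0 : d.+1%:R != 0 :> C by rewrite pnatr_eq0.
  exact: (mulKf d0 (f z : C)).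
rewrite E; apply/lspanZ/lspan_sum => i _.
have := IH _ (frechet_pderiv i df) (pderiv_homogeneous i df hf).
move=> [N [c [w [hw ->]]]].
rewrite (_ : (fun z => _) = \sum_l c l *: (fun z : V => (z i 0 : C) * (w l z : C) : R[i]^o)); last first.
  apply/funext => z; rewrite !fct_sumE mulr_sumr; apply: eq_bigr => l _.
  exact: (mulrCA (z i 0 : C) (c l) (w l z : C)).
apply: lspan_sum => l _; apply/lspanZ/lspan_gen.
have [a [ha ->]] := hw l; exists (fun j => (a j + (j == i))%N); split.
  by rewrite big_split /= ha -(big_mkcond (fun j => j == i)) big_pred1_eq addn1.
apply/funext => z; rewrite /mono [RHS](bigD1 i) //= [in LHS](bigD1 i) //= eqxx addn1 exprS mulrA.
by congr (_ * _); apply: eq_bigr => j /negbTE ->; rewrite addn0.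
Qed.

End Taylor.

(** * Linear changes of variables in the Lebesgue measure *)

Section TupleIntegral.
Variable R : realType.
Local Notation RM := (measurableTypeR R).
Local Notation leb := (@lebesgue_measure R).

(** The image of Lebesgue measure under [phi], multiplied by [a], agrees with Lebesgue measure on
    half-open intervals, hence everywhere. *)
Lemma integral_affine (a b : R) (F : RM -> \bar R) : 0 < a -> measurable_fun setT F ->
  (forall x, (0 <= F x)%E) ->
  (\int[leb]_x F (a * x + b)%R = (a^-1)%:E * \int[leb]_x F x)%E.
Proof.
move=> a0 mF F0.
have mphi : measurable_fun setT (fun x : RM => (a * x + b)%R : RM).
  apply: measurable_funD; last exact: measurable_cst.
  by apply: measurable_funM => //; exact: measurable_cst.
pose phi : {mfun RM >-> RM} := HB.pack (fun x : RM => (a * x + b)%R : RM)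
  (isMeasurableFun.Build _ _ _ _ _ mphi).
pose an : {nonneg R} := NngNum (ltW a0).
have E A : measurable A -> leb A = mscale an (pushforward leb phi) A.
  apply: (@lebesgue_measure_unique _ (mscale an (pushforward leb phi))) => _ [[c d]] _ <-.
  have E1 : phi @^-1` `]c, d]%classic = `](c - b) / a, (d - b) / a]%classic.
    by apply/seteqP; split=> x /=; rewrite !in_itv /= ltr_pdivrMr // ler_pdivlMr // ltrBlDr lerBrDr mulrC.
  rewrite -[RHS]/(a%:E * leb (phi @^-1` `]c, d]%classic))%E E1.
  rewrite !lebesgue_measure_itv /= !lte_fin ltr_pM2r ?invr_gt0 // ltrD2r.
  case: ifPn => _; last by rewrite mule0.
  by rewrite -!EFinD -EFinM -mulrBl mulrCA divff ?gt_eqF // mulr1; congr EFin; ring.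
have -> : (\int[leb]_x F x = \int[mscale an (pushforward leb phi)]_x F x)%E => //.
  by move=> mp; apply: eq_measure_integral => A mA _; exact: E.
rewrite ge0_integral_mscale //= ge0_integral_pushforward //.
rewrite preimage_setT muleA -EFinM mulVf ?gt_eqF // mul1e.
by [].
Qed.

Definition upd N (i : 'I_N) (v : R) (t : N.-tuple RM) : N.-tuple RM :=
  [tuple if j == i then v else tnth t j | j < N].

Lemma tnth_upd N (i j : 'I_N) v t : tnth (upd i v t) j = if j == i then v else tnth t j.
Proof. by rewrite tnth_mktuple. Qed.

Lemma measurable_upd d (T : measurableType d) N (i : 'I_N) (g : T -> RM) (f : T -> N.-tuple RM) :
  measurable_fun setT g -> measurable_fun setT f ->
  measurable_fun setT (fun x => upd i (g x) (f x)).
Proof.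
move=> mg mf; apply/measurable_fun_tnthP => j.
have [ji|ji] := eqVneq j i.
  rewrite (_ : _ \o _ = g) //; apply/funext => x /=; by rewrite tnth_upd ji eqxx.
rewrite (_ : _ \o _ = (fun t : N.-tuple RM => tnth t j) \o f).
  by apply: measurableT_comp => //; exact: measurable_tnth.
by apply/funext => x /=; rewrite tnth_upd (negbTE ji).
Qed.

Let consT N (x : RM) (t : N.-tuple RM) : N.+1.-tuple RM := [tuple of x :: t].

Let measurable_consT N : measurable_fun setT (fun p : RM * N.-tuple RM => consT p.1 p.2).
Proof. exact: (measurable_cons measurable_fst measurable_snd). Qed.

Lemma integral_cons N (F : N.+1.-tuple RM -> \bar R) : measurable_fun setT F ->
  (forall t, (0 <= F t)%E) ->
  (\int[lebesgue_tuple R N.+1]_t F t =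
   \int[leb]_x \int[lebesgue_tuple R N]_t F [tuple of x :: t])%E.
Proof.
move=> mF F0; rewrite /lebesgue_tuple /=.
rewrite ge0_integral_pushforward //=; last exact: measurable_consT.
by rewrite preimage_setT fubini_tonelli1 //=; apply: measurableT_comp mF _; exact: measurable_consT.
Qed.

Lemma integral_cons_swap N (F : N.+1.-tuple RM -> \bar R) : measurable_fun setT F ->
  (forall t, (0 <= F t)%E) ->
  (\int[lebesgue_tuple R N.+1]_t F t =
   \int[lebesgue_tuple R N]_t \int[leb]_x F [tuple of x :: t])%E.
Proof.
move=> mF F0; rewrite integral_cons //.
rewrite (@fubini_tonelli _ _ _ _ _ _ (lebesgue_tuple R N) (fun p => F (consT p.1 p.2))) //.
by apply: measurableT_comp mF _; exact: measurable_consT.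
Qed.

Lemma upd_cons0 N v x (t : N.-tuple RM) : upd ord0 v (consT x t) = consT v t.
Proof.
apply: eq_from_tnth => j; rewrite tnth_upd.
case: (unliftP ord0 j) => [k ->|->]; last by rewrite eqxx tnth0.
by rewrite eq_sym (negbTE (neq_lift _ _)) !tnthS.
Qed.

Lemma upd_consS N (i : 'I_N) v x (t : N.-tuple RM) :
  upd (lift ord0 i) v (consT x t) = consT x (upd i v t).
Proof.
apply: eq_from_tnth => j; rewrite tnth_upd.
case: (unliftP ord0 j) => [k ->|->]; last by rewrite (negbTE (neq_lift _ _)) !tnth0.
by rewrite (inj_eq lift_inj) !tnthS tnth_upd.
Qed.

Let measurable_cons_r N x : measurable_fun [set: N.-tuple RM] (@consT N x).
Proof. exact: (measurable_cons (measurable_cst x) (@measurable_id _ _ setT)). Qed.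

Let measurable_cons_l N (t : N.-tuple RM) : measurable_fun [set: RM] (fun x : RM => consT x t).
Proof. exact: (measurable_cons (@measurable_id _ _ setT) (measurable_cst t)). Qed.

Let measurable_inner N (F : N.+1.-tuple RM -> \bar R) : measurable_fun setT F ->
  (forall t, (0 <= F t)%E) ->
  measurable_fun setT (fun t : N.-tuple RM => \int[leb]_x F (consT x t))%E.
Proof.
move=> mF F0.
apply: (@measurable_fun_fubini_tonelli_G _ _ _ _ _ leb (fun p => F (consT p.1 p.2))) => //.
by apply: measurableT_comp mF _; exact: measurable_consT.
Qed.

Let measurable_outer N (F : N.+1.-tuple RM -> \bar R) : measurable_fun setT F ->
  (forall t, (0 <= F t)%E) ->
  measurable_fun setT (fun x : RM => \int[lebesgue_tuple R N]_t F (consT x t))%E.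
Proof.
move=> mF F0.
apply: (@measurable_fun_fubini_tonelli_F _ _ _ _ _ (lebesgue_tuple R N) (fun p => F (consT p.1 p.2))) => //.
by apply: measurableT_comp mF _; exact: measurable_consT.
Qed.

(** Tonelli isolates coordinate [i]. As [phi] does not depend on it, the map is affine in that
    variable for fixed values of the others. The induction follows the construction of the product
    measure. *)
Lemma integral_upd N (i : 'I_N) (a : R) (phi : N.-tuple RM -> RM) (F : N.-tuple RM -> \bar R) :
  0 < a -> measurable_fun setT phi -> (forall v t, phi (upd i v t) = phi t) ->
  measurable_fun setT F -> (forall t, (0 <= F t)%E) ->
  (\int[lebesgue_tuple R N]_t F (upd i (a * tnth t i + phi t)%R t) =
   (a^-1)%:E * \int[lebesgue_tuple R N]_t F t)%E.
Proof.
move=> a0; elim: N i phi F => [[]//|N IH] i phi F mphi phiE mF F0.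
have ai0 : (0 <= (a^-1)%:E :> \bar R)%E by rewrite lee_fin invr_ge0 ltW.
have mupd : measurable_fun setT (fun t => F (upd i (a * tnth t i + phi t)%R t)).
  apply: measurableT_comp mF _; apply: measurable_upd => //.
  apply: measurable_funD => //; apply: measurable_funM; first exact: measurable_cst.
  exact: measurable_tnth.
case: (unliftP ord0 i) => [i' Ei|Ei]; last first.
  rewrite !integral_cons_swap // -ge0_integralZl //; last 2 first.
  - exact: measurable_inner.
  - by move=> t _; apply: integral_ge0.
  apply: eq_integral => t _; rewrite -(@integral_affine a (phi (consT 0 t))) //.
    apply: eq_integral => x _; rewrite -/(consT x t) Ei upd_cons0 tnth0; congr (F (consT _ _)).
    by congr (_ + _); rewrite -(upd_cons0 x 0 t) -Ei phiE.
  by apply: measurableT_comp mF _; exact: measurable_cons_l.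
rewrite !integral_cons // -ge0_integralZl //; last 2 first.
- exact: measurable_outer.
- by move=> t _; apply: integral_ge0.
apply: eq_integral => x _.
rewrite -(IH i' (fun t => phi (consT x t))) //.
- by apply: eq_integral => t _; rewrite -/(consT x t) Ei upd_consS tnthS.
- by apply: measurableT_comp mphi _; exact: measurable_cons_r.
- by move=> v t; rewrite -upd_consS -Ei phiE.
- by apply: measurableT_comp mF _; exact: measurable_cons_r.
Qed.

End TupleIntegral.

Section LinearInvariance.
Variable R : realType.
Local Notation C := R[i].
Local Notation RM := (measurableTypeR R).
Local Notation leb := (@lebesgue_measure R).

Section Tuples.
Variable N : nat.
Local Notation T := (N.-tuple RM).
Implicit Types (F : T -> \bar R) (p q : 'I_N) (t : T).

(* The factor 1 matches the affine maps of [integral_upd]. *)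
Definition shear p q (a : R) t : T := upd p (1 * tnth t p + a * tnth t q) t.

Lemma measurable_shear p q a : measurable_fun setT (shear p q a).
Proof.
apply: measurable_upd; last exact: measurable_id.
apply: measurable_funD; apply: measurable_funM; try exact: measurable_cst;
  exact: measurable_tnth.
Qed.

Lemma integral_shear p q a F : p != q -> measurable_fun setT F -> (forall t, (0 <= F t)%E) ->
  (\int[lebesgue_tuple R N]_t F (shear p q a t) = \int[lebesgue_tuple R N]_t F t)%E.
Proof.
move=> pq mF F0.
rewrite (@integral_upd R N p 1 (fun t => a * tnth t q)) ?invr1 ?mul1e //.
  by apply: measurable_funM; [exact: measurable_cst | exact: measurable_tnth].
by move=> v t; rewrite tnth_upd eq_sym (negbTE pq).
Qed.

Definition rot2 p q (c s : R) t : T :=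
  [tuple if j == p then c * tnth t p - s * tnth t q else
         if j == q then s * tnth t p + c * tnth t q else tnth t j | j < N].

Lemma measurable_rot2 p q c s : measurable_fun setT (rot2 p q c s).
Proof.
apply/measurable_fun_tnthP => j.
rewrite (_ : _ \o _ = fun t => if j == p then c * tnth t p - s * tnth t q else
         if j == q then s * tnth t p + c * tnth t q else tnth t j); last first.
  by apply/funext => t /=; rewrite tnth_mktuple.
case: (j == p).
  by apply: measurable_funB; apply: measurable_funM; try exact: measurable_cst;
    exact: measurable_tnth.
case: (j == q); last exact: measurable_tnth.
by apply: measurable_funD; apply: measurable_funM; try exact: measurable_cst;
  exact: measurable_tnth.
Qed.

(* A rotation is a product of three shears, except the half-turn, the square of a quarter-turn. *)
Lemma integral_rot2 p q c s F : p != q -> c ^+ 2 + s ^+ 2 = 1 ->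
  measurable_fun setT F -> (forall t, (0 <= F t)%E) ->
  (\int[lebesgue_tuple R N]_t F (rot2 p q c s t) = \int[lebesgue_tuple R N]_t F t)%E.
Proof.
move=> pq cs1 mF F0; have qp : q != p by rewrite eq_sym.
have gen c' s' F' : c' ^+ 2 + s' ^+ 2 = 1 -> 1 + c' != 0 ->
    measurable_fun setT F' -> (forall t, (0 <= F' t)%E) ->
    (\int[lebesgue_tuple R N]_t F' (rot2 p q c' s' t) = \int[lebesgue_tuple R N]_t F' t)%E.
  move=> h1 h2 mF' F'0; pose u := s' / (1 + c').
  have uc : u * (1 + c') = s' by rewrite /u divfK.
  have us : u * s' = 1 - c'.
    by apply: (mulIf h2); rewrite mulrAC uc -expr2; rewrite -(subr_sqr 1) expr1n -h1; ring.
  have E t : rot2 p q c' s' t = shear p q (- u) (shear q p s' (shear p q (- u) t)).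
    apply: eq_from_tnth => j; rewrite tnth_mktuple !tnth_upd !eqxx (negbTE pq) (negbTE qp).
    have [_|jp] := eqVneq j p.
      rewrite mul1r; set x := tnth t p; set y := tnth t q.
      transitivity ((1 - u * s') * x - (2 * u - u * (u * s')) * y); last by ring.
      by rewrite us -uc; congr (_ * _ - _ * _); ring.
    have [_|jq] := eqVneq j q; last by [].
    set x := tnth t p; set y := tnth t q.
    by transitivity (s' * x + (1 - u * s') * y); [rewrite us; congr (_ + _ * _); ring | ring].
  rewrite (eq_integral (fun t => F' (shear p q (- u) (shear q p s' (shear p q (- u) t))))); last first.
    by move=> t _; rewrite E.
  have m1 := measurable_shear p q (- u); have m2 := measurable_shear q p s'.
  have mF1 : measurable_fun setT (fun t => F' (shear p q (- u) t)) by apply: measurableT_comp mF' m1.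
  have mF2 : measurable_fun setT (fun t => F' (shear p q (- u) (shear q p s' t))).
    exact: measurableT_comp mF1 m2.
  rewrite (@integral_shear p q (- u) (fun t => F' (shear p q (- u) (shear q p s' t)))) //.
  rewrite (@integral_shear q p s' (fun t => F' (shear p q (- u) t))) //.
  exact: integral_shear.
have [h|h] := eqVneq (1 + c) 0; last exact: gen.
have cE : c = -1 by apply/eqP; rewrite -addr_eq0 addrC h.
have s0 : s = 0.
  apply/eqP; rewrite -sqrf_eq0; apply/eqP; apply: (addrI (c ^+ 2)).
  by rewrite cs1 addr0 cE sqrrN expr1n.
have E t : rot2 p q c s t = rot2 p q 0 1 (rot2 p q 0 1 t).
  rewrite cE s0; apply: eq_from_tnth => j; rewrite !tnth_mktuple !eqxx (negbTE qp).
  by case: eqP => // _; [ring | case: eqP => // _; ring].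
have h01 : 0 ^+ 2 + 1 ^+ 2 = 1 :> R by rewrite expr0n expr1n /= add0r.
have h1 : 1 + 0 != 0 :> R by rewrite addr0 oner_eq0.
rewrite (eq_integral (fun t => F (rot2 p q 0 1 (rot2 p q 0 1 t)))); last by move=> t _; rewrite E.
rewrite (gen 0 1 (fun t => F (rot2 p q 0 1 t))) //; first exact: gen.
by apply: measurableT_comp mF _; exact: measurable_rot2.
Qed.

Definition scalet (a : R) t : T := [tuple a * tnth t j | j < N].

Lemma integral_scale a F : 0 < a -> measurable_fun setT F -> (forall t, (0 <= F t)%E) ->
  (\int[lebesgue_tuple R N]_t F (scalet a t) =
   (a ^- N)%:E * \int[lebesgue_tuple R N]_t F t)%E.
Proof.
move=> a0 mF F0.
pose sc k t : T := [tuple if (j < k)%N then a * tnth t j else tnth t j | j < N].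
have msc k : measurable_fun setT (sc k).
  apply/measurable_fun_tnthP => j.
  rewrite (_ : _ \o _ = fun t => if (j < k)%N then a * tnth t j else tnth t j); last first.
    by apply/funext => t /=; rewrite tnth_mktuple.
  case: (j < k)%N; last exact: measurable_tnth.
  by apply: measurable_funM; [exact: measurable_cst | exact: measurable_tnth].
have E k : (k <= N)%N -> (\int[lebesgue_tuple R N]_t F (sc k t) =
   (a ^- k)%:E * \int[lebesgue_tuple R N]_t F t)%E.
  elim: k => [_|k IH kN].
    rewrite expr0 invr1 mul1e; apply: eq_integral => t _; congr F.
    by apply: eq_from_tnth => j; rewrite tnth_mktuple.
  have mF' : measurable_fun setT (fun t => F (sc k t)) by apply: measurableT_comp mF _.
  have := @integral_upd R N (Ordinal kN) a (fun=> 0) (fun t => F (sc k t)) a0 (measurable_cst _) (fun _ _ => erefl) mF' (fun t => F0 _).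
  rewrite IH; last exact: ltnW.
  rewrite muleA -EFinM exprS invfM => <-; apply: eq_integral => t _; congr F.
  apply: eq_from_tnth => j; rewrite !tnth_mktuple -(inj_eq val_inj) /= addr0 ltnS.
  have [jk|jk] := eqVneq (j : nat) k.
    by rewrite jk leqnn ltnn; congr (_ * tnth _ _); apply: val_inj.
  by rewrite leq_eqVlt (negbTE jk).
rewrite -E //; apply: eq_integral => t _; congr F.
by apply: eq_from_tnth => j; rewrite !tnth_mktuple ltn_ord.
Qed.

End Tuples.

(** Boxes serve as sets of finite measure containing a ball and as sets of positive measure around a
    point. *)
Definition box N (c : 'I_N -> R) (d : R) : set (N.-tuple RM) :=
  [set t | forall j, `|tnth t j - c j| <= d].

Lemma box_measurable N (c : 'I_N -> R) (d : R) : measurable (box c d).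
Proof.
rewrite (_ : box c d = \bigcap_(j in setT) ((fun t : N.-tuple RM => tnth t j) @^-1` `[c j - d, c j + d])).
  apply: fin_bigcap_measurable => // j _; rewrite -[X in measurable X]setTI.
  apply: measurable_tnth => //.
apply/seteqP; split => t h j; have := h j.
  by rewrite /= in_itv /= ler_distl.
by move=> /(_ I); rewrite /= in_itv /= ler_distl.
Qed.

Lemma box_measure N (c : 'I_N -> R) (d : R) : 0 <= d ->
  lebesgue_tuple R N (box c d) = ((2 * d) ^+ N)%:E.
Proof.
move=> d0; elim: N c => [|N IH] c.
  rewrite /lebesgue_tuple /= diracE expr0 mem_set //.
  by case.
rewrite /lebesgue_tuple /= /product_cons /pushforward.
rewrite (_ : _ @^-1` _ = `[c ord0 - d, c ord0 + d]%classic `*` box (fun j => c (lift ord0 j)) d); last first.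
  apply/seteqP; split => [[x t]|[x t]] /=.
    move=> h; split; first by have := h ord0; rewrite /= tnth0 in_itv /= ler_distl.
    by move=> j; have := h (lift ord0 j); rewrite tnthS.
  rewrite in_itv /= -ler_distl => -[h1 h2] j.
  by case: (unliftP ord0 j) => [j' ->|->]; rewrite ?tnthS ?tnth0.
rewrite product_measure1E //; last exact: box_measurable.
have L : lebesgue_measure (`[c ord0 - d, c ord0 + d]%classic : set R) = (2 * d)%:E.
  rewrite lebesgue_measure_itv /= lte_fin; case: ifPn => [_|].
    by rewrite -EFinD; congr EFin; ring.
  rewrite -leNgt => h; have -> : d = 0 by apply/eqP; rewrite eq_le d0 andbT; lra.
  by rewrite mulr0.
rewrite exprS EFinM; congr (_ * _)%E; first exact: L.
exact: (IH (fun j => c (lift ord0 j))).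
Qed.

End LinearInvariance.

Section ComplexCoordinates.
Variables (R : realType) (n : nat).
Local Notation C := R[i].
Local Notation V := 'cV[C]_n.
Local Notation RM := (measurableTypeR R).
Local Notation T := ((n + n).-tuple RM).
Local Notation mu := (lebesgue_tuple R (n + n)).

Definition dil (m : 'I_n -> C) (z : V) : V := \col_i (m i * z i 0).

Lemma dil_comp (m m' : 'I_n -> C) z : dil m (dil m' z) = dil (fun i => m i * m' i) z.
Proof. by apply/matrixP => i j; rewrite !mxE mulrA. Qed.

Lemma dil_cst c z : dil (fun=> c) z = c *: z.
Proof. by apply/matrixP => i j; rewrite !mxE (ord1 j). Qed.

Lemma eucl_norm_dil (m : 'I_n -> C) z : (forall i, normc (m i) = 1) ->
  eucl_norm (dil m z) = eucl_norm z.
Proof.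
move=> hm; congr Num.sqrt; apply: eq_bigr => i _.
by rewrite mxE sqnormM sqnormE hm expr1n mul1r.
Qed.

Lemma cvec_rot2 i (l : C) (x : T) :
  cvec (rot2 (lshift n i) (rshift n i) (complex.Re l) (complex.Im l) x) =
  dil (fun j => if j == i then l else 1) (cvec x).
Proof.
apply/matrixP => j k; rewrite !mxE !tnth_mktuple.
rewrite (eq_sym (rshift n j) (lshift n i)) !eq_shift.
have [->|_] := eqVneq j i; last by rewrite mul1r.
by apply: complex_eqP; rewrite ?cReM ?cImM //= addrC.
Qed.

(** One coordinate at a time: multiplying [z_i] by a unimodular number rotates the plane of its real
    and imaginary parts. *)
Lemma integral_dil (m : 'I_n -> C) (G : V -> \bar R) : (forall i, normc (m i) = 1) ->
  measurable_fun setT (fun x : T => G (cvec x)) -> (forall z, (0 <= G z)%E) ->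
  measurable_fun setT (fun x : T => G (dil m (cvec x))) /\
  (\int[mu]_x G (dil m (cvec x)) = \int[mu]_x G (cvec x))%E.
Proof.
move=> hm mG G0.
pose mk k (i : 'I_n) := if (i < k)%N then m i else 1.
suff H k : (k <= n)%N -> measurable_fun setT (fun x : T => G (dil (mk k) (cvec x))) /\
    (\int[mu]_x G (dil (mk k) (cvec x)) = \int[mu]_x G (cvec x))%E.
  have := H n (leqnn n); rewrite (_ : mk n = m) //.
  by apply/funext => i; rewrite /mk ltn_ord.
elim: k => [_|k IH kn].
  have E z : dil (mk 0%N) z = z by apply/matrixP => i j; rewrite mxE mul1r (ord1 j).
  rewrite (_ : (fun x : T => G (dil (mk 0%N) (cvec x))) = fun x => G (cvec x)) //.
  by apply/funext => x; rewrite E.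
have [mk1 <-] := IH (ltnW kn); pose i := Ordinal kn.
have E x : dil (mk k.+1) (cvec x) = dil (mk k) (cvec (rot2 (lshift n i) (rshift n i) (complex.Re (m i)) (complex.Im (m i)) x)).
  rewrite cvec_rot2 dil_comp; apply/matrixP => j u; rewrite !mxE; congr (_ * _).
  rewrite /mk ltnS -(inj_eq val_inj) /=.
  have [jk|jk] := eqVneq (j : nat) k; last by rewrite mulr1 leq_eqVlt (negbTE jk).
  by rewrite jk leqnn ltnn mul1r; congr m; apply: val_inj.
have -> : (fun x : T => G (dil (mk k.+1) (cvec x))) = (fun x => G (dil (mk k) (cvec x))) \o
   rot2 (lshift n i) (rshift n i) (complex.Re (m i)) (complex.Im (m i)).
  by apply/funext => x /=; rewrite E.
split; first by apply: measurableT_comp mk1 _; exact: measurable_rot2.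
apply: (@integral_rot2 R (n + n) _ _ _ _ (fun x => G (dil (mk k) (cvec x)))) => //.
  by rewrite eq_shift.
by have := hm i; move/(congr1 (fun x => x ^+ 2)); rewrite -sqnormE expr1n.
Qed.

Lemma eucl_norm_ge0 (z : V) : 0 <= eucl_norm z.
Proof. exact: sqrtr_ge0. Qed.

Lemma eucl_norm_scalet a (x : T) : 0 < a -> eucl_norm (cvec (scalet a x)) = a * eucl_norm (cvec x).
Proof.
move=> a0; rewrite -[in RHS](ger0_norm (ltW a0)) -sqrtr_sqr -sqrtrM ?sqr_ge0 //.
congr Num.sqrt; rewrite mulr_sumr; apply: eq_bigr => i _.
by rewrite !mxE /sqnorm /= !tnth_mktuple; ring.
Qed.

Lemma sqnorm_le_eucl (z : V) i : sqnorm (z i 0) <= eucl_norm z ^+ 2.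
Proof.
rewrite sqr_sqrtr; last by apply: sumr_ge0 => j _; apply: sqnorm_ge0.
by rewrite (bigD1 i) //= lerDl sumr_ge0 // => j _; apply: sqnorm_ge0.
Qed.

Lemma normc_le_eucl (z : V) i : normc (z i 0) <= eucl_norm z.
Proof.
rewrite -(@ler_pXn2r _ 2) ?nnegrE ?normc_ge0 ?eucl_norm_ge0 //.
by rewrite -sqnormE sqnorm_le_eucl.
Qed.

Lemma tnth_le_eucl (x : T) j : `|tnth x j| <= eucl_norm (cvec x).
Proof.
case: (splitP j) => i ij.
  have -> : j = lshift n i by apply/val_inj.
  apply: le_trans (normc_le_eucl _ i); rewrite mxE.
  exact: (Re_le_normc (tnth x (lshift n i) +i* tnth x (rshift n i))%C).
have -> : j = rshift n i by apply/val_inj.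
apply: le_trans (normc_le_eucl _ i); rewrite mxE.
exact: (Im_le_normc (tnth x (lshift n i) +i* tnth x (rshift n i))%C).
Qed.

Lemma measurable_eucl : measurable_fun setT (fun x : T => eucl_norm (cvec x)).
Proof.
have ms : measurable_fun [set: R] (@Num.sqrt R : R -> R).
  by apply: continuous_measurable_fun; exact: sqrt_continuous.
apply: (measurableT_comp ms).
rewrite (_ : (fun _ => _) = fun x : T => \sum_(i < n) (tnth x (lshift n i) ^+ 2 + tnth x (rshift n i) ^+ 2)); last first.
  by apply/funext => x; apply: eq_bigr => i _; rewrite mxE.
apply: measurable_sum => i; apply: measurable_funD; apply: measurable_funX; exact: measurable_tnth.
Qed.

End ComplexCoordinates.

(** * Integrals of radial functions *)

Section RadialIntegral.
Variables (R : realType) (n : nat).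
Local Notation C := R[i].
Local Notation RM := (measurableTypeR R).
Local Notation T := ((n + n).-tuple RM).
Local Notation mu := (lebesgue_tuple R (n + n)).
Local Notation leb := (@lebesgue_measure R).
Local Notation nrm := (fun x : T => eucl_norm (cvec x)).

Lemma measurable_indic_comp d (X : measurableType d) (A : set R) (f : X -> R) :
  measurable A -> measurable_fun setT f -> measurable_fun setT (fun x => \1_A (f x) : R).
Proof.
move=> mA mf; have mi : measurable_fun [set: R] (\1_A : R -> R) by exact: measurable_indic.
exact: (measurableT_comp mi mf).
Qed.

Lemma indic_ge0 U (A : set U) x : 0 <= (\1_A x : R).
Proof. by rewrite indicE; case: (_ \in _). Qed.

(* In place of polar coordinates: integrate g (r |x|) r^(N-1) over r > 0 and
   1 <= |x| <= 2, where N = 2n. Scaling r bounds this by the radial integral. Scaling x by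
   1/r turns it into the integral of g(|x|) dr/r over |x|/2 <= r <= |x|, an interval
   whose mass for dr/r is at least 1/2. Only |x| >= 1 is treated this way: on the unit ball g <= M. *)
Lemma radial_lty (g : R -> R) (M : R) : measurable_fun [set: R] g -> (forall r, 0 <= g r) ->
  (forall r, 0 <= r <= 1 -> g r <= M) ->
  (\int[leb]_(r in `[0%R, +oo[) (g r * r ^+ (n + n).-1)%:E < +oo)%E -> (0 < n)%N ->
  (\int[mu]_x (g (eucl_norm (cvec x)))%:E < +oo)%E.
Proof.
move=> mg g0 gM K_lty n0.
set K := (\int[leb]_(r in _) _)%E in K_lty.
set N := (n + n)%N in K K_lty *.
have N0 : (0 < N)%N by rewrite addn_gt0 n0.
have M0 : 0 <= M by apply: le_trans (g0 0) (gM 0 _); rewrite lexx ler01.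
have mN : measurable_fun setT nrm := measurable_eucl (n := n).
have m1 : measurable_fun setT (fun p : RM * T => p.1 : R) by exact: measurable_fst.
have m2 : measurable_fun setT (fun p : RM * T => nrm p.2).
  by apply: (measurableT_comp mN); exact: measurable_snd.
have K0 : (0 <= K)%E.
  apply: integral_ge0 => r; rewrite /= in_itv /= andbT => r0.
  by rewrite lee_fin mulr_ge0 // exprn_ge0.
(* [Phi] is the integrand in the variables [(r, x)], and [Psi] what it becomes when [x] is replaced
   by [x / r]: the factor [r^(N-1) r^(-N)] is the power [-1] of [r]. *)
pose Phi (p : RM * T) : R := \1_`]0, +oo[%classic p.1 * \1_`[1, 2]%classic (nrm p.2) *
  (g (p.1 * nrm p.2) * p.1 ^+ N.-1).
pose Psi (p : RM * T) : R := \1_`]0, +oo[%classic p.1 * (p.1 `^ (-1) *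
  (\1_`[1, 2]%classic (nrm p.2 * p.1 `^ (-1)) * g (nrm p.2))).
have Phi0 p : 0 <= Phi p.
  have [h|h] := leP p.1 0.
    rewrite /Phi (_ : \1_`]0, +oo[%classic p.1 = 0) ?mul0r //.
    by rewrite indicE memNset //= in_itv /= andbT; apply/negP; rewrite -leNgt.
  by rewrite /Phi !mulr_ge0 ?indic_ge0 ?exprn_ge0 // ltW.
have Psi0 p : 0 <= Psi p by rewrite /Psi !mulr_ge0 ?indic_ge0 ?powR_ge0.
have Phi0' p : (0%:E <= (Phi p)%:E)%E by rewrite lee_fin.
have Psi0' p : (0%:E <= (Psi p)%:E)%E by rewrite lee_fin.
have mBox (d : R) : measurable_fun setT (fun t : T => (\1_(box (fun=> 0) d) t)%:E : \bar R).
  by apply/measurable_EFinP; apply: measurable_indic; exact: box_measurable.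
have bm (d : R) : 0 <= d -> (mu (box (fun=> 0%R) d) < +oo)%E.
  by move=> d0; rewrite box_measure // ltry.
have mpow : measurable_fun setT (fun p : RM * T => p.1 `^ (-1)).
  by have := measurableT_comp (@measurable_powR R (-1)) m1; exact.
have mPhi : measurable_fun setT (fun p => (Phi p)%:E).
  apply/measurable_EFinP; apply: measurable_funM.
    by apply: measurable_funM; apply: measurable_indic_comp.
  apply: measurable_funM; last exact: measurable_funX.
  by apply: (measurableT_comp mg); apply: measurable_funM.
have mPsi : measurable_fun setT (fun p => (Psi p)%:E).
  apply/measurable_EFinP; apply: measurable_funM; first exact: measurable_indic_comp.
  apply: measurable_funM => //; apply: measurable_funM; last exact: (measurableT_comp mg m2).
  by apply: measurable_indic_comp => //; exact: measurable_funM.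
have EPhi1 : (\int[mu]_t \int[leb]_x (Phi (x, t))%:E < +oo)%E.
  apply: (@le_lt_trans _ _ (\int[mu]_t (K * (\1_(box (fun=> 0) 2) t)%:E))%E).
    apply: ge0_le_integral => //.
    - by move=> t _; apply: integral_ge0 => x _; rewrite lee_fin.
    - apply: (@measurable_fun_fubini_tonelli_G _ _ _ _ _ leb (fun p => (Phi p)%:E)) => //.
    - exact: emeasurable_funM.
    move=> t _.
    have [tin|tout] := boolP (nrm t \in `[1, 2]%R); last first.
      have i0 : \1_`[1, 2]%classic (nrm t) = 0 :> R by rewrite indicE memNset //; exact/negP.
      rewrite (eq_integral (fun=> 0%E)) => [|x _]; last first.
        by rewrite /Phi [X in _ * X * _]i0 mulr0 mul0r.
      by rewrite integral0 mule_ge0 // lee_fin indic_ge0.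
    have tb : box (fun=> 0) 2 t.
      by move=> j; rewrite subr0 (le_trans (tnth_le_eucl t j)) //; case/andP: tin.
    rewrite (_ : \1_(box (fun=> 0) 2) t = 1) ?mule1; last by rewrite indicE mem_set.
    set rho := nrm t in tin *; have /andP[rho1 _] := tin.
    have rho0 : 0 < rho by rewrite (lt_le_trans ltr01).
    (* The substitution [y = rho * r] produces negative powers of [rho], which are at most 1 because
       [rho >= 1]. *)
    pose F (y : RM) : \bar R := (\1_`]0, +oo[%classic y * (g y * (y / rho) ^+ N.-1))%:E.
    have F0 y : (0 <= F y)%E.
      rewrite lee_fin; have [h|h] := leP y 0.
        rewrite (_ : \1_`]0, +oo[%classic y = 0) ?mul0r //.
        by rewrite indicE memNset //= in_itv /= andbT; apply/negP; rewrite -leNgt.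
      by rewrite !mulr_ge0 ?indic_ge0 ?exprn_ge0 ?divr_ge0 // ltW.
    have mF : measurable_fun setT F.
      apply/measurable_EFinP; apply: measurable_funM; first exact: measurable_indic_comp.
      apply: measurable_funM => //; apply: measurable_funX; apply: measurable_funM => //.
    rewrite (eq_integral (fun x : RM => F (rho * x + 0))) => [|x _]; last first.
      rewrite /F /Phi /= addr0 -/rho.
      rewrite (_ : \1_`[1, 2]%classic rho = 1) ?mulr1; last by rewrite indicE mem_set.
      rewrite (_ : \1_`]0, +oo[%classic (rho * x) = \1_`]0, +oo[%classic x :> R); last first.
        by rewrite !indicE; congr (nat_of_bool _)%:R; apply/idP/idP; rewrite !inE /= !in_itv /= !andbT pmulr_rgt0.
      by rewrite [rho * x / rho]mulrAC divff ?gt_eqF // mul1r [rho * x]mulrC.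
    rewrite integral_affine //.
    apply: (@le_trans _ _ (\int[leb]_x F x)%E).
      rewrite -[leRHS]mul1e; apply: lee_wpmul2r; first exact: integral_ge0.
      by rewrite lee_fin invf_le1.
    rewrite /K [leRHS]integral_mkcond; apply: ge0_le_integral => //.
    - apply/(measurable_restrictT _ _).1 => //; apply/measurable_EFinP; apply: measurable_funTS.
      by apply: measurable_funM => //; exact: measurable_funX.
    move=> y _; rewrite patchE /F indicE.
    have [y0|y0] := ltP 0 y; last first.
      rewrite memNset /= ?in_itv /= ?andbT; last by apply/negP; rewrite -leNgt.
      rewrite mul0r; case: ifPn => //; rewrite inE /= in_itv /= andbT => y0'.
      by rewrite lee_fin mulr_ge0 // exprn_ge0.
    rewrite mem_set /= ?in_itv /= ?y0 // mem_set /= ?in_itv /= ?(ltW y0) // mul1r lee_fin.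
    rewrite ler_wpM2l // lerXn2r ?nnegrE ?divr_ge0 ?(ltW y0) ?(ltW rho0) //.
    by rewrite ler_pdivrMr // ler_peMr // ltW.
  rewrite ge0_integralZl // integral_indic //; last exact: box_measurable.
  rewrite setIT; apply: lte_mul_pinfty => //; last exact: bm.
  by rewrite ge0_fin_numE.
have EPsi : (\int[mu]_t \int[leb]_x (Psi (x, t))%:E < +oo)%E.
  rewrite -(@fubini_tonelli _ _ _ _ _ leb mu (fun p => (Psi p)%:E) mPsi Psi0').
  rewrite -(@fubini_tonelli _ _ _ _ _ leb mu (fun p => (Phi p)%:E) mPhi Phi0') in EPhi1.
  rewrite (eq_integral (fun x : RM => \int[mu]_t (Phi (x, t))%:E)%E) // => x _.
  have [x0|x0] := ltP 0 x; last first.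
    apply: eq_integral => t _; rewrite /Phi /Psi /=.
    by rewrite (_ : \1_`]0, +oo[%classic x = 0) ?mul0r // indicE memNset //= in_itv /= andbT; apply/negP; rewrite -leNgt.
  have i1 : \1_`]0, +oo[%classic x = 1 :> R by rewrite indicE mem_set //= in_itv /= x0.
  pose F (t : T) : \bar R := (\1_`[1, 2]%classic (nrm t * x^-1) * g (nrm t))%:E.
  have F0 t : (0 <= F t)%E by rewrite lee_fin mulr_ge0 // indic_ge0.
  have mF : measurable_fun setT F.
    apply/measurable_EFinP; apply: measurable_funM; last exact: (measurableT_comp mg mN).
    by apply: measurable_indic_comp => //; exact: measurable_funM.
  rewrite (eq_integral (fun t => (x^-1)%:E * F t)%E) => [|t _]; last first.
    by rewrite /Psi /= i1 mul1r powR_inv1 ?(ltW x0) // -EFinM.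
  rewrite [RHS](eq_integral (fun t => (x ^+ N.-1)%:E * F (scalet x t))%E) => [|t _]; last first.
    rewrite /F /Phi /= i1 mul1r eucl_norm_scalet // [x * _ / x]mulrAC divff ?gt_eqF // mul1r -EFinM.
    by congr EFin; ring.
  have mF' : measurable_fun setT (fun t => F (scalet x t)).
    apply: measurableT_comp mF _; apply/measurable_fun_tnthP => j.
    rewrite (_ : _ \o _ = fun t : T => x * tnth t j); last by apply/funext => t /=; rewrite tnth_mktuple.
    by apply: measurable_funM => //; exact: measurable_tnth.
  rewrite ge0_integralZl ?lee_fin ?invr_ge0 ?(ltW x0) //.
  rewrite ge0_integralZl ?lee_fin ?exprn_ge0 ?(ltW x0) //.
  rewrite integral_scale // muleA -EFinM; congr (_%:E * _)%E.
  by rewrite -/N -[in RHS](prednK N0) exprS invfM mulrCA divff ?mulr1 // expf_neq0 // gt_eqF.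
(* [|x| / r] lies in [[1, 2]] exactly when [r] lies in [[rho / 2, rho]]; there [1 / r >= 1 / rho],
   on a length [rho / 2]. *)
have half t : ((2^-1 * (\1_`[1, +oo[%classic (nrm t) * g (nrm t)))%:E <= \int[leb]_x (Psi (x, t))%:E)%E.
  have [t1|t1] := ltP (nrm t) 1.
    rewrite (_ : \1_`[1, +oo[%classic (nrm t) = 0) ?mul0r ?mulr0; last first.
      by rewrite indicE memNset //= in_itv /= andbT; apply/negP; rewrite -ltNge.
    by apply: integral_ge0 => x _; rewrite lee_fin.
  set rho := nrm t in t1 *; have rho0 : 0 < rho by rewrite (lt_le_trans ltr01).
  rewrite (_ : \1_`[1, +oo[%classic rho = 1) ?mul1r; last by rewrite indicE mem_set //= in_itv /= t1.
  apply: (@le_trans _ _ (\int[leb]_x ((rho^-1 * g rho)%:E * (\1_`[rho / 2, rho]%classic x)%:E))%E).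
    rewrite ge0_integralZl ?lee_fin ?mulr_ge0 ?invr_ge0 ?(ltW rho0) //; last first.
      by apply/measurable_EFinP; exact: measurable_indic.
    have L : lebesgue_measure (`[rho / 2, rho]%classic : set R) = (rho / 2)%:E.
      rewrite lebesgue_measure_itv /= lte_fin ltr_pdivrMr // ltr_pMr // ltr1n.
      by rewrite -EFinD; congr EFin; lra.
    rewrite integral_indic // setIT [X in (_ * X)%E](_ : _ = (rho / 2)%:E); last exact: L.
    rewrite -EFinM lee_fin le_eqVlt; apply/orP; left; apply/eqP.
    by field; rewrite gt_eqF.
  apply: ge0_le_integral => //.
  - by move=> x _; rewrite -EFinM lee_fin !mulr_ge0 ?invr_ge0 ?indic_ge0 // ltW.
  - by apply: emeasurable_funM => //; apply/measurable_EFinP; exact: measurable_indic.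
  - by apply: (measurableT_comp mPsi); exact: measurable_pair2.
  move=> x _; rewrite -EFinM lee_fin indicE.
  have [|xin] := boolP (x \in _); last by rewrite mulr0.
  rewrite inE /= in_itv /= mulr1 => /andP[x1 x2].
  have x0 : 0 < x by apply: lt_le_trans x1; rewrite divr_gt0.
  rewrite /Psi /= -/rho (_ : \1_`]0, +oo[%classic x = 1) ?mul1r; last by rewrite indicE mem_set //= in_itv /= x0.
  rewrite powR_inv1 ?(ltW x0) // (_ : \1_`[1, 2]%classic (rho / x) = 1) ?mul1r; last first.
    rewrite indicE mem_set //= in_itv /= ler_pdivlMr // mul1r x2 /=.
    by rewrite ler_pdivrMr // mulrC -ler_pdivrMr.
  by rewrite ler_wpM2r // lef_pV2 ?posrE.
apply: (@le_lt_trans _ _ (\int[mu]_t ((2%:E * (2^-1 * (\1_`[1, +oo[%classic (nrm t) * g (nrm t)))%:E) +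
   (M%:E * (\1_(box (fun=> 0) 1) t)%:E)))%E).
  apply: ge0_le_integral => //.
  - by move=> t _; rewrite lee_fin.
  - by apply/measurable_EFinP; exact: (measurableT_comp mg mN).
  - apply: emeasurable_funD; apply: emeasurable_funM => //; apply/measurable_EFinP.
    apply: measurable_funM => //; apply: measurable_funM; first exact: measurable_indic_comp.
    exact: (measurableT_comp mg mN).
  move=> t _; rewrite -!EFinM -EFinD lee_fin mulrA divff // mul1r.
  have [t1|t1] := leP 1 (nrm t).
    rewrite (_ : \1_`[1, +oo[%classic (nrm t) = 1); last by rewrite indicE mem_set //= in_itv /= t1.
    by rewrite mul1r lerDl mulr_ge0 // indic_ge0.
  rewrite (_ : \1_(box _ _) t = 1); last first.
    by rewrite indicE mem_set // => j; rewrite subr0 (le_trans (tnth_le_eucl t j)) // ltW.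
  rewrite mulr1; apply: le_trans (gM _ _) _; first by rewrite eucl_norm_ge0 ltW.
  by rewrite lerDr mulr_ge0 // indic_ge0.
have mI : measurable_fun setT (fun t : T => (2^-1 * (\1_`[1, +oo[%classic (nrm t) * g (nrm t)))%:E).
  apply/measurable_EFinP; apply: measurable_funM => //; apply: measurable_funM.
    exact: measurable_indic_comp.
  exact: (measurableT_comp mg mN).
have mB : measurable_fun setT (fun t : T => (\1_(box (fun=> 0) 1) t)%:E : \bar R).
  exact: mBox.
rewrite ge0_integralD //; last 4 first.
- by move=> t _; rewrite mule_ge0 ?lee_fin // !mulr_ge0 ?invr_ge0 ?indic_ge0.
- exact: emeasurable_funM.
- by move=> t _; rewrite mule_ge0 ?lee_fin // indic_ge0.
- exact: emeasurable_funM.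
have h0 t : (0%:E <= (2^-1 * (\1_`[1, +oo[%classic (nrm t) * g (nrm t)))%:E)%E.
  by rewrite lee_fin !mulr_ge0 ?invr_ge0 ?indic_ge0.
rewrite ge0_integralZl //.
rewrite ge0_integralZl //.
apply: lte_add_pinfty.
  rewrite lte_mul_pinfty //; apply: le_lt_trans EPsi.
  apply: ge0_le_integral => //.
  - apply: (@measurable_fun_fubini_tonelli_G _ _ _ _ _ leb (fun p => (Psi p)%:E)) => //.
rewrite integral_indic //; last exact: box_measurable.
by rewrite setIT; apply: lte_mul_pinfty => //; exact: bm.
Qed.

End RadialIntegral.

(** * The weighted norm *)

Section FatouBound.
Context d (T : measurableType d) (R : realType) (mu : {measure set T -> \bar R}).

Lemma fatou_bound (g : nat -> T -> R) (g' : T -> R) (c : \bar R) :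
  (forall N, measurable_fun setT (g N)) -> (forall N x, 0 <= g N x) ->
  (forall x, g ^~ x @ \oo --> g' x) ->
  (forall N, (\int[mu]_x (g N x)%:E <= c)%E) -> (\int[mu]_x (g' x)%:E <= c)%E.
Proof.
move=> mg g0 gcv gc.
pose f N x := (g N x)%:E.
have E x : (g' x)%:E = limn_einf (f ^~ x).
  have cv : f ^~ x @ \oo --> (g' x)%:E.
    by apply: cvg_EFin; [apply: nearW | exact: gcv].
  by have [-> _] := cvg_limn_einf_sup cv.
rewrite (eq_integral (fun x => limn_einf (f ^~ x))); last by move=> x _; rewrite E.
apply: le_trans (fatou mu measurableT _ _) _.
- by move=> N; apply/measurable_EFinP.
- by move=> N x _; rewrite lee_fin.
rewrite limn_einf_lim; apply: lime_le; first exact: is_cvg_einfs.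
apply: nearW => N; apply: le_trans (gc N); apply: ereal_inf_lbound.
by exists N => /=.
Qed.

End FatouBound.

Section RootParseval.
Variable R : realType.
Local Notation C := R[i].

(** Unfolded, the left side is a triple sum. Its sum over [d] is [unity_root_average] with the roles
    of degree and root index exchanged, and only the diagonal [k = l] remains. *)
Lemma root_parseval N (g : C -> C) :
  \sum_(d < N.+1) sqnorm (root_avg N d g) =
  N.+1%:R^-1 * \sum_(k < N.+1) sqnorm (g (proot R N ^+ k)).
Proof.
suff : (\sum_(d < N.+1) sqnorm (root_avg N d g))%:C%C =
    (N.+1%:R^-1 * \sum_(k < N.+1) sqnorm (g (proot R N ^+ k)))%:C%C by case.
set w := proot R N; set M : C := N.+1%:R.
have M0 : M != 0 by rewrite pnatr_eq0.
rewrite rmorph_sum rmorphM rmorph_sum fmorphV rmorph_nat /= -/M.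
have wJ k : conjc (w ^+ k) = (w ^+ k)^-1.
  have w0 : w ^+ k != 0 by rewrite -normc_gt0 normc_proot.
  by apply: (mulfI w0); rewrite -sqnormC sqnormE normc_proot expr1n divff.
pose G k := g (w ^+ k).
have E d : (sqnorm (root_avg N d g))%:C%C = M^-1 * (\sum_(k < N.+1) \sum_(l < N.+1)
    (G k * conjc (G l)) * (M^-1 * (((w ^+ d) ^+ k)^-1 * (w ^+ d) ^+ l))).
  rewrite sqnormC /root_avg -/w -/M rmorphM rmorph_sum fmorphV rmorph_nat /= -/M.
  rewrite -mulrA; congr (_ * _); rewrite mulr_suml; apply: eq_bigr => k _.
  rewrite mulrCA [LHS]mulrA mulr_sumr; apply: eq_bigr => l _.
  rewrite rmorphM fmorphV rmorphXn /= wJ exprVn invrK -/(G k) -/(G l).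
  by rewrite -!exprM ![(d * _)%N]mulnC; ring.
rewrite (eq_bigr _ (fun d _ => E (nat_of_ord d))) -mulr_sumr; congr (_ * _).
rewrite exchange_big /=; apply: eq_bigr => k _; rewrite exchange_big /=.
have S l : \sum_(d < N.+1) (G k * conjc (G l)) * (M^-1 * (((w ^+ d) ^+ k)^-1 * (w ^+ d) ^+ l)) =
    G k * conjc (G l) * (l == k %[mod N.+1])%:R.
  by rewrite -(unity_root_average k l (prootP R N)) -/M !mulr_sumr.
rewrite (eq_bigr _ (fun (l : 'I_N.+1) _ => S l)).
rewrite (bigD1 k) //= eqxx mulr1 big1 ?addr0 ?sqnormC // => l lk.
by rewrite !modn_small // -(inj_eq val_inj) /= in lk *; rewrite (negbTE lk) mulr0.
Qed.

End RootParseval.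

Section FockNorm.
Variables (R : realType) (n : nat) (h : R -> R).
Local Notation C := R[i].
Local Notation V := 'cV[C]_n.
Local Notation RM := (measurableTypeR R).
Local Notation T := ((n + n).-tuple RM).
Local Notation mu := (lebesgue_tuple R (n + n)).
Hypotheses (n0 : (0 < n)%N) (h_ge0 : forall r, 0 <= r -> 0 <= h r)
  (h_meas : measurable_fun (`[0, +oo[%classic : set R) h)
  (h_int : forall m : nat, (\int[@lebesgue_measure R]_(r in `[0%R, +oo[)
     (r ^+ (2 * m + 2 * n - 1) * expR (- 2 * h r))%:E < +oo)%E).
Implicit Types (f g u : cfun R n).

Let w (z : V) := fock_weight h z.

Lemma fock_weight_gt0 z : 0 < w z.
Proof. exact: expR_gt0. Qed.

Lemma fock_weight_dil (m : 'I_n -> C) z : (forall i, normc (m i) = 1) -> w (dil m z) = w z.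
Proof. by move=> hm; rewrite /w /fock_weight eucl_norm_dil. Qed.

(** [h] is controlled on [[0, +oo[] alone; composing with the absolute value gives a function
    measurable on the whole line. *)
Let h_abs : measurable_fun [set: R] (fun r => h `|r|).
Proof.
apply: (@measurable_comp _ _ _ _ _ _ (`[0, +oo[%classic : set R)) => //.
by move=> _ [x _ <-]; rewrite /= in_itv /= andbT.
Qed.

Lemma measurable_weight : measurable_fun setT (fun x : T => w (cvec x)).
Proof.
rewrite (_ : (fun _ => _) = (fun r : R => expR (- 2 * h `|r|)) \o (fun x : T => eucl_norm (cvec x))).
  apply: measurableT_comp; last exact: measurable_eucl.
  by apply: measurableT_comp => //; apply: measurable_funM => //; exact: h_abs.
by apply/funext => x; rewrite /w /fock_weight /= ger0_norm // eucl_norm_ge0.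
Qed.

Definition cmeas f := measurable_fun setT (fun x : T => complex.Re (f (cvec x) : C)) /\
  measurable_fun setT (fun x : T => complex.Im (f (cvec x) : C)).

Lemma cmeas_cst c : cmeas (fun=> c).
Proof. by split; exact: measurable_cst. Qed.

Lemma cmeasD f g : cmeas f -> cmeas g -> cmeas (fun z => (f z : C) + (g z : C)).
Proof.
move=> [fr fi] [gr gi]; split.
  by under eq_fun do rewrite cReD; apply: measurable_funD.
by under eq_fun do rewrite cImD; apply: measurable_funD.
Qed.

Lemma cmeasM f g : cmeas f -> cmeas g -> cmeas (fun z => (f z : C) * (g z : C)).
Proof.
move=> [fr fi] [gr gi]; split.
  by under eq_fun do rewrite cReM; apply: measurable_funB; apply: measurable_funM.
by under eq_fun do rewrite cImM; apply: measurable_funD; apply: measurable_funM.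
Qed.

Lemma cmeas_sum (I : Type) (r : seq I) (F : I -> cfun R n) : (forall i, cmeas (F i)) ->
  cmeas (fun z => \sum_(i <- r) (F i z : C)).
Proof.
move=> hF; elim: r => [|i r IH].
  by rewrite (_ : (fun _ => _) = fun=> 0); [exact: cmeas_cst | apply/funext => z; rewrite big_nil].
rewrite (_ : (fun _ => _) = fun z => (F i z : C) + \sum_(j <- r) (F j z : C)); first exact: cmeasD.
by apply/funext => z; rewrite big_cons.
Qed.

Lemma cmeas_mono a : cmeas (mono a).
Proof.
rewrite /mono; elim: (index_enum _) => [|i r IH].
  by rewrite (_ : (fun _ => _) = fun=> 1); [exact: cmeas_cst | apply/funext => z; rewrite big_nil].
rewrite (_ : (fun _ => _) = fun z : V => (z i 0 ^+ a i : C) * (\prod_(j <- r) (z j 0) ^+ a j : C)); last first.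
  by apply/funext => z; rewrite big_cons.
apply: cmeasM => //; elim: (a i) => [|k IHk].
  by rewrite (_ : (fun _ => _) = fun=> 1); [exact: cmeas_cst | apply/funext => z; rewrite expr0].
rewrite (_ : (fun _ => _) = fun z : V => (z i 0 : C) * (z i 0 ^+ k : C)); last first.
  by apply/funext => z; rewrite exprS.
apply: cmeasM => //; split.
  by under eq_fun do rewrite mxE /=; exact: measurable_tnth.
by under eq_fun do rewrite mxE /=; exact: measurable_tnth.
Qed.

Lemma cmeas_lspan (A : set (cfun R n)) f : (forall u, A u -> cmeas u) -> lspan A f -> cmeas f.
Proof.
move=> hA; apply: (@lspan_min R (cfun R n) A cmeas hA); first exact: (cmeas_cst 0).
by move=> a u v hu hv; apply: cmeasD => //; apply: (@cmeasM (fun=> a)) => //; exact: cmeas_cst.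
Qed.

(** An entire function is the pointwise limit of its Taylor polynomials, whose measurability is
    algebraic. *)
Lemma cmeas_frechet f : frechet f -> cmeas f.
Proof.
move=> df.
have mS N : cmeas (fun z => \sum_(j < N) (tcoef f j z : C)).
  apply: cmeas_sum => j.
  apply: (@cmeas_lspan (@monos R n j)); first by move=> u [a [_ ->]]; exact: cmeas_mono.
  by apply: homogeneous_lspan; [exact: frechet_tcoef | exact: tcoef_homogeneous].
have cv z (e : R) : 0 < e -> exists N0, forall N, (N0 <= N)%N ->
    normc ((f z : C) - \sum_(j < N) (tcoef f j z : C)) <= e.
  move=> e0; have [M M0 hM] := frechet_bounded (2 * vnorm z) df.
  have [N0 hN0] := half_power_le (4 * M) e0; exists N0 => N /hN0 h1.
  by apply: le_trans h1; apply: tcoef_series.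
split.
  apply: (@measurable_fun_cvg _ _ R setT (fun N x => complex.Re (\sum_(j < N) (tcoef f j (cvec x) : C)))).
    by move=> N; have [] := mS N.
  move=> x _; apply/cvgrPdist_le => e e0; have [N0 hN0] := cv (cvec x) e e0.
  exists N0 => // N hN /=; rewrite -cReB; apply: le_trans (Re_le_normc _) _; exact: hN0.
apply: (@measurable_fun_cvg _ _ R setT (fun N x => complex.Im (\sum_(j < N) (tcoef f j (cvec x) : C)))).
  by move=> N; have [] := mS N.
move=> x _; apply/cvgrPdist_le => e e0; have [N0 hN0] := cv (cvec x) e e0.
exists N0 => // N hN /=; rewrite -cImB; apply: le_trans (Im_le_normc _) _; exact: hN0.
Qed.

Definition qden f (z : V) : R := sqnorm (f z : C) * w z.

(** The squared norm, in the extended reals so as to be meaningful before its finiteness is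
    known. *)
Definition fq f : \bar R := (\int[mu]_x (qden f (cvec x))%:E)%E.

Lemma qden_ge0 f z : 0 <= qden f z.
Proof. by rewrite mulr_ge0 ?sqnorm_ge0 // ltW // fock_weight_gt0. Qed.

Lemma measurable_qden f : cmeas f -> measurable_fun setT (fun x : T => qden f (cvec x)).
Proof.
move=> [fr fi]; apply: measurable_funM; last exact: measurable_weight.
by apply: measurable_funD; apply: measurable_funX.
Qed.

Lemma fq_ge0 f : (0 <= fq f)%E.
Proof. by apply: integral_ge0 => x _; rewrite lee_fin qden_ge0. Qed.

Lemma fock_spaceE f : fock_space h f <-> frechet f /\ (fq f < +oo)%E.
Proof. by split=> -[] /entire_frechet. Qed.

Lemma fq_dil f m : frechet f -> (forall i, normc (m i) = 1) -> fq (fun z => f (dil m z)) = fq f.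
Proof.
move=> df hm.
have [||_ E] := @integral_dil R n m (fun z => (qden f z)%:E) hm.
- by apply/measurable_EFinP; exact: measurable_qden (cmeas_frechet df).
- by move=> z; rewrite lee_fin qden_ge0.
rewrite /fq -E; apply: eq_integral => x _.
by rewrite /qden fock_weight_dil.
Qed.

Lemma sqnormD_le (x y : C) : sqnorm (x + y) <= 2 * sqnorm x + 2 * sqnorm y.
Proof.
case: x y => a b [c d]; rewrite /sqnorm /=.
by have := sqr_ge0 (a - c); have := sqr_ge0 (b - d); nra.
Qed.

(** The inequality [|x + y|^2 <= 2 |x|^2 + 2 |y|^2] stands in for the triangle inequality at the
    level of squared norms. *)
Lemma fqD f g : frechet f -> frechet g ->
  (fq (fun z => ((f z : C) + (g z : C))%R) <= 2%:E * fq f + 2%:E * fq g)%E.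
Proof.
move=> df dg; have mf := measurable_qden (cmeas_frechet df); have mg := measurable_qden (cmeas_frechet dg).
have nn u : forall x : T, setT x -> (0%:E <= (qden u (cvec x))%:E)%E by move=> x _; rewrite lee_fin qden_ge0.
have mf' : measurable_fun setT (fun x : T => (qden f (cvec x))%:E) by apply/measurable_EFinP.
have mg' : measurable_fun setT (fun x : T => (qden g (cvec x))%:E) by apply/measurable_EFinP.
have nf := nn f; have ng := nn g; have t0 : (0%:E <= 2%:E :> \bar R)%E by rewrite lee_fin.
rewrite /fq -(ge0_integralZl _ measurableT mf' nf t0) -(ge0_integralZl _ measurableT mg' ng t0).
rewrite -ge0_integralD //.
- apply: ge0_le_integral => //.
  + exact: nn.
  + by apply/measurable_EFinP; exact: measurable_qden (cmeasD (cmeas_frechet df) (cmeas_frechet dg)).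
  + by apply: emeasurable_funD; apply: emeasurable_funM.
  move=> x _; rewrite -!EFinM -EFinD lee_fin /qden !mulrA -mulrDl ler_wpM2r //.
    by rewrite ltW // fock_weight_gt0.
  exact: sqnormD_le.
- by move=> x hx; rewrite mule_ge0 // nn.
- exact: emeasurable_funM.
- by move=> x hx; rewrite mule_ge0 // nn.
- exact: emeasurable_funM.
Qed.

Lemma fqZ c f : frechet f -> fq (fun z => (c * (f z : C))%R) = ((sqnorm c)%:E * fq f)%E.
Proof.
move=> df; rewrite /fq -ge0_integralZl //.
- by apply: eq_integral => x _; rewrite -EFinM /qden sqnormM mulrA.
- by apply/measurable_EFinP; exact: measurable_qden (cmeas_frechet df).
- by move=> x _; rewrite lee_fin qden_ge0.
- by rewrite lee_fin sqnorm_ge0.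
Qed.

Lemma fqD_lty f g : frechet f -> frechet g -> (fq f < +oo)%E -> (fq g < +oo)%E ->
  (fq (fun z => ((f z : C) + (g z : C))%R) < +oo)%E.
Proof.
move=> df dg qf qg; apply: le_lt_trans (fqD df dg) _.
by rewrite lte_add_pinfty // lte_mul_pinfty // lee_fin.
Qed.

Lemma frechet_mono a : frechet (mono a : cfun R n).
Proof. by apply: frechet_prod => i; exact: frechet_coordX. Qed.

(** [|mono a z|^2 <= |z|^(2m)] with [m] the total degree, and [g r * r^(2n-1)] is the integrand of
    [h_int m]. On [[0, 1]] the bound 1 for [g] comes from [h >= 0]. *)
Lemma fq_mono_lty a : (fq (mono a) < +oo)%E.
Proof.
pose m := (\sum_i a i)%N.
pose g (r : R) := `|r| ^+ (2 * m) * expR (- 2 * h `|r|).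
have g0 r : 0 <= g r by rewrite mulr_ge0 ?expR_ge0 ?exprn_ge0.
have mg : measurable_fun [set: R] g.
  apply: measurable_funM; first by apply: measurable_funX; exact: normr_measurable.
  by apply: measurableT_comp => //; apply: measurable_funM => //; exact: h_abs.
apply: (@le_lt_trans _ _ (\int[mu]_x (g (eucl_norm (cvec x)))%:E)%E); last first.
  apply: (@radial_lty R n g 1) => //.
    move=> r /andP[r0 r1]; rewrite /g ger0_norm // mulr_ile1 ?exprn_ge0 ?expR_ge0 ?exprn_ile1 //.
    by rewrite -expR0 ler_expR mulNr oppr_le0 mulr_ge0 // h_ge0.
  apply: le_lt_trans (h_int m); rewrite le_eqVlt; apply/orP; left; apply/eqP.
  apply: eq_integral.
  move=> r; rewrite inE /= in_itv /= andbT => r0; rewrite /g ger0_norm // mulrAC -exprD.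
  by congr (_ ^+ _ * _)%:E; rewrite (mul2n n) -addnn -subn1 addnBA // addn_gt0 n0.
apply: ge0_le_integral => //.
- by move=> x _; rewrite lee_fin qden_ge0.
- by apply/measurable_EFinP; exact: measurable_qden (cmeas_mono a).
- apply/measurable_EFinP; apply: (measurableT_comp mg); exact: measurable_eucl.
move=> x _; rewrite lee_fin /qden /g ger0_norm ?eucl_norm_ge0 // /w /fock_weight.
rewrite ler_wpM2r ?expR_ge0 // mulnC exprM sqnormE lerXn2r ?nnegrE ?normc_ge0 ?exprn_ge0 ?eucl_norm_ge0 //.
rewrite /mono normc_prod /m -prodrXr; apply: ler_prod => i _; rewrite normc_ge0 normcX /=.
by rewrite lerXn2r ?nnegrE ?normc_ge0 ?eucl_norm_ge0 // normc_le_eucl.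
Qed.

End FockNorm.

(** * Bessel's inequality and norm convergence of the Taylor series *)

Section TaylorDensity.
Variables (R : realType) (n : nat) (h : R -> R).
Local Notation C := R[i].
Local Notation V := 'cV[C]_n.
Local Notation RM := (measurableTypeR R).
Local Notation T := ((n + n).-tuple RM).
Local Notation mu := (lebesgue_tuple R (n + n)).
Hypothesis h_meas : measurable_fun (`[0, +oo[%classic : set R) h.
Implicit Types (f g u : cfun R n).

Lemma cvg_qden (F : nat -> cfun R n) f z :
  (forall e : R, 0 < e -> exists N0, forall N, (N0 <= N)%N -> normc ((F N z : C) - f z) <= e) ->
  (fun N => qden h (F N) z) @ \oo --> qden h f z.
Proof.
move=> hF; apply: cvgM; last exact: cvg_cst.
have cv (p : C -> R) : (forall x y, `|p x - p y| <= normc (x - y)) -> (fun N => p (F N z)) @ \oo --> p (f z).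
  move=> hp; apply/cvgrPdist_le => e e0; have [N0 hN] := hF e e0; exists N0 => // N /= /hN h1.
  by rewrite distrC; apply: le_trans (hp _ _) h1.
apply: cvgD; rewrite ?expr2; apply: cvgM; apply: cv => x y;
  by rewrite -?cReB -?cImB ?Re_le_normc ?Im_le_normc.
Qed.

Definition avgf N d f : cfun R n := fun z => root_avg N d (fun t => f (t *: z)).

Lemma frechet_avgf N d f : frechet f -> frechet (avgf N d f).
Proof. by move=> df; apply: frechet_root_avg => t; apply: frechet_scale. Qed.

Let mq f : frechet f -> measurable_fun setT (fun x : T => (qden h f (cvec x))%:E).
Proof. by move=> df; apply/measurable_EFinP; exact: measurable_qden (cmeas_frechet df). Qed.

Let q0 f (x : T) : (0%:E <= (qden h f (cvec x))%:E)%E.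
Proof. by rewrite lee_fin qden_ge0. Qed.

Lemma fq_scale f c : frechet f -> normc c = 1 -> fq h (fun z => f (c *: z)) = fq h f.
Proof.
move=> df hc; rewrite -(@fq_dil R n h h_meas f (fun=> c) df) //.
by congr (fq h _); apply/funext => z; rewrite dil_cst.
Qed.

(** [root_parseval] at each point, integrated: the dilates of [f] by the [N + 1] roots all have the
    norm of [f]. *)
Lemma fq_avgf_sum N f : frechet f -> (fq h f < +oo)%E ->
  (\int[mu]_x (\sum_(d < N.+1) qden h (avgf N d f) (cvec x))%:E = fq h f)%E.
Proof.
move=> df qf; have qfin : fq h f \is a fin_num by rewrite ge0_fin_numE ?fq_ge0.
pose F (k : nat) : cfun R n := fun z => f ((proot R N ^+ k) *: z).
have dF k : frechet (F k) by exact: frechet_scale.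
have k0 : (0%:E <= (N.+1%:R^-1)%:E :> \bar R)%E by rewrite lee_fin invr_ge0.
have E x : (\sum_(d < N.+1) qden h (avgf N d f) (cvec x))%:E =
   (\sum_(k < N.+1) (N.+1%:R^-1)%:E * (qden h (F k) (cvec x))%:E)%E.
  under [RHS]eq_bigr do rewrite -EFinM; rewrite sumEFin; congr EFin; rewrite -mulr_suml root_parseval mulr_sumr mulr_suml.
  by apply: eq_bigr => k _; rewrite mulrA.
rewrite (eq_integral _ _ (fun x _ => E x)).
rewrite ge0_integral_sum //; last 2 first.
- by move=> k; apply: emeasurable_funM => //; exact: mq.
- by move=> k x _; rewrite mule_ge0.
rewrite (eq_bigr (fun=> (N.+1%:R^-1)%:E * fq h f)%E) => [|k _]; last first.
  rewrite ge0_integralZl //; last exact: mq.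
  by congr (_ * _)%E; rewrite -/(fq h (F k)) fq_scale // normc_proot.
rewrite -(fineK qfin) -EFinM sumEFin sumr_const card_ord -(mulr_natl (_ * _)) mulrA divff ?mul1r //.
Qed.

Lemma fq_avgf_le N d f : (d <= N)%N -> frechet f -> (fq h f < +oo)%E -> (fq h (avgf N d f) <= fq h f)%E.
Proof.
move=> dN df qf; rewrite -[leRHS](fq_avgf_sum N df qf).
apply: ge0_le_integral => //; first exact: mq (frechet_avgf N d df).
- rewrite (_ : (fun _ => _) = fun x : T => (\sum_(d < N.+1) (qden h (avgf N d f) (cvec x))%:E)%E).
    by apply: emeasurable_sum => k; exact: mq (frechet_avgf N k df).
  by apply/funext => x; rewrite sumEFin.
move=> x _; rewrite lee_fin (bigD1 (Ordinal (dN : (d < N.+1)%N))) //= lerDl sumr_ge0 // => k _.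
exact: qden_ge0.
Qed.

Lemma fq_cst0 : fq h ((fun=> 0) : cfun R n) = 0%E.
Proof.
by rewrite /fq (eq_integral (fun=> 0%E)) ?integral0 // => x _; rewrite /qden /sqnorm /= expr0n /= addr0 mul0r.
Qed.

Lemma fq_sum_lty (I : Type) (r : seq I) (F : I -> cfun R n) : (forall i, frechet (F i)) ->
  (forall i, (fq h (F i) < +oo)%E) -> (fq h (fun z => (\sum_(i <- r) (F i z : C))%R) < +oo)%E.
Proof.
move=> dF qF; elim: r => [|i r IH].
  rewrite (_ : (fun _ => _) = fun=> 0) ?fq_cst0 //.
  by apply/funext => z; rewrite big_nil.
rewrite (_ : (fun _ => _) = fun z => (F i z : C) + \sum_(j <- r) (F j z : C)); last first.
  by apply/funext => z; rewrite big_cons.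
by apply: fqD_lty => //; exact: frechet_sum.
Qed.

(** Pythagoras for distinct degrees: the averages of the sum are its components, so [fq_avgf_sum] is
    the claim. *)
Lemma fq_homogeneous_sum N (v : nat -> cfun R n) : (forall d, frechet (v d)) ->
  (forall d, homogeneous (v d) d) -> (forall d, (fq h (v d) < +oo)%E) ->
  fq h (fun z => (\sum_(d < N.+1) (v d z : C))%R) = (\sum_(d < N.+1) fq h (v d))%E.
Proof.
move=> dv hv qv; pose u : cfun R n := fun z => \sum_(d < N.+1) (v d z : C).
have du : frechet u by apply: (@frechet_sum _ _ _ _ (fun d : 'I_N.+1 => v d)) => d; exact: dv.
have qu : (fq h u < +oo)%E by apply: (@fq_sum_lty _ _ (fun d : 'I_N.+1 => v d)).
rewrite -/u -(fq_avgf_sum N du qu).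
have E (d : 'I_N.+1) : avgf N d u = v d.
  apply/funext => z; rewrite -(root_avg_poly (fun j => v j z : C) (ltn_ord d : (d <= N)%N)).
  congr (_ * _); apply: eq_bigr => k _; congr (_ * _); rewrite /u; apply: eq_bigr => j _.
  by rewrite hv ?expf_neq0 ?(prim_root_neq0 (prootP R N)) // mulrC.
rewrite -ge0_integral_sum //; last by move=> d; exact: mq.
by apply: eq_integral => x _; rewrite sumEFin; congr EFin; apply: eq_bigr => d _; rewrite E.
Qed.

Lemma tcoef_avgf_cvg f d z : frechet f -> forall e : R, 0 < e -> exists N0, forall N, (N0 <= N)%N ->
  normc ((avgf (d + N) d f z : C) - tcoef f d z) <= e.
Proof.
move=> df e e0; have [M M0 hM] := frechet_bounded (2 * vnorm z) df.
have [N0 hN0] := half_power_le (4 * M) e0; exists N0 => N hN.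
apply: le_trans (tcoef_avg df hM _) (hN0 _ _); first by rewrite leq_addr.
by rewrite ltnW // ltnS (leq_trans hN) // leq_addl.
Qed.

(** Fatou is applied to the whole sum over [d < D]; averages of order [D + N] include all these
    degrees. *)
Lemma bessel f D : frechet f -> (fq h f < +oo)%E -> (\sum_(d < D) fq h (tcoef f d) <= fq h f)%E.
Proof.
move=> df qf; rewrite -ge0_integral_sum //; last by move=> d; exact: mq (frechet_tcoef d df).
rewrite (eq_integral (fun x => (\sum_(d < D) qden h (tcoef f d) (cvec x))%:E)); last first.
  by move=> x _; rewrite sumEFin.
apply: (@fatou_bound _ _ _ _ (fun N x => \sum_(d < D) qden h (avgf (D + N) d f) (cvec x))).
- by move=> N; apply: measurable_sum => d; exact: measurable_qden (cmeas_frechet (frechet_avgf _ d df)).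
- by move=> N x; apply: sumr_ge0 => d _; exact: qden_ge0.
- move=> x; apply: cvg_big => [|d _]; first exact: add_continuous.
  apply: cvg_qden => e e0.
  have [N0 hN0] := tcoef_avgf_cvg d (cvec x) df e0; exists N0 => N hN.
  have -> : (D + N = d + (D - d + N))%N by rewrite addnA subnKC // ltnW.
  by apply: hN0; rewrite (leq_trans hN) // leq_addl.
move=> N; rewrite -[leRHS](fq_avgf_sum (D + N) df qf).
apply: ge0_le_integral => //.
- by move=> x _; rewrite lee_fin; apply: sumr_ge0 => d _; exact: qden_ge0.
- apply/measurable_EFinP; apply: measurable_sum => d.
  exact: measurable_qden (cmeas_frechet (frechet_avgf _ d df)).
- apply/measurable_EFinP; apply: measurable_sum => d.
  exact: measurable_qden (cmeas_frechet (frechet_avgf _ d df)).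
move=> x _; rewrite lee_fin.
have DN : (D <= (D + N).+1)%N by rewrite ltnW // ltnS leq_addr.
rewrite -(big_mkord xpredT (fun d => qden h (avgf (D + N) d f) (cvec x))).
rewrite -(big_mkord xpredT (fun d => qden h (avgf (D + N) d f) (cvec x))).
rewrite (big_cat_nat (leq0n D) DN) //= lerDl sumr_ge0 // => d _.
exact: qden_ge0.
Qed.

Lemma tcoef_lty f d : frechet f -> (fq h f < +oo)%E -> (fq h (tcoef f d) < +oo)%E.
Proof.
move=> df qf; apply: le_lt_trans (qf); apply: le_trans (bessel d.+1 df qf).
by rewrite big_ord_recr /= leeDr // sume_ge0 // => i _; exact: fq_ge0.
Qed.

(** The remainder after [D] terms is the pointwise limit of the blocks of degrees [D, ..., D + N].
    Their squared norms are blocks of the series of the [q d], which converges by [bessel], and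
    Fatou passes to the limit. *)
Lemma taylor_density f (e : R) : frechet f -> (fq h f < +oo)%E -> 0 < e ->
  exists D0, forall D, (D0 <= D)%N ->
    (fq h (fun z => ((f z : C) - \sum_(j < D) (tcoef f j z : C))%R) <= e%:E)%E.
Proof.
move=> df qf e0.
pose q d := fine (fq h (tcoef f d)).
have qE d : fq h (tcoef f d) = (q d)%:E.
  by rewrite fineK // ge0_fin_numE ?fq_ge0 // tcoef_lty.
have q_ge0 d : 0 <= q d by rewrite fine_ge0 // fq_ge0.
pose S D := \sum_(0 <= d < D) q d.
have Sub D : S D <= fine (fq h f).
  rewrite -lee_fin fineK ?ge0_fin_numE ?fq_ge0 // /S big_mkord.
  rewrite -sumEFin; apply: le_trans (bessel D df qf).
  by apply: lee_sum => d _; rewrite qE.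
have hs : has_sup (range S).
  by split; [exists (S 0%N), 0%N | exists (fine (fq h f)) => _ [D _ <-]].
have [_ [D0 _ <-] hD0] := sup_adherent e0 hs.
exists D0 => D hD.
(* Degrees below [D] are replaced by 0, so that the block is a sum from degree 0 as in
   [fq_homogeneous_sum]. *)
pose v d : cfun R n := if (D <= d)%N then tcoef f d else fun=> 0.
have dv d : frechet (v d).
  by rewrite /v; case: leqP => _; [exact: frechet_tcoef | exact: frechet_cst].
have hv d : homogeneous (v d) d.
  by rewrite /v; case: leqP => _; [exact: tcoef_homogeneous | move=> l z _; rewrite mulr0].
have qv d : fq h (v d) = (if (D <= d)%N then q d else 0)%:E.
  by rewrite /v; case: leqP => _; rewrite ?qE ?fq_cst0.
pose u N : cfun R n := fun z => \sum_(d < (D + N).+1) (v d z : C).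
have uE N z : u N z = (\sum_(j < (D + N).+1) (tcoef f j z : C)) - \sum_(j < D) (tcoef f j z : C).
  have DN : (D <= (D + N).+1)%N by rewrite ltnW // ltnS leq_addr.
  rewrite /u -(big_mkord xpredT (fun d => v d z : C)) -(big_mkord xpredT (fun d => tcoef f d z : C)).
  rewrite -(big_mkord xpredT (fun d => tcoef f d z : C)) !(big_cat_nat (leq0n D) DN) //=.
  rewrite [RHS]addrC addKr [X in X + _]big_nat_cond big1 ?add0r => [|d]; last first.
    by rewrite andbT => /andP[_ dD]; rewrite /v leqNgt dD.
  by apply: eq_big_nat => d /andP[dD _]; rewrite /v dD.
have du N : frechet (u N).
  by apply: (@frechet_sum _ _ _ _ (fun d : 'I_(D + N).+1 => v d)) => d; exact: dv.
apply: (@fatou_bound _ _ _ _ (fun N x => qden h (u N) (cvec x))).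
- by move=> N; exact: measurable_qden (cmeas_frechet (du N)).
- by move=> N x; exact: qden_ge0.
- move=> x; apply: cvg_qden => e' e'0.
  have [M M0 hM] := frechet_bounded (2 * vnorm (cvec x)) df.
  have [N0 hN0] := half_power_le (4 * M) e'0; exists N0 => N hN.
  rewrite uE opprB addrA subrK distc_sym.
  apply: le_trans (tcoef_series _ df hM) (hN0 _ _).
  by rewrite ltnW // ltnS (leq_trans hN) // leq_addl.
move=> N; rewrite -/(fq h (u N)) (fq_homogeneous_sum (D + N) dv hv); last by move=> d; rewrite qv ltry.
rewrite (eq_bigr _ (fun (d : 'I_(D + N).+1) _ => qv d)) sumEFin lee_fin.
have DN : (D <= (D + N).+1)%N by rewrite ltnW // ltnS leq_addr.
rewrite -(big_mkord xpredT (fun d => if (D <= d)%N then q d else 0)) (big_cat_nat (leq0n D) DN) //=.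
rewrite [X in X + _]big_nat_cond big1 ?add0r => [|d]; last first.
  by rewrite andbT => /andP[_ dD]; rewrite leqNgt dD.
have -> : \sum_(D <= d < (D + N).+1) (if (D <= d)%N then q d else 0) = \sum_(D <= d < (D + N).+1) q d.
  by apply: eq_big_nat => d /andP[-> _].
have SE : S (D + N).+1 = S D + \sum_(D <= d < (D + N).+1) q d by rewrite /S (big_cat_nat (leq0n D) DN).
have h1 : S (D + N).+1 <= sup (range S) by apply: ub_le_sup; [case: hs | exists (D + N).+1].
have h2 : S D0 <= S D by rewrite /S (big_cat_nat (leq0n D0) hD) //= lerDl sumr_ge0.
by clear -h1 h2 hD0 SE; lra.
Qed.

(** [avgf N d] is a contraction sending the Taylor polynomial of degree [N] to its component of
    degree [d]. The estimate puts Taylor components into closed invariant subspaces. *)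
Lemma avgf_tcoef_le f N d : (d <= N)%N -> frechet f -> (fq h f < +oo)%E ->
  (fq h (fun z => ((avgf N d f z : C) - tcoef f d z)%R) <=
   fq h (fun z => ((f z : C) - \sum_(j < N.+1) (tcoef f j z : C))%R))%E.
Proof.
move=> dN df qf; pose u : cfun R n := fun z => (f z : C) - \sum_(j < N.+1) (tcoef f j z : C).
pose s : cfun R n := fun z => -1 * \sum_(j < N.+1) (tcoef f j z : C).
have ds : frechet s.
  apply: frechetZ; apply: (@frechet_sum _ _ _ _ (fun j : 'I_N.+1 => tcoef f j)) => j.
  exact: frechet_tcoef.
have uE : u = fun z => (f z : C) + s z by apply/funext => z; rewrite /s mulN1r.
have du : frechet u by rewrite uE; exact: frechetD.
have qu : (fq h u < +oo)%E.
  rewrite uE; apply: fqD_lty => //.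
  rewrite (fqZ h_meas); last first.
    by apply: (@frechet_sum _ _ _ _ (fun j : 'I_N.+1 => tcoef f j)) => j; exact: frechet_tcoef.
  rewrite lte_mul_pinfty ?lee_fin ?sqnorm_ge0 //.
  apply: (@fq_sum_lty _ _ (fun j : 'I_N.+1 => tcoef f j)) => j; first exact: frechet_tcoef.
  exact: tcoef_lty.
rewrite -/u (_ : (fun z => _) = avgf N d u); first exact: fq_avgf_le.
apply/funext => z; rewrite /avgf /u.
have -> : root_avg N d (fun t => (f (t *: z) : C) - \sum_(j < N.+1) (tcoef f j (t *: z) : C)) =
   root_avg N d (fun t => f (t *: z)) - root_avg N d (fun t => \sum_(j < N.+1) (tcoef f j (t *: z) : C)).
  by rewrite /root_avg -mulrBr -sumrB; congr (_ * _); apply: eq_bigr => k _; rewrite mulrBr.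
congr (_ - _); rewrite -(root_avg_poly (fun j => tcoef f j z : C) dN).
congr (_ * _); apply: eq_bigr => k _; congr (_ * _); apply: eq_bigr => j _.
by rewrite (tcoef_homogeneous j df) ?expf_neq0 ?(prim_root_neq0 (prootP R N)) // mulrC.
Qed.

(** By continuity a nonzero value persists on a box, which has positive measure, whereas the
    integrand vanishes almost everywhere. *)
Lemma fq_eq0 f : frechet f -> fq h f = 0%E -> f = fun=> 0.
Proof.
move=> df qf; apply/funext => z0; apply: contrapT => /eqP fz0.
have c0 : 0 < normc (f z0 : C) by rewrite normc_gt0.
have [d d0 hd] := frechet_cont df z0 c0.
have ae0 : ae_eq mu setT (fun x : T => (qden h f (cvec x))%:E) (cst 0%E).
  apply/ae_eq_integral_abs => //; first exact: mq.
  by rewrite -[RHS]qf; apply: eq_integral => x _; rewrite gee0_abs.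
pose x0 (j : 'I_(n + n)) : R := match fintype.split j with
  | inl i => complex.Re (z0 i 0) | inr i => complex.Im (z0 i 0) end.
pose r := d / (2 * n.+1%:R); have n0 : 0 < 2 * n.+1%:R :> R by rewrite mulr_gt0.
have r0 : 0 < r by rewrite divr_gt0.
have bpos x : box x0 r x -> qden h f (cvec x) != 0.
  move=> hx; have fx : (f (cvec x) : C) != 0.
    apply/eqP => fx0; have := hd (cvec x); rewrite fx0 sub0r normcN ltxx => hd'.
    suff : false by []; apply: hd'.
    apply: (@le_lt_trans _ _ (\sum_(i < n) (d / n.+1%:R))).
      apply: ler_sum => i _; rewrite !mxE; apply: le_trans (normc_le_ReIm _) _; rewrite cReB cImB /=.
      have -> : d / n.+1%:R = r + r.
        have : n.+1%:R != 0 :> R by rewrite pnatr_eq0.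
        by rewrite /r; move: (n.+1%:R : R) => m m0; field.
      have h1 := hx (lshift n i); have h2 := hx (rshift n i).
      rewrite /x0 (unsplitK (inl i)) in h1; rewrite /x0 (unsplitK (inr i)) in h2.
      exact: lerD.
    by rewrite sumr_const card_ord -[ltLHS]mulr_natr mulrAC ltr_pdivrMr // ltr_pM2l // ltr_nat.
  rewrite /qden mulf_neq0 //; last by rewrite gt_eqF // fock_weight_gt0.
  by rewrite sqnormE sqrf_eq0 normc_eq0.
have [A [mA A0 hA]] := ae0.
have : (mu (box x0 r) <= mu A)%E.
  apply: le_measure; rewrite ?inE //; first exact: box_measurable.
  move=> x hx; apply: hA => /= /(_ I) [] /eqP; exact/negP/bpos.
rewrite A0 box_measure ?(ltW r0) // lee_fin leNgt => /negP; apply.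
by rewrite exprn_gt0 // mulr_gt0.
Qed.

End TaylorDensity.

(** * Monomials and block degrees *)

Section MonomialAverages.
Variables (R : realType) (n : nat).
Local Notation C := R[i].
Local Notation V := 'cV[C]_n.
Implicit Types (f g u v : cfun R n) (A W : set (cfun R n)).

(** Invariance under the torus of diagonal unitary matrices. *)
Definition dil_stable W := forall m : 'I_n -> C, (forall i, normc (m i) = 1) ->
  forall u, W u -> W (fun z => u (dil m z)).

Definition lin_closed W := W 0 /\ forall (a : C) u v, W u -> W v -> W (a *: u + v).

Lemma lin_closedZ W a u : lin_closed W -> W u -> W (a *: u).
Proof. by move=> [W0 WL] Wu; rewrite -[a *: u]addr0; exact: WL. Qed.

Lemma lin_closed_sum W (I : Type) (r : seq I) (c : I -> C) (F : I -> cfun R n) :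
  lin_closed W -> (forall i, W (F i)) -> W (\sum_(i <- r) c i *: F i).
Proof.
move=> [W0 WL] WF; elim: r => [|i r IH]; first by rewrite big_nil.
by rewrite big_cons; exact: WL.
Qed.

Lemma lin_closed_lspan A : lin_closed (lspan A).
Proof. by split; [exact: lspan0 | move=> a u v ? ?; apply: lspanD => //; exact: lspanZ]. Qed.

Lemma mono_dil a (m : 'I_n -> C) z :
  mono a (dil m z) = (\prod_i m i ^+ a i) * (mono a z : C).
Proof. by rewrite /mono -big_split; apply: eq_bigr => i _; rewrite mxE exprMn. Qed.

Lemma mono_neq0 a : mono a <> 0 :> cfun R n.
Proof.
move=> /(congr1 (fun u : cfun R n => u (const_mx 1) : C)) /eqP.
rewrite /mono big1 => [|i _]; first by rewrite oner_eq0.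
by rewrite mxE expr1n.
Qed.

Section Blocks.
Variables (k : nat) (bl : 'I_n -> 'I_k).
Implicit Types (s : 'I_k -> nat) (l : 'I_k -> C).

Definition bdeg (a : 'I_n -> nat) j := (\sum_(i | bl i == j) a i)%N.

Definition bmonos s : set (cfun R n) :=
  [set u | exists a : 'I_n -> nat, (forall j, bdeg a j = s j) /\ u = mono a].

Definition has_weight s u := forall l, (forall j, normc (l j) = 1) ->
  forall z, u (dil (l \o bl) z) = (\prod_j l j ^+ s j) * (u z : C).

Lemma sum_bdeg a : (\sum_j bdeg a j = \sum_i a i)%N.
Proof. by rewrite (partition_big bl xpredT). Qed.

Lemma prod_block l a : \prod_i l (bl i) ^+ a i = \prod_j l j ^+ bdeg a j.
Proof.
rewrite (partition_big bl xpredT) //=; apply: eq_bigr => j _.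
by rewrite /bdeg -prodrXr; apply: eq_bigr => i /eqP ->.
Qed.

Lemma mono_block_dil a l z : mono a (dil (l \o bl) z) = (\prod_j l j ^+ bdeg a j) * (mono a z : C).
Proof. by rewrite mono_dil (prod_block l). Qed.

(* The average of s-twisted dilates of u over the (N+1)-st roots of unity, one
   independent root per block: it keeps the monomials of block degree s modulo N + 1. *)
Definition bavg N s u : cfun R n := fun z =>
  (N.+1%:R^-1) ^+ k * \sum_(K : {ffun 'I_k -> 'I_N.+1})
    (\prod_j ((proot R N ^+ K j) ^+ s j)^-1) * (u (dil (fun i => proot R N ^+ K (bl i)) z) : C).

Fact bavg_linear N s : linear (bavg N s).
Proof.
move=> a u v; apply/funext => z; pose X : C := N.+1%:R^-1 ^+ k.
pose S f : C := \sum_(K : {ffun 'I_k -> 'I_N.+1})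
  (\prod_j ((proot R N ^+ K j) ^+ s j)^-1) * (f (dil (fun i => proot R N ^+ K (bl i)) z) : C).
change (X * S (a *: u + v) = a * (X * S u) + X * S v).
have -> : S (a *: u + v) = a * S u + S v; last by rewrite mulrDr mulrCA.
rewrite /S mulr_sumr -big_split; apply: eq_bigr => K _.
by rewrite [X in _ * X = _]/(a * _ + _) mulrDr mulrCA.
Qed.

HB.instance Definition _ N s := GRing.isLinear.Build C (cfun R n) (cfun R n) *:%R _ (bavg_linear N s).

Lemma bavg_mono N s a : bavg N s (mono a) = [forall j, bdeg a j == s j %[mod N.+1]]%:R *: mono a.
Proof.
apply/funext => z; rewrite [RHS]/(_ * _) /bavg.
under eq_bigr => K _ do rewrite (mono_block_dil a (fun j => proot R N ^+ K j)) mulrA -big_split.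
rewrite -mulr_suml mulrA; congr (_ * _).
rewrite -(bigA_distr_bigA (fun j (K : 'I_N.+1) => ((proot R N ^+ K) ^+ s j)^-1 * (proot R N ^+ K) ^+ bdeg a j)).
rewrite -[k in _ ^+ k]card_ord -prodr_const -big_split /=.
rewrite (eq_bigr _ (fun j _ => unity_root_average _ _ (prootP R N))).
case: forallP => [h|/forallP]; first by apply: big1 => j _; rewrite (h j).
by rewrite negb_forall => /existsP[j hj]; rewrite (bigD1 j) //= (negbTE hj) mul0r.
Qed.

Lemma bavg_weight N s u : has_weight s u -> bavg N s u = u.
Proof.
move=> hu; apply/funext => z; rewrite /bavg.
under eq_bigr => K _.
  rewrite (hu (fun j => proot R N ^+ K j)) => [|j]; last exact: normc_proot.
  rewrite mulrA -big_split big1 /= => [|j _]; last first.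
    by rewrite mulVf // !expf_neq0 // (prim_root_neq0 (prootP R N)).
  over.
rewrite sumr_const card_ffun !card_ord mul1r -(mulr_natl (u z : C)) natrX mulrA -exprMn mulVf ?pnatr_eq0 //.
by rewrite expr1n mul1r.
Qed.

Lemma bavg_in N s u W : lin_closed W -> dil_stable W -> W u -> W (bavg N s u).
Proof.
move=> LW DW Wu; rewrite (_ : bavg N s u = (N.+1%:R^-1) ^+ k *: \sum_(K : {ffun 'I_k -> 'I_N.+1})
    (\prod_j ((proot R N ^+ K j) ^+ s j)^-1) *: (fun z => u (dil (fun i => proot R N ^+ K (bl i)) z) : R[i]^o)).
  apply: lin_closedZ => //; apply: lin_closed_sum => // K.
  by apply: (DW (fun i => proot R N ^+ K (bl i))) => // i; exact: normc_proot.
by apply/funext => z; rewrite /bavg [RHS]/(_ * _) fct_sumE.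
Qed.

Lemma bmonos_monos s : bmonos s `<=` monos (\sum_j s j).
Proof. by move=> _ [a [ha ->]]; exists a; split => //; rewrite -sum_bdeg; apply: eq_bigr. Qed.

Lemma bdeg_le a d : (\sum_i a i = d)%N -> forall j, (bdeg a j <= d)%N.
Proof. by move=> <- j; rewrite -sum_bdeg (bigD1 j) //= leq_addr. Qed.

(** Once [N] is at least the total degree, block degrees congruent modulo [N + 1] are equal. *)
Lemma bavg_lspan N s u : (\sum_j s j <= N)%N -> lspan (monos (\sum_j s j)) u ->
  lspan (bmonos s) (bavg N s u).
Proof.
move=> sN; apply: (@lspan_min _ _ _ (fun u => lspan (bmonos s) (bavg N s u))).
- move=> _ [a [ha ->]]; rewrite bavg_mono; case: forallP => [h|_]; last by rewrite scale0r; exact: lspan0.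
  rewrite scale1r; apply: lspan_gen; exists a; split => // j.
  move: (h j); rewrite !modn_small ?ltnS => [/eqP //||].
    by apply: leq_trans sN; rewrite (bigD1 j) //= leq_addr.
  exact: leq_trans (bdeg_le ha j) sN.
- by rewrite linear0; exact: lspan0.
- by move=> a u0 v hu hv; rewrite linearP; apply: lspanD => //; exact: lspanZ.
Qed.

Lemma lspan_weight s u : lspan (bmonos s) u -> has_weight s u.
Proof.
apply: lspan_min => [_ [a [ha ->]]|l hl z|a u0 v hu hv l hl z].
- by move=> l hl z; rewrite mono_block_dil; congr (_ * _); apply: eq_bigr => j _; rewrite ha.
- by rewrite [RHS]mulr0.
- rewrite [LHS]/(a * _ + _) hu // hv // [X in _ = _ * X]/(a * _ + _).
  by rewrite mulrDr mulrCA.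
Qed.

Lemma lspan_bmonos_frechet s u : lspan (bmonos s) u -> frechet u.
Proof.
apply: lspan_min => [_ [a [_ ->]]||a u0 v hu hv]; first exact: frechet_mono.
  exact: (frechet_cst 0).
by apply: frechetD => //; exact: frechetZ.
Qed.

(* Constant multipliers force degree \sum_j s j; block averages then cut out the block degrees. *)
Lemma weight_lspan s u : frechet u -> has_weight s u -> lspan (bmonos s) u.
Proof.
move=> du hu; pose d := (\sum_j s j)%N.
have avgE N : avgf N d u = u.
  apply/funext => z; rewrite /avgf /root_avg.
  under eq_bigr => K _.
    rewrite -dil_cst (hu (fun=> _)) => [|j]; last exact: normc_proot.
    rewrite prodrXr mulrA mulVf ?mul1r; last first.
      by rewrite !expf_neq0 // (prim_root_neq0 (prootP R N)).
    over.
  by rewrite sumr_const card_ord -(mulr_natl (u z : C)) mulrA mulVf ?mul1r // pnatr_eq0.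
(* All averages of [u] in degree [d] equal [u], hence so does their limit. *)
have tE : tcoef u d = u.
  apply/funext => z; apply/esym/subr0_eq/normc_small0 => e e0.
  by have [N0 hN0] := tcoef_avgf_cvg d z du e0; have := hN0 N0 (leqnn _); rewrite avgE.
rewrite -(bavg_weight d hu); apply: bavg_lspan => //.
by apply: homogeneous_lspan => //; rewrite -tE; exact: tcoef_homogeneous.
Qed.

End Blocks.

(** When every coordinate is its own block, block degrees are exponents and the average isolates one
    monomial. *)
Local Notation mavg := (bavg (fun i : 'I_n => i)).

Lemma bdeg_id a i : bdeg (fun i : 'I_n => i) a i = a i.
Proof. by rewrite /bdeg big_pred1_eq. Qed.

Lemma mavg_mono N d a c : (d <= N)%N -> (\sum_i a i = d)%N -> (\sum_i c i = d)%N ->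
  mavg N c (mono a) = [forall i, a i == c i]%:R *: mono c.
Proof.
have le a' i : (\sum_i a' i = d)%N -> (a' i <= d)%N by move=> <-; rewrite (bigD1 i) //= leq_addr.
move=> dN ha hc; rewrite bavg_mono.
have -> : [forall j, bdeg id a j == c j %[mod N.+1]] = [forall i, a i == c i].
  by apply: eq_forallb => i; rewrite bdeg_id !modn_small // ltnS (leq_trans _ dN) // le.
case: forallP => [h|_]; last by rewrite !scale0r.
by congr (_ *: mono _); apply/funext => i; apply/eqP.
Qed.

Lemma sum_mavg N d u : (d <= N)%N -> lspan (monos d) u ->
  u = \sum_(c : {ffun 'I_n -> 'I_N.+1}) mavg N (fun i => c i) u.
Proof.
move=> dN; apply: (@lspan_min _ _ _ (fun u => u = \sum_(c : {ffun 'I_n -> 'I_N.+1}) mavg N (fun i => c i) u)).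
- move=> _ [a [ha ->]].
  have aN i : (a i < N.+1)%N by rewrite ltnS (leq_trans _ dN) // -ha (bigD1 i) //= leq_addr.
  pose a' : {ffun 'I_n -> 'I_N.+1} := [ffun i => Ordinal (aN i)].
  rewrite (bigD1 a') //= bavg_mono big1 ?addr0 => [|c /eqP ca].
    case: forallP => [_|[]]; first by rewrite scale1r.
    by move=> i; rewrite bdeg_id ffunE.
  rewrite bavg_mono; case: forallP => [h|_]; last by rewrite scale0r.
  case: ca; apply/ffunP => i; apply/val_inj; rewrite ffunE /=.
  by move/eqP: (h i); rewrite bdeg_id !modn_small.
- by rewrite big1 // => c _; rewrite linear0.
- move=> a u0 v hu hv; rewrite {1}hu {1}hv scaler_sumr -big_split; apply: eq_bigr => c _.
  by rewrite linearP.
Qed.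

(** [u] is the sum of its [mavg] averages, and a nonzero one is a multiple of a monomial. *)
Lemma mono_in d A W u : A `<=` monos d -> lspan A u -> u <> 0 ->
  lin_closed W -> dil_stable W -> W u -> exists2 v, A v & W v.
Proof.
move=> Ad Au u0 LW DW Wu; apply: contrapT => hN; apply: u0.
rewrite (sum_mavg (leqnn d) (lspanS Ad Au)) big1 // => c _.
(* The span records that the surviving monomial belongs to [A], which need not contain all monomials
   of degree [d]. *)
suff : lspan [set v | A v /\ v = mono (fun i => c i : nat)] (mavg d (fun i => c i) u).
  move=> [N [x [w [hw E]]]]; move: E (hw); case: N x w {hw} => [|N] x w E hw; first by rewrite E big_ord0.
  have {}E : mavg d (fun i => c i) u = (\sum_l x l) *: mono (fun i => c i : nat).
    by rewrite E scaler_suml; apply: eq_bigr => l _; have [_ ->] := hw l.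
  have [x0|x0] := eqVneq (\sum_l x l) 0; first by rewrite E x0 scale0r.
  case: hN; exists (w ord0); have [Aw wE] := hw ord0; first by [].
  rewrite wE -[mono _]scale1r -(mulVf x0) -scalerA -E; apply: lin_closedZ => //.
  exact: bavg_in.
move: Au; apply: (@lspan_min _ _ _ (fun u => lspan _ (mavg d (fun i => c i) u))).
- move=> v Av; have [a [ha va]] := Ad _ Av; rewrite va bavg_mono.
  case: forallP => [h|_]; last by rewrite scale0r; exact: lspan0.
  rewrite scale1r; apply: lspan_gen; split; first by rewrite -va.
  congr mono; apply/funext => i; move/eqP: (h i); rewrite bdeg_id !modn_small //.
  by rewrite ltnS -ha (bigD1 i) //= leq_addr.
- by rewrite linear0; exact: lspan0.
- by move=> a u0 v hu hv; rewrite linearP; apply: lspanD => //; exact: lspanZ.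
Qed.

End MonomialAverages.

(** * Irreducibility of the weight spaces *)

Section Irreducibility.
Variables (R : realType) (n k : nat) (bl : 'I_n -> 'I_k) (fst : 'I_k -> 'I_n).
Local Notation C := R[i].
Local Notation V := 'cV[C]_n.
Hypothesis fstK : forall j, bl (fst j) = j.
Implicit Types (s : 'I_k -> nat) (u v : cfun R n) (W : set (cfun R n)).

(** The exponents of the monomial in the first coordinates of the blocks. *)
Let top s i := if i == fst (bl i) then s (bl i) else 0%N.

Lemma bdeg_top s j : bdeg bl (top s) j = s j.
Proof.
rewrite /bdeg (bigD1 (fst j)) ?fstK //= /top fstK eqxx big1 ?addn0 // => i /andP[/eqP <-].
by move=> /negbTE ->.
Qed.

Lemma prod_top s (F : 'I_n -> C) : \prod_i F i ^+ top s i = \prod_j F (fst j) ^+ s j.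
Proof.
rewrite (partition_big bl xpredT) //=; apply: eq_bigr => j _.
rewrite (bigD1 (fst j)) ?fstK //= /top fstK eqxx big1 ?mulr1 // => i /andP[/eqP <-].
by move=> /negbTE ->; rewrite expr0.
Qed.

Let e0 : V := \col_i (i == fst (bl i))%:R.

(** The coefficient at [mono (top s)] is the value at [e0], where the first coordinates are 1 and
    the others 0: every other monomial of these block degrees contains a vanishing coordinate. *)
Lemma mavg_top s u : lspan (bmonos bl s) u ->
  bavg id (\sum_j s j) (top s) u = (u e0 : C) *: mono (top s).
Proof.
have sum_top : (\sum_i top s i = \sum_j s j)%N.
  by rewrite -(sum_bdeg bl); apply: eq_bigr => j _; exact: bdeg_top.
apply: (@lspan_min _ _ _ (fun u => bavg id (\sum_j s j) (top s) u = (u e0 : C) *: mono (top s))).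
- move=> _ [a [ha ->]]; rewrite (@mavg_mono _ _ _ (\sum_j s j)) ?sum_top //; last first.
    by rewrite -(sum_bdeg bl); apply: eq_bigr => j _.
  congr (_ *: _); case: forallP => [h|/forallP].
    rewrite /mono big1 // => i _; rewrite mxE (eqP (h i)) /top.
    by case: ifP; rewrite ?expr1n ?expr0.
  rewrite negb_forall => /existsP[i ai].
  have [i' i'0 ai'] : exists2 i', i' != fst (bl i') & a i' != 0%N.
    apply: contrapT => hN.
    have a0 i' : i' != fst (bl i') -> a i' = 0%N.
      by move=> hi; apply/eqP; apply: contrapT => /negP h; apply: hN; exists i'.
    case/negP: ai; rewrite /top; case: (eqVneq i (fst (bl i))) => [E|/a0 -> //].
    rewrite -(ha (bl i)) /bdeg (bigD1 i) ?eqxx //= big1 ?addn0 // => i' /andP[/eqP bi' hi'].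
    by apply: a0; rewrite bi' -E.
  by rewrite /mono (bigD1 i') //= mxE (negbTE i'0) expr0n (negbTE ai') mul0r.
- by rewrite linear0 scale0r.
- by move=> a u0 v hu hv; rewrite linearP /= hu hv scalerA -scalerDl.
Qed.

(** Repeated factors become a single product over a flat index set, the form in which distributivity
    expands a product of linear forms. *)
Lemma big_sig1 (S : Type) (idx : S) (op : Monoid.com_law idx) (b : 'I_n -> nat) (F : 'I_n -> S) :
  \big[op/idx]_(x < (\sum_i b i)%N) F (tagnat.sig1 x) = \big[op/idx]_i \big[op/idx]_(l < b i) F i.
Proof. by rewrite sig_big_dep /= (reindex _ tagnat.sig_bij_on). Qed.

Lemma prod_mono (I : finType) (f : I -> 'I_n) (z : V) :
  \prod_x z (f x) 0 = mono (fun i => \sum_(x | f x == i) 1)%N z :> C.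
Proof.
rewrite (partition_big f xpredT) //= /mono; apply: eq_bigr => i _.
by rewrite -prodrXr; apply: eq_bigr => x /eqP ->.
Qed.

Variable M : 'M[C]_n.
Hypotheses (M_block : forall i i', bl i != bl i' -> M i i' = 0)
  (M_row : forall i, 0 < M (fst (bl i)) i) (M_col : forall i, M i (fst (bl i)) != 0).

Lemma M_ge0 j i : 0 <= M (fst j) i.
Proof.
have [<-|ji] := eqVneq (bl i) j; first exact/ltW/M_row.
by rewrite M_block // fstK eq_sym.
Qed.

(** By [mavg_top] this is the coefficient at [mono (top s)] of [mono a] composed with [M]. The
    coordinates of [M *m e0] are the nonzero entries [M i (fst (bl i))]. *)
Lemma mono_M_e0 a : mono a (M *m e0) != 0 :> C.
Proof.
apply/prodf_neq0 => i _; rewrite expf_neq0 // mxE (bigD1 (fst (bl i))) //= mxE fstK eqxx mulr1.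
rewrite big1 ?addr0 // => i' i'i; rewrite mxE; have [E|] := eqVneq i' (fst (bl i')); last by rewrite mulr0.
rewrite M_block ?mul0r //; apply: contra i'i => /eqP ->; by rewrite -E.
Qed.

(* Expanding the product of the linear forms (M z)_(fst j), all of whose coefficients
   are nonnegative, the choice [tagnat.sig1] contributes a positive multiple of mono b. *)
Lemma mavg_top_M s b : (forall j, bdeg bl b j = s j) ->
  exists2 c : C, c != 0 & bavg id (\sum_j s j) b (fun z => mono (top s) (M *m z)) = c *: mono b.
Proof.
move=> hb; pose d := (\sum_i b i)%N.
have sb : (\sum_j s j = d)%N by rewrite /d -(sum_bdeg bl); apply: eq_bigr.
pose L (x : 'I_d) i := M (fst (bl (tagnat.sig1 x))) i.
have E : (fun z => mono (top s) (M *m z)) = \sum_(f : {ffun 'I_d -> 'I_n})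
    (\prod_x L x (f x)) *: mono (fun i => \sum_(x | f x == i) 1)%N.
  apply/funext => z; rewrite {1}/mono prod_top fct_sumE.
  under eq_bigr do rewrite -hb.
  rewrite -(prod_block bl (fun j => (M *m z) (fst j) 0)).
  rewrite (_ : \prod_i _ = \prod_i \prod_(l < b i) (M *m z) (fst (bl i)) 0); last first.
    by apply: eq_bigr => i _; rewrite prodr_const card_ord.
  rewrite -(big_sig1 _ b (fun i => (M *m z) (fst (bl i)) 0)).
  transitivity (\prod_x \sum_i L x i * z i 0); first by apply: eq_bigr => x _; rewrite mxE.
  rewrite (bigA_distr_bigA (fun (x : 'I_d) i => L x i * z i 0)).
  by apply: eq_bigr => f _; rewrite big_split /= prod_mono.
have deg (f : {ffun 'I_d -> 'I_n}) : (\sum_i \sum_(x | f x == i) 1 = d)%N.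
  by rewrite (sum_bdeg f (fun=> 1%N)) sum1_card card_ord.
exists (\sum_(f : {ffun 'I_d -> 'I_n}) (\prod_x L x (f x)) *
    [forall i, (\sum_(x | f x == i) 1)%N == b i]%:R).
  pose f0 : {ffun 'I_d -> 'I_n} := [ffun x => tagnat.sig1 x].
  rewrite (bigD1 f0) //=; apply/lt0r_neq0/ltr_pwDl; last first.
    apply: sumr_ge0 => f _; apply: mulr_ge0; last exact: ler0n.
    by apply: prodr_ge0 => x _; exact: M_ge0.
  apply: mulr_gt0; first by apply: prodr_gt0 => x _; rewrite ffunE; exact: M_row.
  case: forallP => [_|[] i]; first exact: ltr01.
  apply/eqP; rewrite big_mkcond; under eq_bigr do rewrite ffunE.
  rewrite (big_sig1 _ b (fun i' => if i' == i then 1%N else 0%N)) (bigD1 i) //= eqxx sum1_card card_ord.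
  by rewrite big1 ?addn0 // => i' /negbTE ->; rewrite big1.
rewrite E linear_sum scaler_suml; apply: eq_bigr => f _.
by rewrite linearZ /= (@mavg_mono _ _ _ d) ?sb // scalerA.
Qed.

Lemma weight_irreducible s W u : lin_closed W -> dil_stable W ->
  (forall v, W v -> W (fun z => v (M *m z))) -> W `<=` lspan (bmonos bl s) ->
  W u -> u <> 0 -> lspan (bmonos bl s) `<=` W.
Proof.
move=> LW DW MW Ws Wu u0.
have [_ [a [_ ->]] Wa] := mono_in (@bmonos_monos R n k bl s) (Ws _ Wu) u0 LW DW Wu.
have Wt : W (mono (top s)).
  have := bavg_in id (\sum_j s j) (top s) LW DW (MW _ Wa).
  rewrite (mavg_top (Ws _ (MW _ Wa))) => /(lin_closedZ (mono a (M *m e0) : C)^-1 LW).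
  by rewrite scalerA mulVf ?scale1r // mono_M_e0.
apply: lspan_min; [|by case: LW|by case: LW] => _ [b [hb ->]].
have [c c0 Ec] := mavg_top_M hb.
have := bavg_in id (\sum_j s j) b LW DW (MW _ Wt).
by rewrite Ec => /(lin_closedZ c^-1 LW); rewrite scalerA mulVf ?scale1r.
Qed.

End Irreducibility.

(** * Tensors and block unitary matrices *)

Section Tensors.
Variables (R : realType) (k : nat) (b : 'I_k -> nat).
Local Notation C := R[i].
Local Notation n := (\sum_j b j)%N.
Local Notation V := 'cV[C]_n.
Local Notation bl := (@tagnat.sig1 k b).
Implicit Types (s : 'I_k -> nat).

Lemma submxcolE (z : V) j l : submxcol z j l 0 = z (tagnat.Rank j l) 0.
Proof. by rewrite mxE. Qed.

Lemma tensor_frechet s (p : forall j, cfun R (b j)) : (forall j, homog_poly (s j) (p j)) ->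
  frechet (fun z : V => \prod_j (p j (submxcol z j) : C)).
Proof.
move=> hp; apply: frechet_prod => j; have [P hP] := hp j.
rewrite (_ : (fun _ => _) = fun z : V => \sum_(m <- mpoly.msupp (mpoly.mpoly_of_dhomog P))
    mpoly.mcoeff m (mpoly.mpoly_of_dhomog P) * \prod_l z (tagnat.Rank j l) 0 ^+ (mpoly.fun_of_multinom m l)).
  apply: frechet_sum => m; apply: frechetZ; apply: frechet_prod => l; exact: frechet_coordX.
apply/funext => z; rewrite hP mpoly.mevalE; apply: eq_bigr => m _; congr (_ * _).
by apply: eq_bigr => l _; rewrite submxcolE.
Qed.

Lemma meval_dhomog_scale m d (P : mpoly.dhomog m C d) (c : C) (x y : 'I_m -> C) :
  (forall i, x i = c * y i) ->
  mpoly.meval x (mpoly.mpoly_of_dhomog P) = c ^+ d * mpoly.meval y (mpoly.mpoly_of_dhomog P).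
Proof.
move=> xy; rewrite !mpoly.mevalE mulr_sumr; pose I := mpoly.mpoly_multinom__canonical__eqtype_Equality m.
rewrite (@big_seq _ _ _ I) [RHS](@big_seq _ _ _ I); apply: eq_bigr => a ha.
rewrite mulrCA; congr (_ * _).
have <- : (\sum_i mpoly.fun_of_multinom a i = d)%N.
  by rewrite -mpoly.mdegE; apply: (@mpoly.dhomog_mf _ _ (mpoly.mpoly_mdeg__canonical__mpoly_Measure m) _ _ _ _ ha); case: (P).
by rewrite -prodrXr -big_split; apply: eq_bigr => i _; rewrite xy exprMn.
Qed.

Lemma tensor_weight s (p : forall j, cfun R (b j)) : (forall j, homog_poly (s j) (p j)) ->
  has_weight bl s (fun z : V => \prod_j (p j (submxcol z j) : C)).
Proof.
move=> hp l hl z; rewrite -big_split; apply: eq_bigr => j _ /=; have [P hP] := hp j.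
by rewrite !hP; apply: meval_dhomog_scale => i; rewrite !mxE /= tagnat.Rank1K.
Qed.

Lemma mono_tensor s (a : 'I_n -> nat) : (forall j, bdeg bl a j = s j) ->
  exists2 p : forall j, cfun R (b j), forall j, homog_poly (s j) (p j)
    & forall z, mono a z = \prod_j (p j (submxcol z j) : C).
Proof.
move=> ha; have sumE (S : Type) (idx : S) (op : Monoid.com_law idx) (F : 'I_n -> S) :
    \big[op/idx]_i F i = \big[op/idx]_j \big[op/idx]_(l < b j) F (tagnat.Rank j l).
  rewrite sig_big_dep /= (reindex _ (@tagnat.rank_bij_on k b)) /=.
  by apply: eq_bigr => -[j l] _.
exists (fun j x => \prod_(l < b j) x l 0 ^+ a (tagnat.Rank j l)) => [j|z]; last first.
  rewrite /mono sumE; apply: eq_bigr => j _; apply: eq_bigr => l _.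
  by rewrite submxcolE.
pose m := mpoly.Multinom [tuple a (tagnat.Rank j l) | l < b j].
have mE l : mpoly.fun_of_multinom m l = a (tagnat.Rank j l) by rewrite mpoly.mnmE.
have hm : mpoly.mdeg m = s j.
  rewrite mpoly.mdegE -ha /bdeg [RHS]big_mkcond (sumE _ 0%N addn (fun i => if bl i == j then a i else 0%N)) /=.
  rewrite [RHS](bigD1 j) //= [X in (_ + X)%N]big1 ?addn0 => [|j' /negbTE j'j].
    by apply: eq_bigr => l _; rewrite mE tagnat.Rank1K eqxx.
  by apply: big1 => l _; rewrite tagnat.Rank1K j'j.
have hX : mpoly.mpolyX R[i] m \is mpoly.ishomog1 (s j) (mpoly.mpoly_mdeg__canonical__mpoly_Measure (b j)).
  by rewrite (mpoly.dhomogX _ (mpoly.mpoly_mdeg__canonical__mpoly_Measure _)) /= hm.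
exists (mpoly.DHomog hX) => x; rewrite mpoly.mevalX; apply: eq_bigr => l _.
by rewrite mE.
Qed.

(** A tensor is entire of weight [s], so [weight_lspan] spares the expansion of a product of
    polynomials; conversely a monomial factors along the blocks. *)
Lemma homog_tensorE s : homog_tensor s = lspan (bmonos bl s) :> set (cfun R n).
Proof.
rewrite /homog_tensor; apply/seteqP; split.
  case: (@lin_closed_lspan R n (bmonos bl s)) => L0 LL.
  apply: (lspan_min _ L0 LL) => f [p hp /funext ->]; apply: weight_lspan; first exact: tensor_frechet hp.
  exact: tensor_weight.
by apply: lspanS => _ [a [ha ->]]; exact: mono_tensor.
Qed.

End Tensors.

Section BlockUnitaries.
Variables (R : realType) (k : nat) (b : 'I_k -> nat).
Local Notation C := R[i].
Local Notation n := (\sum_j b j)%N.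
Local Notation V := 'cV[C]_n.
Local Notation bl := (@tagnat.sig1 k b).
Implicit Types (f u : cfun R n) (A : forall j, 'M[C]_(b j)) (W : set (cfun R n)).

Lemma block_actionE A f z : block_action A f z = f ((\mxdiag_j invmx (A j)) *m z).
Proof. by rewrite -[z in RHS]submxcolK mul_mxdiag_mxcol. Qed.

Lemma block_action_frechet A f : frechet f -> frechet (block_action A f).
Proof.
move=> /(frechet_affine (\mxdiag_j invmx (A j)) 0).
by rewrite (_ : (fun _ => _) = block_action A f) //; apply/funext => z; rewrite addr0 block_actionE.
Qed.

Lemma submxcol_dil (l : 'I_k -> C) (z : V) j : submxcol (dil (l \o bl) z) j = l j *: submxcol z j.
Proof. by apply/matrixP => i i'; rewrite !mxE /= tagnat.Rank1K ord1. Qed.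

Lemma dil_mxcol (l : 'I_k -> C) (B : forall j, 'cV[C]_(b j)) :
  dil (l \o bl) (\mxcol_j B j) = \mxcol_j (l j *: B j).
Proof. by apply/matrixP => i i'; rewrite !mxE ord1. Qed.

Lemma block_action_weight A f s : has_weight bl s f -> has_weight bl s (block_action A f).
Proof.
move=> hf l hl z; rewrite /block_action -hf // dil_mxcol; congr f.
by apply/eq_mxcol => j; rewrite submxcol_dil -scalemxAr.
Qed.

Lemma invmx_right m (M N : 'M[C]_m) : M *m N = 1%:M -> invmx M = N.
Proof. by move=> MN; have [Mu _] := mulmx1_unit MN; rewrite -[LHS]mulmx1 -MN mulKmx. Qed.

(** Conjugates, because the action substitutes the inverse matrix. *)
Definition dil_block (m : 'I_n -> C) j : 'M[C]_(b j) :=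
  diag_mx (\row_l conjc (m (tagnat.Rank j l))).

Lemma conjc_unit (c : C) : normc c = 1 -> conjc c * c = 1.
Proof. by move=> hc; rewrite mulrC -sqnormC sqnormE hc expr1n. Qed.

Lemma dil_block_mul m j : (forall i, normc (m i) = 1) ->
  dil_block m j *m diag_mx (\row_l m (tagnat.Rank j l)) = 1%:M.
Proof.
move=> hm; rewrite mulmx_diag; apply/matrixP => i i'; rewrite !mxE.
by rewrite conjc_unit.
Qed.

Lemma dil_block_unitary m : (forall i, normc (m i) = 1) -> block_unitary (dil_block m).
Proof.
move=> hm j; apply/unitarymxP; rewrite -[RHS](dil_block_mul j hm); congr (_ *m _).
apply/matrixP => i i'; rewrite !mxE eq_sym; have [->|_] := eqVneq; last by rewrite !mulr0n rmorph0.
by rewrite !mulr1n; apply: conjCK.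
Qed.

Lemma block_action_dil m f : (forall i, normc (m i) = 1) ->
  block_action (dil_block m) f = fun z => f (dil m z).
Proof.
move=> hm; apply/funext => z; rewrite /block_action; congr f; apply/matrixP => i i'.
rewrite ord1 mxE (invmx_right (dil_block_mul _ hm)) mul_diag_mx !mxE tagnat.sig2K //.
Qed.

Lemma block_invariant_dil_stable W :
  (forall A, block_unitary A -> forall u, W u -> W (block_action A u)) -> dil_stable W.
Proof.
by move=> hW m hm u Wu; rewrite -block_action_dil //; apply: hW => //; exact: dil_block_unitary.
Qed.

(* Up to sign, the reflection in the hyperplane orthogonal to (m, 1, ..., 1). *)
Definition house m : 'M[C]_m :=
  let w (l : 'I_m) : R := if l == 0 :> nat then m%:R else 1 in
  \matrix_(l, l') (2 / (m%:R ^+ 2 + m%:R - 1) * w l * w l' - (l == l')%:R)%:C%C.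

Lemma house_sqr m : (0 < m)%N -> house m *m house m = 1%:M.
Proof.
case: m => // m _; set c : R := 2 / (m.+1%:R ^+ 2 + m.+1%:R - 1).
pose w (l : 'I_m.+1) : R := if l == 0 :> nat then m.+1%:R else 1.
have DE : m.+1%:R ^+ 2 + m.+1%:R - 1 = m.+1%:R ^+ 2 + m%:R :> R by rewrite -(natr1 m); ring.
have D0 : m.+1%:R ^+ 2 + m.+1%:R - 1 != 0 :> R by rewrite DE gt_eqF // ltr_pwDl // exprn_gt0.
have ww : \sum_l w l ^+ 2 = m.+1%:R ^+ 2 + m.+1%:R - 1.
  rewrite big_ord_recl /w /= (eq_bigr (fun=> 1)) => [|i _]; last by rewrite expr1n.
  by rewrite sumr_const card_ord DE.
apply/matrixP => i j; rewrite !mxE.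
transitivity (\sum_l ((c * w i * w l - (i == l)%:R) * (c * w l * w j - (l == j)%:R)))%:C%C.
  by rewrite rmorph_sum; apply: eq_bigr => l _; rewrite !mxE rmorphM.
transitivity ((i == j)%:R : R)%:C%C; last by rewrite rmorph_nat.
congr (_%:C)%C.
transitivity (c ^+ 2 * w i * w j * (\sum_l w l ^+ 2) - c * w i * (\sum_l w l * (l == j)%:R) -
   c * w j * (\sum_l w l * (l == i)%:R) + \sum_l (l == i)%:R * (l == j)%:R).
  rewrite !mulr_sumr -!sumrB -big_split; apply: eq_bigr => l _ /=.
  by rewrite (eq_sym i l); ring.
have delta (x : 'I_m.+1 -> R) i' : \sum_l x l * (l == i')%:R = x i'.
  by rewrite (bigD1 i') //= eqxx mulr1 big1 ?addr0 // => l /negbTE ->; rewrite mulr0.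
rewrite !delta ww /c; move: (m.+1%:R : R) D0 (w i) (w j) => M D0 x y.
by rewrite (eq_sym j i); field.
Qed.

Lemma house_unitarymx m : (0 < m)%N -> house m \is unitarymx.
Proof.
move=> m0; apply/unitarymxP; rewrite -[RHS](house_sqr m0); congr (_ *m _).
apply/matrixP => i j; rewrite !mxE conj_Creal; first by rewrite (eq_sym j i) mulrAC.
by rewrite complex_real.
Qed.

(** For a vector [(x, 1, ..., 1)] with [x > 0] the other entries of the first row are positive
    anyway, the corner exactly when [x^2 > m - 1]; [x = m] satisfies this. *)
Lemma house_row0 m (l l' : 'I_m) : l = 0%N :> nat -> 0 < house m l l' /\ 0 < house m l' l.
Proof.
case: m l l' => [[]//|m] l l' l0; have -> : l = ord0 by exact/val_inj.
suff h : 0 < house m.+1 ord0 l' by split=> //; move: h; rewrite !mxE (eq_sym ord0 l') mulrAC.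
have DE : m.+1%:R ^+ 2 + m.+1%:R - 1 = m.+1%:R ^+ 2 + m%:R :> R by rewrite -(natr1 m); ring.
have D0 : 0 < m.+1%:R ^+ 2 + m%:R :> R by rewrite ltr_pwDl // exprn_gt0.
rewrite mxE ltcR /= DE; have [->|l'0] := eqVneq l' ord0 => /=; last first.
  have -> : (l' == 0 :> nat) = false by exact/negbTE.
  by rewrite subr0 mulr1 mulr_gt0 // divr_gt0.
rewrite subr_gt0 -mulrA mulrAC ltr_pdivlMr // mul1r -(natr1 m).
by have := ler0n R m; move: (m%:R : R) => M M0; nra.
Qed.

End BlockUnitaries.

(** * The Fock space representation *)

Section FockHilbert.
Variables (R : realType) (n : nat) (h : R -> R).
Local Notation C := R[i].
Local Notation V := 'cV[C]_n.
Local Notation RM := (measurableTypeR R).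
Local Notation T := ((n + n).-tuple RM).
Local Notation mu := (lebesgue_tuple R (n + n)).
Local Notation X := (@fock_space R n h).
Local Notation ip := (@fock_ip R n h).
Hypothesis h_meas : measurable_fun (`[0, +oo[%classic : set R) h.
Implicit Types (f g u v : cfun R n) (A B W : set (cfun R n)).

Lemma frechetB u v : frechet u -> frechet v -> frechet (u - v).
Proof.
move=> du dv; rewrite (_ : u - v = fun z => (u z : C) + -1 * (v z : C)).
  by apply: frechetD => //; exact: frechetZ.
by apply/funext => z; rewrite mulN1r.
Qed.

Lemma fqB_sym u v : fq h (u - v) = fq h (v - u).
Proof.
apply: eq_integral => x _; congr (_ * _)%:E.
by rewrite !sqnormE; congr (_ ^+ 2); exact: distc_sym.
Qed.

Lemma fock_lin_closed : lin_closed X.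
Proof.
split=> [|a u v /fock_spaceE[du qu] /fock_spaceE[dv qv]]; apply/fock_spaceE.
  by split; [exact: frechet_cst | rewrite [fq _ _]fq_cst0].
split; first by apply: frechetD => //; exact: frechetZ.
apply: fqD_lty => //; first exact: frechetZ.
by rewrite [fq _ _]fqZ // lte_mul_pinfty ?lee_fin ?sqnorm_ge0.
Qed.

Lemma fockB u v : X u -> X v -> X (u - v).
Proof.
move=> Xu Xv; rewrite addrC -scaleN1r; exact: fock_lin_closed.2.
Qed.

Lemma hnormE u : hnorm ip u = Num.sqrt (fine (fq h u)).
Proof.
congr (Num.sqrt (fine _)); apply: eq_integral => x _.
by congr EFin; rewrite /qden -sqnormC /=; case: (u _) => a c /=; rewrite !mulr0 !subr0.
Qed.

Lemma fock_fin u : X u -> fq h u \is a fin_num.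
Proof. by case/fock_spaceE => _ qu; rewrite ge0_fin_numE ?fq_ge0. Qed.

Lemma hnorm_lt u e : X u -> 0 < e -> (hnorm ip u < e) = (fq h u < (e ^+ 2)%:E)%E.
Proof.
move=> Xu e0; rewrite hnormE -[fq h u](fineK (fock_fin Xu)) lte_fin.
have q0 : 0 <= fine (fq h u) by rewrite fine_ge0 ?fq_ge0.
by rewrite -[X in _ < X](ger0_norm (ltW e0)) -sqrtr_sqr ltr_sqrt // exprn_gt0.
Qed.

Lemma ip_eq0 u : X u -> ip u u = 0 -> u = 0.
Proof.
move=> Xu u0; have [du _] := (fock_spaceE h u).1 Xu.
apply: (fq_eq0 h_meas) => //; apply/eqP; rewrite eq_le fq_ge0 andbT leNgt; apply/negP => q0.
have q1 : 0 < fine (fq h u) by rewrite fine_gt0 // q0 -ge0_fin_numE ?fq_ge0 ?fock_fin.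
by move: (hnormE u); rewrite /hnorm u0 /= sqrtr0 => /eqP; rewrite eq_sym sqrtr_eq0 leNgt q1.
Qed.

Lemma hclosure_fq A u : A `<=` X -> hclosure X ip A u ->
  forall e : R, 0 < e -> exists2 v, A v & (fq h (u - v)%R <= e%:E)%E.
Proof.
move=> AX [Xu hu] e e0; have s0 : 0 < Num.sqrt e by rewrite sqrtr_gt0.
have [v Av] := hu _ s0; rewrite (hnorm_lt (fockB Xu (AX _ Av)) s0) sqr_sqrtr ?(ltW e0) // => /ltW h1.
by exists v.
Qed.

Lemma fq_hclosure A u : A `<=` X -> X u ->
  (forall e : R, 0 < e -> exists2 v, A v & (fq h (u - v)%R <= e%:E)%E) -> hclosure X ip A u.
Proof.
move=> AX Xu hu; split=> // e e0.
have e2 : 0 < e ^+ 2 / 2 by rewrite divr_gt0 // exprn_gt0.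
have [v Av hv] := hu _ e2; exists v => //; rewrite (hnorm_lt (fockB Xu (AX _ Av)) e0).
apply: le_lt_trans hv _; rewrite lte_fin ltr_pdivrMr // ltr_pMr ?exprn_gt0 //.
by rewrite (ltr_nat R 1 2).
Qed.

Lemma hclosureS A B : A `<=` B -> hclosure X ip A `<=` hclosure X ip B.
Proof. by move=> AB u [Xu hu]; split=> // e /hu [v /AB]; exists v. Qed.

Lemma sub_hclosure A : A `<=` X -> A `<=` hclosure X ip A.
Proof.
move=> AX u Au; apply: fq_hclosure => //; first exact: AX.
move=> e e0; exists u => //; rewrite subrr [fq _ _]fq_cst0 lee_fin ltW //.
Qed.

Lemma closed_subspaceI W1 W2 : closed_subspace X ip W1 -> closed_subspace X ip W2 ->
  closed_subspace X ip (W1 `&` W2).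
Proof.
move=> [W1X W10 W1L W1c] [_ W20 W2L W2c]; split.
- by move=> u [/W1X].
- by [].
- by move=> a u v [? ?] [? ?]; split; [exact: W1L | exact: W2L].
- move=> u hu; split.
    by apply: W1c; apply: hclosureS hu => ? [].
  by apply: W2c; apply: hclosureS hu => ? [].
Qed.

Lemma closed_lin W : closed_subspace X ip W -> lin_closed W.
Proof. by case. Qed.

(* A function changing sign under a measure-preserving rotation has integral 0,
   integrable or not: both parts have the same integral, and fine (+oo - +oo) = 0. *)
Lemma Rintegral_odd (m : 'I_n -> C) (g : V -> R) : (forall i, normc (m i) = 1) ->
  measurable_fun setT (fun x : T => g (cvec x)) ->
  (forall z, g (dil m z) = - g z) -> \int[mu]_x g (cvec x) = 0.
Proof.
move=> hm mg og; rewrite /Rintegral integralE.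
have [||_] := @integral_dil R n m (fun z => (Num.max (g z) 0)%:E) hm.
- by apply/measurable_EFinP; apply: measurable_maxr.
- by move=> z; rewrite lee_fin le_max lexx orbT.
move=> E; set a := (X in (X - _)%E); set c := (X in (_ - X)%E).
have ac : c = a.
  rewrite /a /c; transitivity (\int[mu]_x (Num.max (g (cvec x)) 0)%:E)%E; last first.
    by apply: eq_integral => x _; rewrite funeposE -EFin_max.
  by rewrite -E; apply: eq_integral => x _; rewrite funenegE -EFinN -EFin_max og.
by rewrite ac; case: (a) => [r| |] //=; rewrite subrr.
Qed.

Lemma cmeas_conj f : cmeas f -> cmeas (fun z => conjc (f z : C)).
Proof.
move=> [fr fi]; split.
  rewrite (_ : (fun _ => _) = fun x : T => complex.Re (f (cvec x) : C)) //.
  by apply/funext => x; case: (f _).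
rewrite (_ : (fun _ => _) = fun x : T => - complex.Im (f (cvec x) : C)); first exact: measurable_funN.
by apply/funext => x; case: (f _).
Qed.

Lemma ip_odd u v (m : 'I_n -> C) : frechet u -> frechet v -> (forall i, normc (m i) = 1) ->
  (forall z, (u (dil m z) : C) * conjc (v (dil m z)) = - ((u z : C) * conjc (v z))) -> ip u v = 0.
Proof.
move=> du dv hm huv.
pose F z : C := (u z : C) * conjc (v z) * (fock_weight h z)%:C%C.
have oF z : F (dil m z) = - F z by rewrite /F huv fock_weight_dil // mulNr.
have mF : cmeas F.
  apply: cmeasM; first by apply: cmeasM; [exact: cmeas_frechet | exact/cmeas_conj/cmeas_frechet].
  by split; [exact: measurable_weight | exact: measurable_cst].
apply: complex_eqP => /=.
  by apply: (Rintegral_odd (g := fun z => complex.Re (F z)) hm mF.1) => z; rewrite oF; case: (F z).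
by apply: (Rintegral_odd (g := fun z => complex.Im (F z)) hm mF.2) => z; rewrite oF; case: (F z).
Qed.

End FockHilbert.

Section BlockRepresentation.
Variables (R : realType) (k : nat) (b : 'I_k -> nat) (h : R -> R).
Local Notation C := R[i].
Local Notation n := (\sum_j b j)%N.
Local Notation V := 'cV[C]_n.
Local Notation RM := (measurableTypeR R).
Local Notation T := ((n + n).-tuple RM).
Local Notation mu := (lebesgue_tuple R (n + n)).
Local Notation bl := (@tagnat.sig1 k b).
Local Notation X := (@fock_space R n h).
Local Notation ip := (@fock_ip R n h).
Local Notation U := (@block_unitary R k b).
Local Notation act := (@block_action R k b).
Local Notation E := (@homog_tensor R k b).
Hypotheses (n_ge1 : (1 <= n)%N) (b_gt0 : forall j, (0 < b j)%N)
  (h_ge0 : forall r, 0 <= r -> 0 <= h r)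
  (h_meas : measurable_fun (`[0, +oo[%classic : set R) h)
  (h_int : forall m : nat, (\int[@lebesgue_measure R]_(r in `[0%R, +oo[)
     (r ^+ (2 * m + 2 * n - 1) * expR (- 2 * h r))%:E < +oo)%E).
Implicit Types (s : 'I_k -> nat) (u v : cfun R n) (W : set (cfun R n)).

Lemma mono_fock a : X (mono a).
Proof. by apply/fock_spaceE; split; [exact: frechet_mono | exact: (fq_mono_lty n_ge1 h_ge0 h_meas h_int)]. Qed.

Lemma mono_E a : E (bdeg bl a) (mono a).
Proof. by rewrite homog_tensorE; apply: lspan_gen; exists a. Qed.

Lemma tensor_fock s : E s `<=` X.
Proof.
rewrite homog_tensorE; have [X0 XL] := fock_lin_closed n h_meas.
by apply: lspan_min => // _ [a [_ ->]]; exact: mono_fock.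
Qed.

Lemma tensor_lin s : lin_closed (E s).
Proof. by rewrite homog_tensorE; exact: lin_closed_lspan. Qed.

(** The intrinsic description from which closedness, invariance, orthogonality and inequivalence
    follow. *)
Lemma tensorP s u : E s u <-> frechet u /\ has_weight bl s u.
Proof.
rewrite homog_tensorE; split=> [Eu|[du wu]]; last exact: weight_lspan.
by split; [exact: lspan_bmonos_frechet Eu | exact: lspan_weight].
Qed.

(** The defect [D w] of the weight condition depends continuously on [w] and vanishes on [E s]. On
    the closure it has norm 0, hence is 0 everywhere by [fq_eq0]. *)
Lemma tensor_closed s : closed_subspace X ip (E s).
Proof.
have [E0 EL] := tensor_lin s; split=> //; first exact: tensor_fock.
move=> u hu; have [du _] := (fock_spaceE h u).1 hu.1; apply/tensorP; split=> // l hl z.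
pose c := \prod_j l j ^+ s j; have hc : sqnorm c = 1.
  rewrite sqnormE normc_prod big1 ?expr1n // => j _.
  by rewrite normcX hl expr1n.
have hm i : normc ((l \o bl) i) = 1 by rewrite /= hl.
pose D w : cfun R n := fun z => (w (dil (l \o bl) z) : C) + - c * (w z : C).
have dd w : frechet w -> frechet (fun z => w (dil (l \o bl) z)).
  move=> /(frechet_affine (diag_mx (\row_i (l \o bl) i)) 0).
  rewrite (_ : (fun _ => _) = fun z => w (dil (l \o bl) z)) //; apply/funext => z'.
  by rewrite addr0 mul_diag_mx; congr w; apply/matrixP => i j; rewrite !mxE ord1.
have dD w : frechet w -> frechet (D w).
  by move=> dw; apply: frechetD; [exact: dd | exact: frechetZ].
suff /(congr1 (fun f : cfun R n => f z : C)) : D u = fun=> 0 by rewrite /D mulNr => /subr0_eq.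
apply: (fq_eq0 h_meas); first exact: dD.
apply/eqP; rewrite eq_le fq_ge0 andbT; apply/lee_addgt0Pr => e e0; rewrite add0e.
(* Both terms of [D (u - v)] have the norm of [u - v], so [fqD] gives [2 + 2 = 4] times its
   square. *)
have e4 : 0 < e / 4 by rewrite divr_gt0.
have [v Ev hv] := hclosure_fq h_meas (@tensor_fock s) hu e4.
have [dv wv] := (tensorP s v).1 Ev; have duv := frechetB du dv.
have -> : D u = D (u - v).
  apply/funext => z'; pose d := dil (l \o bl) z'.
  change ((u d : C) + - c * u z' = ((u d : C) - v d) + - c * ((u z' : C) - v z')).
  by rewrite [v d](wv l hl) -/c; ring.
apply: (le_trans (fqD h_meas (dd _ duv) (frechetZ _ duv))).
rewrite (fq_dil h_meas duv hm) (fqZ h_meas _ duv).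
have -> : sqnorm (- c) = 1 by rewrite sqnormE normcN -sqnormE.
have fin := fock_fin (fockB h_meas hu.1 (@tensor_fock s _ Ev)).
move: hv; rewrite mul1e -(fineK fin) -EFinM -EFinD !lee_fin; move: (fine _) => q hq.
have -> : e = 4 * (e / 4) by rewrite mulrC divfK // pnatr_eq0.
by rewrite -mulrDl -natrD ler_pM2l.
Qed.

Lemma tensor_subrep s : subrep X ip U act (E s).
Proof.
split; first exact: tensor_closed.
move=> A _ u /tensorP[du wu]; apply/tensorP; split; first exact: block_action_frechet.
exact: block_action_weight.
Qed.

(* If s j <> t j, multiplying block j by w with w^|s j - t j| = -1 changes
   the sign of u * conj v. *)
Lemma tensor_orthogonal s t u v : s <> t -> E s u -> E t v -> ip u v = 0.
Proof.
move=> st /tensorP[du wu] /tensorP[dv wv].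
have [j stj] : exists j, s j != t j.
  apply: contrapT => hN; apply: st; apply/funext => j; apply/eqP; apply: contrapT => /negP h1.
  by apply: hN; exists j.
have [w wN w1] : exists2 w : C, w ^+ s j * conjc (w ^+ t j) = -1 & normc w = 1.
  have conj_pow (w : C) d : normc w = 1 -> w ^+ d * conjc (w ^+ d) = 1.
    by move=> w1; rewrite -sqnormC sqnormE normcX w1 !expr1n.
  move: stj; rewrite neq_ltn => /orP[] lt.
    have [w wN w1] : exists2 w : C, w ^+ (t j - s j) = -1 & normc w = 1.
      by apply: complex_root_N1; rewrite subn_gt0.
    exists w => //; rewrite -(subnK (ltnW lt)) exprD wN mulN1r rmorphN /= mulrN.
    by rewrite conj_pow.
  have [w wN w1] : exists2 w : C, w ^+ (s j - t j) = -1 & normc w = 1.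
    by apply: complex_root_N1; rewrite subn_gt0.
  by exists w => //; rewrite -(subnK (ltnW lt)) exprD wN mulN1r mulNr conj_pow.
pose l j' : C := if j' == j then w else 1.
have hl j' : normc (l j') = 1 by rewrite /l; case: ifP => // _; exact: normc1.
have prodl (s' : 'I_k -> nat) : \prod_j l j ^+ s' j = w ^+ s' j.
  rewrite (bigD1 j) //= /l eqxx big1 ?mulr1 // => j' /negbTE ->.
  by rewrite expr1n.
apply: (ip_odd h_meas du dv (m := l \o bl)) => [i|z]; first exact: hl.
rewrite (wu l hl) (wv l hl) !prodl [conjc (_ * _)]rmorphM /= -[X in - X]mul1r -mulNr -wN; ring.
Qed.

Lemma subrep_dil_stable W : subrep X ip U act W -> dil_stable W.
Proof. by case=> _; exact: block_invariant_dil_stable. Qed.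

Lemma mxdiag_Rank (B : forall j, 'M[C]_(b j)) j l l' :
  (\mxdiag_j B j) (tagnat.Rank j l) (tagnat.Rank j l') = B j l l'.
Proof. by rewrite -[in RHS](submxblock_diag B j) !mxE. Qed.

Let house_block j : 'M[C]_(b j) := house R (b j).

Lemma block_action_house u : act house_block u = fun z => u ((\mxdiag_j house_block j) *m z).
Proof.
apply/funext => z; rewrite block_actionE; congr (u (_ *m _)); apply: eq_mxdiag => j.
by apply: invmx_right; exact: house_sqr.
Qed.

Let fst j := tagnat.Rank j (Ordinal (b_gt0 j)).

Let fstK j : bl (fst j) = j.
Proof. exact: tagnat.Rank1K. Qed.

Lemma tensor_irreducible s : irreducible_subrep X ip U act (E s).
Proof.
split; first exact: tensor_subrep.
  pose a i := if i == fst (bl i) then s (bl i) else 0%N.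
  exists (mono a); last exact: mono_neq0.
  rewrite homog_tensorE; apply: lspan_gen; exists a; split=> // j.
  exact: (bdeg_top fstK).
move=> W' hW' W'E; have [[u W'u u0]|hN] := pselect (exists2 u, W' u & u <> 0); last first.
  left; apply/seteqP; split=> [u W'u|_ ->]; last by case: hW' => -[].
  by apply: contrapT => u0; apply: hN; exists u.
right; apply/seteqP; split=> //; move: W'E; rewrite homog_tensorE => W'E.
apply: (weight_irreducible fstK (M := \mxdiag_j house_block j) _ _ _ _ _ _ W'E W'u u0).
- by move=> i i' /negbTE ii'; rewrite mxE ii' mxE.
- move=> i; rewrite -[X in (\mxdiag_j _) _ X]tagnat.sig2K mxdiag_Rank.
  by have [] := @house_row0 R (b (bl i)) (Ordinal (b_gt0 (bl i))) (tagnat.sig2 i) erefl.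
- move=> i; rewrite -[X in (\mxdiag_j _) X _]tagnat.sig2K mxdiag_Rank.
  by have [_ /lt0r_neq0] := @house_row0 R (b (bl i)) (Ordinal (b_gt0 (bl i))) (tagnat.sig2 i) erefl.
- exact: closed_lin hW'.1.
- exact: subrep_dil_stable.
- move=> v W'v; rewrite -block_action_house; apply: hW'.2 => // j.
  exact: house_unitarymx.
Qed.

(* Averaging over scalars puts the homogeneous components of u in W, and averaging over
   the torus then puts a monomial there. *)
Lemma irreducible_tensor W : irreducible_subrep X ip U act W -> exists s, W = E s.
Proof.
move=> [hW [u Wu u0] Wmin]; have [[WX W0 WL Wc] Wact] := hW.
have LW : lin_closed W by [].
have DW := subrep_dil_stable hW.
have [du qu] := (fock_spaceE h u).1 (WX _ Wu).
have Wt d : W (tcoef u d).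
  apply: Wc; apply: (fq_hclosure h_meas WX).
    by apply/fock_spaceE; split; [exact: frechet_tcoef | exact: tcoef_lty].
  move=> e e0; have [D0 hD] := taylor_density h_meas du qu e0.
  (* [D0] makes the Taylor remainder small, and [d <= N] lets the average isolate degree [d]. *)
  pose N := maxn D0 d; exists (avgf N d u).
    rewrite (_ : avgf N d u = N.+1%:R^-1 *: \sum_(K < N.+1) ((proot R N ^+ K) ^+ d)^-1 *:
        (fun z => u (dil (fun=> proot R N ^+ K) z) : R[i]^o)).
      apply: lin_closedZ => //; apply: lin_closed_sum => // K; apply: (DW (fun=> _)) => // i.
      exact: normc_proot.
    apply/funext => z; rewrite [RHS]/(_ * _) fct_sumE; congr (_ * _).
    by apply: eq_bigr => K _; rewrite -dil_cst.
  rewrite fqB_sym; apply: le_trans (avgf_tcoef_le h_meas (leq_maxr _ _) du qu) _.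
  by apply: hD; rewrite leqW // leq_maxl.
have [d td] : exists d, tcoef u d <> 0.
  apply: contrapT => hN; apply: u0; apply: (fq_eq0 h_meas) => //.
  apply/eqP; rewrite eq_le fq_ge0 andbT; apply/lee_addgt0Pr => e e0; rewrite add0e.
  have [D0 /(_ _ (leqnn _))] := taylor_density h_meas du qu e0.
  rewrite (_ : (fun z => _) = u) //; apply/funext => z; rewrite big1 ?subr0 // => j _.
  by have -> : tcoef u j = 0; first (by apply: contrapT => tj; apply: hN; exists j).
have Mt : lspan (@monos R n d) (tcoef u d).
  by apply: homogeneous_lspan; [exact: frechet_tcoef | exact: tcoef_homogeneous].
have [v [a [_ ->]] Wa] := mono_in (fun=> id) Mt td LW DW (Wt d).
exists (bdeg bl a); pose s := bdeg bl a.
(* The intersection contains [mono a]. Irreducibility of [W] makes it all of [W], and irreducibility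
   of [E s] then gives equality. *)
have hWE : subrep X ip U act (W `&` E s).
  split; first by apply: closed_subspaceI; [case: hW | exact: tensor_closed].
  by move=> A hA w [Ww Ew]; split; [exact: Wact | exact: (tensor_subrep s).2].
have WE : W `<=` E s.
  have [|W1|W1] := Wmin _ hWE; first by move=> w [].
    suff : [set 0] (mono a : cfun R n) by move/mono_neq0.
    by rewrite -W1; split => //; exact: mono_E.
  by move=> w; rewrite -W1 => -[].
have [_ _ /(_ W hW WE) [W1|//]] := tensor_irreducible s.
by move: Wu; rewrite W1.
Qed.

(** An intertwiner commutes with the block scalars, so its image consists of elements of weight
    [s]. *)
Lemma equivalent_tensor s W : W `<=` X -> equivalent_subrep ip U act (E s) W -> W `<=` E s.
Proof.
move=> WX [F [FW FL _ Fact]] v Wv; apply/tensorP; split; first by case/fock_spaceE: (WX _ Wv).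
move: Wv; rewrite -FW => -[u Eu <-] l hl z.
have [E0 EL] := tensor_lin s; have F0 : F 0 = 0.
  by have := FL 1 0 0 E0 E0; rewrite !scale1r addr0 => /eqP; rewrite -subr_eq0 opprD addNKr oppr_eq0 => /eqP.
have hm i : normc ((l \o bl) i) = 1 by rewrite /= hl.
have := Fact _ (dil_block_unitary hm) _ Eu; rewrite !block_action_dil //.
have -> : (fun z => u (dil (l \o bl) z)) = (\prod_j l j ^+ s j) *: u + 0.
  by rewrite addr0; apply/funext => z'; exact: ((tensorP s u).1 Eu).2.
by rewrite FL // F0 addr0 => /(congr1 (fun f : cfun R n => f z : C)) /esym.
Qed.

(** By [equivalent_tensor], [E t] would lie in [E s] and be orthogonal to itself. *)
Lemma tensor_inequivalent s t : s <> t -> ~ equivalent_subrep ip U act (E s) (E t).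
Proof.
move=> st /(equivalent_tensor (@tensor_fock t)) ts.
have [_ [u Eu u0] _] := tensor_irreducible t; apply: u0.
apply: (ip_eq0 h_meas); first exact: tensor_fock Eu.
by apply: (tensor_orthogonal st) => //; exact: ts.
Qed.

(** All equivalent copies of [E s] already lie in [E s], which is closed. *)
Lemma tensor_isotypic s : isotypic_component X ip U act (E s) = E s.
Proof.
have [E0 EL] := tensor_lin s; apply/seteqP; split.
  move=> u hu; have [_ _ _ Ec] := tensor_closed s; apply: Ec; apply: hclosureS hu.
  by apply: lspan_min => // w [W [[[WX _ _ _] _] hW] Ww]; exact: (equivalent_tensor WX hW).
apply: (subset_trans (sub_hclosure h_meas (@tensor_fock s))); apply: hclosureS => u Eu.
apply: lspan_gen; exists (E s) => //; split; first exact: tensor_subrep.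
by exists id; split=> //; rewrite image_id.
Qed.

Lemma tensor_hilbert_sum : hilbert_direct_sum X ip E.
Proof.
have [X0 XL] := fock_lin_closed n h_meas.
have LX : lspan (\bigcup_s E s) `<=` X.
  by apply: lspan_min => // u [s _]; exact: tensor_fock.
split; [exact: tensor_closed | by move=> s t st u v; exact: tensor_orthogonal |].
apply/seteqP; split=> [u []//|u Xu]; have [du qu] := (fock_spaceE h u).1 Xu.
apply: (fq_hclosure h_meas LX Xu) => e e0.
have [D0 /(_ _ (leqnn _)) hD] := taylor_density h_meas du qu e0.
exists (\sum_(j < D0) tcoef u j).
  apply: lspan_sum => j _.
  have := homogeneous_lspan (frechet_tcoef j du) (tcoef_homogeneous j du).
  apply: lspanS => _ [a [_ ->]]; exists (bdeg bl a) => //; exact: mono_E.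
rewrite (_ : u - _ = fun z => (u z : C) - \sum_(j < D0) (tcoef u j z : C)) //.
by apply/funext => z; rewrite [LHS]/(_ - _) fct_sumE.
Qed.

End BlockRepresentation.

Theorem proposition5p1 (R : realType) (k : nat) (b : 'I_k -> nat)
    (h : R -> R)
    (n_ge1 : (1 <= \sum_j b j)%N)
    (b_gt0 : forall j, (0 < b j)%N)
    (h_ge0 : forall r, 0 <= r -> 0 <= h r)
    (h_cont : {within `[0, +oo[, continuous h})
    (h_int : forall m : nat,
       (\int[@lebesgue_measure R]_(r in `[0%R, +oo[)
          (r ^+ (2 * m + 2 * (\sum_j b j) - 1) * expR (- 2 * h r))%:E < +oo)%E) :
  multiplicity_free (fock_space h) (fock_ip h)
    (@block_unitary R k b) (@block_action R k b) /\
  isotypic_decomposition (fock_space h) (fock_ip h)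
    (@block_unitary R k b) (@block_action R k b)
    (@homog_tensor R k b).
Proof.
have h_meas : measurable_fun (`[0, +oo[%classic : set R) h.
  by apply: subspace_continuous_measurable_fun => //; exact: measurable_itv.
have hsum := tensor_hilbert_sum n_ge1 h_ge0 h_meas h_int.
have irr := tensor_irreducible n_ge1 b_gt0 h_ge0 h_meas h_int.
have iso := tensor_isotypic n_ge1 h_ge0 h_meas h_int.
split.
  exists ('I_k -> nat), (@homog_tensor R k b); split=> // s t st.
  exact: (tensor_inequivalent n_ge1 b_gt0 h_ge0 h_meas h_int st).
split=> // [s|W hW]; first by exists (homog_tensor s).
have [s ->] := irreducible_tensor n_ge1 b_gt0 h_ge0 h_meas h_int hW.
by exists s.
Qed.
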